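(* Let $k\ge1$ be an integer and let $\boldsymbol{\xi}=\{\xi_n\}_{n\ge0}$ be an i.i.d. environment with mean $\mu:=E(\xi_1)$, $0<\mu<\infty$. Consider the $(2k,\boldsymbol{\xi})$-TBRW (that is, $s=2k$). Then the TBRW is null recurrent. Furthermore: (i) If $k<\mu$, then $\mathbb{E}_{\ell+1,\mathrm{root},2k,\boldsymbol{\xi}}(\tau_{\rm exit})=\infty$ for every $\ell\ge1$. (i* ) If $\xi_1\equiv k$, or if $k=\mu$ and $$\limsup_{n\to\infty}\frac{(\log n)^2}{n}\log P\big(\xi_1>n/\log n\big)=-\infty$$ (with $\log 0=-\infty$), then $\mathbb{E}_{\ell+1,\mathrm{root},2k,\boldsymbol{\xi}}(\tau_{\rm exit})=\infty$ for every $\ell\ge1$. (ii) If $k>\mu$, then there exists $\gamma>0$ such that $\mathbb{E}_{\ell+1,\mathrm{root},2k,\boldsymbol{\xi}}(\tau_{\rm exit})\ge\gamma\ell$ for every $\ell\ge1$. Moreover, if there exists $\varepsilon>0$ such that $E(\xi_1^{2+\varepsilon})<\infty$, then $\mathbb{E}_{\ell+1,\mathrm{root},2k,\boldsymbol{\xi}}(\tau_{\rm exit})=\Theta(\ell)$, i.e. it is bounded above and below by positive constant multiples of $\ell$, with constants not depending on $\ell\ge 1$.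
   Context: **Tree Builder Random Walk (TBRW).** Parameters: an integer $s\ge1$ and an environment $\boldsymbol{\xi}=\{\xi_n\}_{n\ge0}$, a sequence of non-negative integer valued random variables with law $P$ and expectation $E$. The initial state is $(T_0,x_0)$, where here $T_0$ is a finite tree with a distinguished vertex, the root, which is the unique vertex carrying a self-loop (a single vertex with a self-loop is allowed), and $x_0\in V(T_0)$. Given a realization of $\boldsymbol{\xi}$, set $X_0=x_0$ and define inductively for $n\ge 0$: (1) if $n\equiv 0 \pmod s$, $T_{n+1}$ is obtained from $T_n$ by attaching $\xi_n$ new leaves to $X_n$; otherwise $T_{n+1}=T_n$; (2) choose uniformly at random (independently of everything else given the past and $\boldsymbol{\xi}$) one of the edges of $T_{n+1}$ incident to $X_n$ (a self-loop counts as one edge), and let $X_{n+1}$ be its other endpoint ($X_{n+1}=X_n$ if the self-loop is chosen). The law and expectation are $\mathbb{P}_{T_0,x_0,s,\boldsymbol{\xi}}$, $\mathbb{E}_{T_0,x_0,s,\boldsymbol{\xi}}$. $\mathbb{E}_{\ell+1,\mathrm{root},2k,\boldsymbol{\xi}}$ denotes expectation for the process with $s=2k$ whose initial tree consists of the root, a self-loop at the root and $\ell$ leaves attached to the root, and with $x_0=\mathrm{root}$. $\tau_{\rm exit}:=\inf\{2n: n\in\mathbb{N},\ X_{2n}\ne X_0\}$. **Recurrence.** The TBRW started from $(T_0,x_0)$ is recurrent if for every $n\ge0$, every pair $(\widetilde T,x)$ attained by $(T_n,X_n)$ with positive probability and every $z\in V(\widetilde T)$, $\mathbb{P}_{T_0,x_0,s,\boldsymbol{\xi}}\big(X_m=z\text{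 for infinitely many } m\,\big|\,T_n=\widetilde T,X_n=x\big)=1$. It is positive recurrent if it is recurrent and for all such $n$, $(\widetilde T,x)$ and $z$, the conditional expectation, given $T_n=\widetilde T$, $X_n=x$, of $\inf\{m\ge1: X_{n+m}=z\}$ is finite. It is null recurrent if it is recurrent but not positive recurrent. *)

(* Defs.v *)
From HB Require Import structures.
From mathcomp Require Import all_boot all_order all_algebra finmap.
From mathcomp Require Import all_classical all_reals all_analysis.

Set Implicit Arguments.
Unset Strict Implicit.
Unset Printing Implicit Defensive.

Import Order.TTheory GRing.Theory Num.Theory.

Local Open Scope classical_set_scope.
Local Open Scope ring_scope.

(* A finite rooted tree with vertices 0, ..., size T and root 0 is stored as the
   list T of the parents of the vertices 1, ..., size T. *)
Definition rtree := seq nat.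

Definition nvert (T : rtree) : nat := (size T).+1.

Definition is_vertex (T : rtree) (v : nat) : Prop := (v < nvert T)%N.

Definition parent (T : rtree) (v : nat) : nat := nth 0%N (0%N :: T) v.

(* Following the parents from any vertex leads to the root: this makes the
   graph with edges {parent T v, v}, 0 < v < nvert T, connected and acyclic.
   The labels need not increase along branches. *)
Definition is_rtree (T : rtree) : Prop :=
  all (fun p => (p < nvert T)%N) T /\
  forall v, is_vertex T v -> exists j, iter j (parent T) v = 0%N.

(* As parent T 0 = 0, the first edge of the list is the self-loop at the root. *)
Definition edges (T : rtree) : seq (nat * nat) :=
  [seq (parent T v, v) | v <- iota 0 (nvert T)].

Definition incident (T : rtree) (x : nat) : seq (nat * nat) :=
  [seq a <- edges T | (a.1 == x) || (a.2 == x)].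

Definition other_end (x : nat) (a : nat * nat) : nat :=
  if a.1 == x then a.2 else a.1.

(* The new leaves receive the labels nvert T, nvert T + 1, ... *)
Definition attach (T : rtree) (x j : nat) : rtree := T ++ nseq j x.

(* The root together with its self-loop and l leaves. *)
Definition star (l : nat) : rtree := nseq l 0%N.

(* T_n when the environment is e and the positions of the walker are x; it only
   depends on e_i and x_i for i < n. *)
Fixpoint tree_at (s : nat) (T0 : rtree) (e x : nat -> nat) (n : nat) : rtree :=
  if n is m.+1 then
    let T := tree_at s T0 e x m in
    if (s %| m)%N then attach T (x m) (e m) else T
  else T0.

Definition step_prob (R : realType) (T : rtree) (x y : nat) : R :=
  (count (fun a => other_end x a == y) (incident T x))%:R
    / (size (incident T x))%:R.

Definition mutually_independent (R : realType) (d : measure_display)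
    (Omega : measurableType d) (P : probability Omega R)
    (xi : nat -> {RV P >-> nat}) : Prop :=
  forall (J : {fset nat}) (B : nat -> set nat),
    P (\bigcap_(i in [set` J]) (xi i @^-1` B i)) =
    (\prod_(i <- J) fine (P (xi i @^-1` B i)))%:E.

Definition identically_distributed (R : realType) (d : measure_display)
    (Omega : measurableType d) (P : probability Omega R)
    (xi : nat -> {RV P >-> nat}) : Prop :=
  forall (i j : nat) (B : set nat), P (xi i @^-1` B) = P (xi j @^-1` B).

Definition iid (R : realType) (d : measure_display)
    (Omega : measurableType d) (P : probability Omega R)
    (xi : nat -> {RV P >-> nat}) : Prop :=
  mutually_independent xi /\ identically_distributed xi.

(* A realization of the (s, xi)-TBRW started from (T0, x0): a probability space
   with an environment distributed as xi and a walker.  The last field is the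
   conditional law of X_{n+1} given X_0, ..., X_n and the whole environment,
   written on the cylinders xi_0 = e_0, ..., xi_m = e_m with m >= n (those with
   m > n express that the walker does not anticipate the environment).  The
   space, hence P, carries the law denoted P_{T0, x0, s, xi} (walker and
   environment averaged together). *)
Record TBRW (R : realType) (d : measure_display) (OmegaE : measurableType d)
    (PE : probability OmegaE R) (xi : nat -> {RV PE >-> nat})
    (s : nat) (T0 : rtree) (x0 : nat) := MkTBRW {
  disp : measure_display;
  space : measurableType disp;
  law : probability space R;
  env : nat -> {RV law >-> nat};
  walk : nat -> {RV law >-> nat};
  env_law : forall (n : nat) (e : nat -> nat),
    law [set w | forall i, (i < n)%N -> env i w = e i] =
    PE [set w | forall i, (i < n)%N -> xi i w = e i];
  walk0 : forall w, walk 0%N w = x0;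
  walk_step : forall (n m : nat) (e x : nat -> nat) (y : nat), (n <= m)%N ->
    (law [set w | [/\ forall i, (i <= m)%N -> env i w = e i,
                      forall i, (i <= n)%N -> walk i w = x i &
                      walk n.+1 w = y]] =
     law [set w | (forall i, (i <= m)%N -> env i w = e i) /\
                  (forall i, (i <= n)%N -> walk i w = x i)]
     * (step_prob R (tree_at s T0 e x n.+1) (x n) y)%:E)%E
}.

Section Process.
Context (R : realType) (d : measure_display) (OmegaE : measurableType d).
Context (PE : probability OmegaE R) (xi : nat -> {RV PE >-> nat}).
Context (s : nat) (T0 : rtree) (x0 : nat) (W : TBRW xi s T0 x0).

Definition tree (n : nat) (w : space W) : rtree :=
  tree_at s T0 (fun i => env W i w) (fun i => walk W i w) n.

Definition state_event (n : nat) (T : rtree) (x : nat) : set (space W) :=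
  [set w | tree n w = T /\ walk W n w = x].

Definition attained (n : nat) (T : rtree) (x : nat) : Prop :=
  (0 < law W (state_event n T x))%E.

Definition cond_prob (A B : set (space W)) : R :=
  fine (law W (A `&` B)) / fine (law W B).

Definition cond_expectation (f : space W -> \bar R) (B : set (space W)) : \bar R :=
  (((fine (law W B))^-1)%:E * \int[law W]_(w in B) f w)%E.

(* The infima are taken in the extended reals, so that inf(empty) = +oo. *)
Definition hitting_after (n z : nat) (w : space W) : \bar R :=
  ereal_inf [set (m%:R)%:E | m in [set m | (1 <= m)%N /\ walk W (n + m)%N w = z]].

Definition tau_exit (w : space W) : \bar R :=
  ereal_inf [set ((2 * n)%:R)%:E
            | n in [set n | walk W (2 * n)%N w <> walk W 0%N w]].

Definition expected_exit_time : \bar R := (\int[law W]_w tau_exit w)%E.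

Definition recurrent : Prop :=
  forall (n : nat) (T : rtree) (x : nat), attained n T x ->
  forall z, is_vertex T z ->
    cond_prob (lim_sup_set (fun m => [set w | walk W m w = z]))
              (state_event n T x) = 1.

Definition positive_recurrent : Prop :=
  recurrent /\
  forall (n : nat) (T : rtree) (x : nat), attained n T x ->
  forall z, is_vertex T z ->
    (cond_expectation (hitting_after n z) (state_event n T x) < +oo)%E.

Definition null_recurrent : Prop := recurrent /\ ~ positive_recurrent.

End Process.

(* Main.v *)
Require Import Defs.
From HB Require Import structures.
From mathcomp Require Import finmap.
From mathcomp Require Import all_boot all_order all_algebra.
From mathcomp Require Import all_classical all_reals all_analysis.
From mathcomp Require Import measurable_realfun.
From mathcomp Require Import zify ring lra.

(* Every part is proved with potential functions of the current tree and position,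
   computed one step at a time and summed over time against the law of the process.

   Exit time.  On the event that the walker is at the root at the times 0, 2, ..., 2n,
   the tree is a star and the root has degree D = l + 1 + (leaves added so far); two
   more steps bring the walker back to the root with probability 1 - (D - 1) / D^2.
   The expected exit time is twice the sum over n of the probability a_n of this event.
   A function f of D and of the phase in the growth period with
   1 + (mean of f after a double step) <= f gives sum a_n <= f(start); an affine f
   works when mu < k.  Conversely, f <= c + (mean of f after a double step) with f bounded
   gives f(start) <= c * sum a_n; f(D) = D ln(N / D)_+ works if the number of leaves,
   truncated if needed, has mean at least k and a second moment, and N -> oo.

   Recurrence.  Two facts are combined.  A vertex visited infinitely often passes this
   property to its neighbours: ln D, D being the degree of the visited vertex, grows by
   at most mu / D on average at a visit, while the probability to jump to a given
   neighbour is 1 / D, so that avoiding that neighbour while coming back infinitely often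
   has probability 0.  And some vertex is visited infinitely often, by parity: the period
   is even, so once the root is no longer visited all the growth happens in one class of
   the bipartition; the new leaves are in the other class, hence they all hang from the
   finitely many old vertices, to which the walker keeps returning.

   No positive recurrence.  The walker can be brought, at a growth time, to a vertex v of
   large depth m carrying many leaves.  As long as the root is avoided, only vertices in
   the class of v grow.  With f(D) = S sqrt D - D, the function f(degree of v) times the
   harmonic measure of v seen from the walker (against the root) drops by at most mu on
   average at each step: large degrees make f concave enough to beat the escape rate,
   of order k / (m D) per period.  So the expected time to reach the root is at least
   f(D) / mu, and S -> oo. *)

Set Implicit Arguments.
Unset Strict Implicit.
Unset Printing Implicit Defensive.

Import Order.TTheory GRing.Theory Num.Theory.
Import numFieldNormedType.Exports.

Local Open Scope classical_set_scope.
Local Open Scope ring_scope.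

(** * Integrals against countable-valued variables *)

Section Disintegration.
Context d (T : measurableType d) (R : realType) (mu : probability T R).

(** The preimage of a set is a countable union of level sets of [Z], enumerated by [unpickle], so
    [g] may be arbitrary. *)
Lemma measurable_countable_comp (C : countType) (Z : T -> C)
    (mZ : forall c, measurable (Z @^-1` [set c]))
    d' (T' : measurableType d') (g : C -> T') :
  measurable_fun setT (fun w => g (Z w)).
Proof.
move=> _ B mB; rewrite setTI.
rewrite (_ : _ @^-1` B = \bigcup_i
    (if unpickle i is Some c then (if `[< B (g c) >] then Z @^-1` [set c] else set0)
     else set0)); last first.
  apply/seteqP; split => w /=.
    by move=> Bw; exists (pickle (Z w)) => //; rewrite pickleK; case: asboolP.
  by move=> [i _]; case: (unpickle i) => //= c; case: asboolP => // Bc ->.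
apply: bigcupT_measurable => i; case: (unpickle i) => [c|]; last exact: measurable0.
by case: asboolP.
Qed.

Lemma ge0_integral_countable (C : countType) (Z : T -> C)
    (mZ : forall c, measurable (Z @^-1` [set c])) (f : T -> \bar R) :
  measurable_fun setT f -> (forall w, 0 <= f w)%E ->
  (\int[mu]_w f w =
   \sum_(i <oo) \int[mu]_(w in (pickle \o Z) @^-1` [set i]) f w)%E.
Proof.
move=> mf f0.
have mF i : measurable ((pickle \o Z) @^-1` [set i]).
  rewrite -[X in measurable X]setTI.
  exact: (measurable_countable_comp mZ (T' := nat) pickle).
have cov : \bigcup_i ((pickle \o Z) @^-1` [set i]) = setT.
  by apply/seteqP; split => // w _; exists (pickle (Z w)).
rewrite -[in LHS]cov (ge0_integral_bigcup mu mF) //.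
- by rewrite cov.
- by move=> i j _ _ [w [/= <- <-]].
Qed.

(** [K] is the conditional law of [Y] given [Z], prescribed through joint masses so that null atoms
    need no separate treatment: integrate over the level sets of [Z], then over those of [Y] inside
    each. *)
Lemma ge0_integral_disintegration (C : countType) (Z : T -> C) (Y : T -> nat)
    (mZ : forall c, measurable (Z @^-1` [set c]))
    (mY : forall y, measurable (Y @^-1` [set y]))
    (K : C -> nat -> \bar R) (G : C -> nat -> \bar R) :
  (forall c y, 0 <= K c y)%E -> (forall c y, 0 <= G c y)%E ->
  (forall c y, mu (Z @^-1` [set c] `&` Y @^-1` [set y]) =
               mu (Z @^-1` [set c]) * K c y)%E ->
  (\int[mu]_w G (Z w) (Y w) = \int[mu]_w \sum_(y <oo) K (Z w) y * G (Z w) y)%E.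
Proof.
move=> K0 G0 H.
have mZY c : measurable ((fun w => (Z w, Y w)) @^-1` [set c]).
  rewrite (_ : _ @^-1` _ = Z @^-1` [set c.1] `&` Y @^-1` [set c.2]).
    exact: measurableI.
  by case: c => c y; apply/seteqP; split=> w /= [<- <-].
have mG : measurable_fun setT (fun w => G (Z w) (Y w)).
  exact: (measurable_countable_comp mZY (fun c => G c.1 c.2)).
rewrite (ge0_integral_countable mZ) //.
rewrite [RHS](ge0_integral_countable mZ); last 2 first.
- exact: (measurable_countable_comp mZ (fun c => \sum_(y <oo) K c y * G c y)%E).
- by move=> w; apply: nneseries_ge0 => y _ _; exact: mule_ge0.
apply: eq_eseriesr => i _.
have [[w wi]|E] := pselect (exists w, pickle (Z w) = i); last first.
  rewrite (_ : _ @^-1` _ = set0) ?integral_set0//.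
  by apply/seteqP; split => // w /= wi; apply: E; exists w.
have FE : (pickle \o Z) @^-1` [set i] = Z @^-1` [set Z w].
  apply/seteqP; split => v /=; last by move=> ->.
  by rewrite -wi => /(pcan_inj pickleK).
rewrite FE; set c := Z w.
under [RHS]eq_integral => v do [rewrite inE /= => vc; rewrite vc].
rewrite integral_cst//.
under eq_integral => v do [rewrite inE /= => vc; rewrite vc].
have covZ : \bigcup_y (Z @^-1` [set c] `&` Y @^-1` [set y]) = Z @^-1` [set c].
  by apply/seteqP; split => v /=; [move=> [y _ []]|move=> vc; exists (Y v)].
rewrite -[in LHS]covZ ge0_integral_bigcup//; first last.
- by move=> y z _ _ [v [/= [_ <-] [_ <-]]].
- rewrite covZ; apply: (@measurable_funS _ _ _ _ setT) => //.
  exact: (measurable_countable_comp mY (G c)).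
- by move=> y; exact: measurableI.
set p := (X in (_ * X)%E).
have pE : p = (fine p)%:E by rewrite fineK// fin_num_measure.
rewrite muleC pE -nneseriesZl; last by move=> y _; exact: mule_ge0.
apply: eq_eseriesr => y _.
under eq_integral => v do [rewrite inE /= => -[_ ->]].
rewrite integral_cst; last exact: measurableI.
rewrite -pE; transitivity (G c y * (mu (Z @^-1` [set c]) * K c y))%E.
  by congr (_ * _)%E; exact: H.
by rewrite muleCA [(K _ _ * _)%E]muleC.
Qed.

End Disintegration.

(** * One step of the process *)

Definition upd (f : nat -> nat) (i v : nat) : nat -> nat :=
  fun j => if j == i then v else f j.

Lemma upd_eq f i v : upd f i v i = v.
Proof. by rewrite /upd eqxx. Qed.

Lemma upd_neq f i v j : j != i -> upd f i v j = f j.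
Proof. by rewrite /upd => /negbTE ->. Qed.

(** Two ranges are needed: the state at time [n] uses the environment before [n] but also the
    position at [n], so it is adapted to [n] and [n.+1]. *)
Definition adapted (A : Type) (n m : nat) (F : (nat -> nat) -> (nat -> nat) -> A) : Prop :=
  forall e e' x x', (forall i, (i < n)%N -> e i = e' i) ->
    (forall i, (i < m)%N -> x i = x' i) -> F e x = F e' x'.

Lemma adapted_tree s T0 n : adapted n n (fun e x => tree_at s T0 e x n).
Proof.
elim: n => [//|n IH] e e' x x' He Hx /=.
rewrite (IH e e' x x') ?He ?Hx // => i i_n; [apply: He|apply: Hx]; exact: ltnW.
Qed.

Local Arguments tree_at : simpl never.

Section NeighbourAverage.
Variable R : realType.
Implicit Types (T : rtree) (g : nat -> R).

Definition nbr_avg T (x : nat) g : R :=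
  (\sum_(a <- incident T x) g (other_end x a)) / (size (incident T x))%:R.

Lemma nneseries_delta (f : nat -> \bar R) (z : nat) : (forall y, 0 <= f y)%E ->
  (\sum_(y <oo) ((z == y)%:R%:E * f y) = f z)%E.
Proof.
move=> f0; rewrite (@nneseriesD1 _ _ z) ?eqxx ?mul1e //; last first.
  by move=> i _; apply: mule_ge0 => //; rewrite lee_fin ler0n.
rewrite eseries0 ?adde0 // => i _ /andP[_ iz].
by rewrite eq_sym (negbTE iz) mul0e.
Qed.

Lemma nneseries_step_prob T x g : (forall y, 0 <= g y) ->
  (\sum_(y <oo) ((step_prob R T x y)%:E * (g y)%:E) = (nbr_avg T x g)%:E)%E.
Proof.
move=> g0; rewrite /step_prob /nbr_avg.
set l := incident T x; set c := (size l)%:R.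
transitivity (\sum_(y <oo) (\sum_(a <- l) ((other_end x a == y)%:R%:E * (g y / c)%:E)))%E.
  apply: eq_eseriesr => y _.
  rewrite -EFinM mulrAC -mulrA -sum1_count natr_sum mulr_suml sumEFin; congr _%:E.
  rewrite big_mkcond /=; apply: eq_bigr => a _.
  by case: (other_end x a == y); rewrite /= ?mul0r.
rewrite nneseries_sum; last first.
  by move=> a y _; apply: mule_ge0; rewrite lee_fin ?ler0n ?divr_ge0 ?ler0n.
rewrite mulr_suml -sumEFin; apply: eq_bigr => a _.
rewrite nneseries_delta // => y; by rewrite lee_fin divr_ge0 ?ler0n.
Qed.

End NeighbourAverage.

Section OneStep.
Context (R : realType) (d : measure_display) (OmegaE : measurableType d).
Context (PE : probability OmegaE R) (xi : nat -> {RV PE >-> nat}).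
Hypothesis xi_iid : iid xi.

Lemma prob_prefix n (e : nat -> nat) :
  PE [set w | forall i, (i < n)%N -> xi i w = e i] =
  (\prod_(i < n) fine (PE (xi 1%N @^-1` [set e i])))%:E.
Proof.
have [ind idd] := xi_iid.
pose J := [fset i in iota 0 n]%fset.
rewrite (_ : [set w | _] = \bigcap_(i in [set` J]) (xi i @^-1` [set e i])); last first.
  apply/seteqP; split => w /= H i; first by rewrite /= !inE mem_iota /= => /H.
  by move=> i_n; apply: H; rewrite /= !inE mem_iota.
have -> := ind J (fun i => [set e i]).
congr _%:E; rewrite (perm_big (iota 0 n)) /=; last first.
  by apply: uniq_perm; rewrite ?fset_uniq ?iota_uniq // => i; rewrite !inE.
rewrite -[X in iota _ X]subn0 -/(index_iota 0 n) big_mkord.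
by apply: eq_bigr => i _; rewrite (idd i 1%N).
Qed.

Context (s : nat) (T0 : rtree) (x0 : nat) (W : TBRW xi s T0 x0).

Definition cyl n m (e x : nat -> nat) : set (Defs.space W) :=
  [set w | (forall i, (i < n)%N -> env W i w = e i) /\
           (forall i, (i < m)%N -> walk W i w = x i)].

Lemma measurable_env_eq i j : measurable (env W i @^-1` [set j]).
Proof. by rewrite -[X in measurable X]setTI; exact: measurable_funP. Qed.

Lemma measurable_walk_eq i j : measurable (walk W i @^-1` [set j]).
Proof. by rewrite -[X in measurable X]setTI; exact: measurable_funP. Qed.

Lemma measurable_cyl n m e x : measurable (cyl n m e x).
Proof.
rewrite (_ : cyl _ _ _ _ = (\bigcap_(i in `I_n) (env W i @^-1` [set e i])) `&`
   (\bigcap_(i in `I_m) (walk W i @^-1` [set x i]))); last by apply/seteqP; split.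
apply: measurableI; apply: bigcap_measurableType => i _.
  exact: measurable_env_eq.
exact: measurable_walk_eq.
Qed.

(** The environment is revealed up to [m] beforehand and the path then grows step by step, which
    [walk_step] allows because the walker does not anticipate. The mass therefore splits into an
    environment factor and a path factor. *)
Lemma law_cyl n m e x : (n <= m)%N ->
  law W (cyl m n.+1 e x) =
  (\prod_(i < m) fine (PE (xi 1%N @^-1` [set e i])) * ((x 0%N == x0)%:R *
   \prod_(i < n) step_prob R (tree_at s T0 e x i.+1) (x i) (x i.+1)))%:E.
Proof.
elim: n => [|n IH] nm.
  rewrite big_ord0 mulr1; have [x00|x00] := eqVneq (x 0%N) x0.
    rewrite mulr1 -prob_prefix -(env_law W m e); congr (law W _).
    apply/seteqP; split => w /=; first by case.
    by move=> H; split => // -[|//] _; rewrite walk0 x00.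
  rewrite mulr0 (_ : cyl _ _ _ _ = set0) ?measure0 //.
  by apply/seteqP; split => w // -[_ /(_ 0%N isT)]; rewrite walk0 => E; rewrite E eqxx in x00.
case: m nm IH => // m nm IH.
rewrite (_ : cyl _ _ _ _ = [set w | [/\ forall i, (i <= m)%N -> env W i w = e i,
                      forall i, (i <= n)%N -> walk W i w = x i &
                      walk W n.+1 w = x n.+1]]); last first.
  apply/seteqP; split => w /=.
    by case=> He Hx; split; [exact: He|move=> i i_n; apply: Hx; rewrite ltnS leqW|exact: Hx].
  case=> He Hx Hn; split => // i; rewrite ltnS leq_eqVlt => /orP[/eqP ->//|i_n].
  by apply: Hx; rewrite -ltnS.
rewrite walk_step // (_ : [set w | _] = cyl m.+1 n.+1 e x) //.
by rewrite (IH (ltnW nm)) -EFinM [in RHS](big_ord_recr n) /= -!mulrA.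
Qed.

(** The past is coded by a pair of finite sequences, hence countable-valued, as the disintegration
    requires. *)
Let pre n m (w : Defs.space W) : seq nat * seq nat :=
  (mkseq (fun i => env W i w) n, mkseq (fun i => walk W i w) m).

Let pre_preimage n m (c : seq nat * seq nat) :
  pre n m @^-1` [set c] =
  if (size c.1 == n) && (size c.2 == m) then cyl n m (nth 0%N c.1) (nth 0%N c.2) else set0.
Proof.
case: c => a b /=; case: ifPn => [/andP[/eqP sa /eqP sb]|ab].
  apply/seteqP; split => w /=.
    by move=> [<- <-]; split => i i_n; rewrite nth_mkseq.
  by move=> [Ha Hb]; congr pair; apply: (@eq_from_nth _ 0%N); rewrite ?size_mkseq ?sa ?sb // => i i_n;
    rewrite nth_mkseq // ?Ha ?Hb.
apply/seteqP; split => w //= -[Ea Eb].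
by move: ab; rewrite -Ea -Eb !size_mkseq !eqxx.
Qed.

Let measurable_pre n m c : measurable (pre n m @^-1` [set c]).
Proof. by rewrite pre_preimage; case: ifP => _ //; exact: measurable_cyl. Qed.

Let adapted_pre A n m (F : (nat -> nat) -> (nat -> nat) -> A) w : adapted n m F ->
  F (env W ^~ w) (walk W ^~ w) = F (nth 0%N (pre n m w).1) (nth 0%N (pre n m w).2).
Proof. by move=> aF; apply: aF => i i_n; rewrite nth_mkseq. Qed.

Lemma measurable_adapted n m d' (A : measurableType d')
    (F : (nat -> nat) -> (nat -> nat) -> A) : adapted n m F ->
  measurable_fun setT (fun w => F (env W ^~ w) (walk W ^~ w)).
Proof.
move=> aF; rewrite (_ : (fun w => _) =
    (fun w => F (nth 0%N (pre n m w).1) (nth 0%N (pre n m w).2))).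
  exact: (measurable_countable_comp (@measurable_pre n m)
    (fun c => F (nth 0%N c.1) (nth 0%N c.2))).
by apply/funext => w; exact: adapted_pre.
Qed.

(** Conditioning is on the past up to time [n], including the environment value at [n]; by [law_cyl]
    the kernel of the next position is [step_prob]. *)
Lemma integral_walk_step n (F : (nat -> nat) -> (nat -> nat) -> R) :
  adapted n.+1 n.+2 F -> (forall e x, 0 <= F e x) ->
  (\int[law W]_w (F (env W ^~ w) (walk W ^~ w))%:E =
   \int[law W]_w (nbr_avg (tree n.+1 w) (walk W n w)
      (fun y => F (env W ^~ w) (upd (walk W ^~ w) n.+1 y)))%:E)%E.
Proof.
move=> aF F0.
pose G (c : seq nat * seq nat) (y : nat) := (F (nth 0%N c.1) (upd (nth 0%N c.2) n.+1 y))%:E.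
pose K (c : seq nat * seq nat) (y : nat) :=
  (step_prob R (tree_at s T0 (nth 0%N c.1) (nth 0%N c.2) n.+1) (nth 0%N c.2 n) y)%:E.
transitivity (\int[law W]_w G (pre n.+1 n.+1 w) (walk W n.+1 w))%E.
  apply: eq_integral => w _; congr _%:E; apply: aF => i i_n /=.
    by rewrite nth_mkseq.
  rewrite /upd; case: eqVneq => [-> //|i_neq]; rewrite nth_mkseq //.
  by rewrite ltn_neqAle i_neq -ltnS.
rewrite (ge0_integral_disintegration (@measurable_pre n.+1 n.+1)
   (measurable_walk_eq n.+1) (K := K)).
- apply: eq_integral => w _.
  under eq_eseriesr => y _ do rewrite /K /G.
  rewrite nneseries_step_prob //; congr _%:E.
  rewrite nth_mkseq // /tree (@adapted_tree s T0 n.+1 (env W ^~ w) (nth 0%N (pre n.+1 n.+1 w).1)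
      (walk W ^~ w) (nth 0%N (pre n.+1 n.+1 w).2)); last 2 first.
  + by move=> i i_n; rewrite nth_mkseq.
  + by move=> i i_n; rewrite nth_mkseq.
  congr (_ / _); apply: eq_bigr => a _; apply: aF => i i_n.
    by rewrite nth_mkseq.
  rewrite /upd; case: eqVneq => // i_neq; rewrite nth_mkseq //.
  by rewrite ltn_neqAle i_neq -ltnS.
- by move=> c y; rewrite lee_fin divr_ge0 ?ler0n.
- by move=> c y; rewrite lee_fin.
- move=> [a b] y; rewrite pre_preimage /=.
  case: ifP => _; last by rewrite set0I measure0 mul0e.
  transitivity (law W (cyl n.+1 n.+2 (nth 0%N a) (upd (nth 0%N b) n.+1 y))).
    congr (law W _); apply/seteqP; split => w /=.
      move=> [[Ha Hb] Hy]; split => // i; rewrite ltnS leq_eqVlt => /orP[/eqP ->|i_n].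
        by rewrite upd_eq.
      by rewrite upd_neq ?ltn_eqF // Hb.
    move=> [Ha Hb]; split; first split => //.
      by move=> i i_n; rewrite (Hb i (leqW i_n)) upd_neq ?ltn_eqF.
    by rewrite Hb // upd_eq.
  rewrite !law_cyl // -EFinM; congr _%:E.
  have E i : (i < n.+1)%N -> upd (nth 0%N b) n.+1 y i = nth 0%N b i.
    by move=> i_n; rewrite upd_neq ?ltn_eqF.
  have ET i : (i <= n)%N -> tree_at s T0 (nth 0%N a) (upd (nth 0%N b) n.+1 y) i.+1 =
      tree_at s T0 (nth 0%N a) (nth 0%N b) i.+1.
    by move=> i_n; apply: adapted_tree => // j j_i; rewrite E //; exact: leq_trans j_i _.
  rewrite [X in _ * (_ * X) = _]big_ord_recr /= ET // (E 0%N) // (E n) // upd_eq !mulrA.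
  congr (_ * _ * _ * _); apply: eq_bigr => i _.
  by rewrite ET ?(ltnW (ltn_ord i)) // (E i (leqW (ltn_ord i))) (E i.+1) ?ltnS.
Qed.

(** The environment value at [n] is independent of what precedes, the position at time [n] included,
    because the path factor in [law_cyl] only involves earlier values. *)
Lemma integral_env_step n (F : (nat -> nat) -> (nat -> nat) -> R) :
  adapted n.+1 n.+1 F -> (forall e x, 0 <= F e x) ->
  (\int[law W]_w (F (env W ^~ w) (walk W ^~ w))%:E =
   \int[law W]_w \int[PE]_v (F (upd (env W ^~ w) n (xi 1%N v)) (walk W ^~ w))%:E)%E.
Proof.
move=> aF F0.
pose G (c : seq nat * seq nat) (y : nat) := (F (upd (nth 0%N c.1) n y) (nth 0%N c.2))%:E.
pose K (y : nat) := PE (xi 1%N @^-1` [set y]).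
have mxi y : measurable (xi 1%N @^-1` [set y]).
  by rewrite -[X in measurable X]setTI; exact: measurable_funP.
transitivity (\int[law W]_w G (pre n n.+1 w) (env W n w))%E.
  apply: eq_integral => w _; congr _%:E; apply: aF => i i_n /=; last by rewrite nth_mkseq.
  rewrite /upd; case: eqVneq => [-> //|i_neq]; rewrite nth_mkseq //.
  by rewrite ltn_neqAle i_neq -ltnS.
rewrite (ge0_integral_disintegration (@measurable_pre n n.+1)
   (measurable_env_eq n) (K := fun _ => K)).
- apply: eq_integral => w _.
  transitivity (\int[PE]_v G (pre n n.+1 w) (xi 1%N v))%E; last first.
    apply: eq_integral => v _; congr _%:E; apply: aF => i i_n; last by rewrite nth_mkseq.
    rewrite /upd; case: eqVneq => // i_neq; rewrite nth_mkseq //.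
    by rewrite ltn_neqAle i_neq -ltnS.
  rewrite (ge0_integral_disintegration (Z := fun _ => tt) _ mxi
    (K := fun _ => K) (G := fun _ => G (pre n n.+1 w))) //.
  + rewrite [RHS]integral_cst // -[LHS]mule1; congr (_ * _)%E.
    exact/esym/probability_setT.
  + by move=> u; rewrite (_ : _ @^-1` _ = setT) //; apply/seteqP; split => //; case: u.
  + by move=> _ y; rewrite lee_fin.
  + move=> u y; rewrite (_ : _ @^-1` [set u] = setT); last first.
      by apply/seteqP; split => //; case: u.
    by rewrite setTI -[LHS]mul1e; congr (_ * _)%E; exact/esym/probability_setT.
- by [].
- by move=> c y; rewrite lee_fin.
- move=> [a b] y; rewrite pre_preimage /=.
  case: ifP => _; last by rewrite set0I measure0 mul0e.
  transitivity (law W (cyl n.+1 n.+1 (upd (nth 0%N a) n y) (nth 0%N b))).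
    congr (law W _); apply/seteqP; split => w /=.
      move=> [[Ha Hb] Hy]; split => // i; rewrite ltnS leq_eqVlt => /orP[/eqP ->|i_n].
        by rewrite upd_eq.
      by rewrite upd_neq ?ltn_eqF // Ha.
    move=> [Ha Hb]; split; first split => //.
      by move=> i i_n; rewrite Ha ?leqW // upd_neq ?ltn_eqF.
    by rewrite Ha // upd_eq.
  rewrite !law_cyl // /K -[PE _](@fineK R) ?fin_num_measure // -EFinM; congr _%:E.
  rewrite big_ord_recr /= upd_eq mulrAC; congr (_ * _ * _).
    by apply: eq_bigr => i _; rewrite upd_neq ?ltn_eqF.
  congr (_ * _); apply: eq_bigr => i _; congr (step_prob R _ _ _).
  apply: adapted_tree => // j j_i; rewrite upd_neq // ltn_eqF //.
  by apply: leq_trans j_i _.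
Qed.

End OneStep.

(** * Means of functions of one environment value *)

Section Mean.
Context (R : realType) (d : measure_display) (OmegaE : measurableType d).
Context (PE : probability OmegaE R) (X : {RV PE >-> nat}).
Implicit Types h f : nat -> R.

Definition has_mean h (c : R) : Prop :=
  PE.-integrable setT (fun v => (h (X v))%:E) /\ (\int[PE]_v (h (X v))%:E = c%:E)%E.

Lemma measurable_comp_RV d' (A : measurableType d') (h : nat -> A) :
  measurable_fun setT (fun v => h (X v)).
Proof. by apply: (@measurableT_comp _ _ _ _ _ _ h). Qed.

Lemma has_mean_cst (a : R) : has_mean (fun=> a) a.
Proof.
split; first exact: finite_measure_integrable_cst.
rewrite integral_cst // -[RHS]mule1; congr (_ * _)%E; exact: probability_setT.
Qed.

Lemma has_meanD h1 h2 c1 c2 : has_mean h1 c1 -> has_mean h2 c2 ->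
  has_mean (fun j => h1 j + h2 j) (c1 + c2).
Proof.
move=> [i1 e1] [i2 e2]; split.
  by under eq_fun do rewrite EFinD; exact: integrableD.
by under eq_integral do rewrite EFinD; rewrite integralD // e1 e2.
Qed.

Lemma has_meanZ h c a : has_mean h c -> has_mean (fun j => a * h j) (a * c).
Proof.
move=> [i1 e1]; split.
  by under eq_fun do rewrite EFinM; exact: integrableZl.
by under eq_integral do rewrite EFinM; rewrite integralZl // e1.
Qed.

Lemma ge0_has_mean h c : (forall j, 0 <= h j) ->
  (\int[PE]_v (h (X v))%:E = c%:E)%E -> has_mean h c.
Proof.
move=> h0 e; split => //; apply/integrableP; split.
  exact: (measurable_comp_RV (fun j => (h j)%:E)).
under eq_integral do rewrite gee0_abs ?lee_fin //.
by rewrite e ltry.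
Qed.

Lemma le_mean f h c : (forall j, 0 <= f j) -> (forall j, f j <= h j) ->
  has_mean h c -> (\int[PE]_v (f (X v))%:E <= c%:E)%E.
Proof.
move=> f0 fh [_ <-]; apply: ge0_le_integral => //.
- by move=> v _; rewrite lee_fin.
- exact: (measurable_comp_RV (fun j => (f j)%:E)).
- exact: (measurable_comp_RV (fun j => (h j)%:E)).
- by move=> v _; rewrite lee_fin.
Qed.

(** The minorant [h] may change sign; its positive part is interposed to pass from an integrable to
    a nonnegative integrand. *)
Lemma ge_mean f h c : (forall j, 0 <= f j) -> (forall j, h j <= f j) ->
  has_mean h c -> (c%:E <= \int[PE]_v (f (X v))%:E)%E.
Proof.
move=> f0 fh [ih <-].
apply: (@le_trans _ _ (\int[PE]_v (Num.max (h (X v)) 0)%:E)%E).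
  apply: le_integral => //.
  - apply: (le_integrable _ _ _ ih) => //.
      exact: (measurable_comp_RV (fun j => (Num.max (h j) 0)%:E)).
    move=> v _ /=; rewrite lee_fin ger0_norm ?le_max ?lexx ?orbT //.
    by rewrite ge_max ler_norm normr_ge0.
  - by move=> v _; rewrite lee_fin le_max lexx.
apply: ge0_le_integral => //.
- by move=> v _; rewrite lee_fin le_max lexx orbT.
- exact: (measurable_comp_RV (fun j => (Num.max (h j) 0)%:E)).
- exact: (measurable_comp_RV (fun j => (f j)%:E)).
- by move=> v _; rewrite lee_fin ge_max fh f0.
Qed.

End Mean.

(** * One-step drift inequalities *)

Section Steps.
Context (R : realType) (d : measure_display) (OmegaE : measurableType d).
Context (PE : probability OmegaE R) (xi : nat -> {RV PE >-> nat}).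
Hypothesis xi_iid : iid xi.
Context (s : nat) (T0 : rtree) (x0 : nat) (W : TBRW xi s T0 x0).

Definition legal (e x : nat -> nat) (n : nat) : Prop :=
  x n.+1 \in [seq other_end (x n) a | a <- incident (tree_at s T0 e x n.+1) (x n)].

Lemma nbr_avg_ge0 T x (g : nat -> R) : (forall y, 0 <= g y) -> 0 <= nbr_avg T x g.
Proof. by move=> g0; rewrite divr_ge0 ?ler0n ?sumr_ge0. Qed.

Lemma eq_nbr_avg T x (g h : nat -> R) : g =1 h -> nbr_avg T x g = nbr_avg T x h.
Proof. by move=> gh; rewrite /nbr_avg; congr (_ / _); apply: eq_bigr. Qed.

Lemma measurable_adapted_set n m (A : (nat -> nat) -> (nat -> nat) -> Prop) :
  adapted n m A -> measurable [set w | A (env W ^~ w) (walk W ^~ w)].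
Proof.
move=> aA; have aF : adapted n m (fun e x => `[< A e x >]).
  by move=> e e' x x' He Hx; rewrite (aA e e' x x').
rewrite (_ : [set w | _] = (fun w => `[< A (env W ^~ w) (walk W ^~ w) >]) @^-1` [set true]).
  rewrite -[X in measurable X]setTI.
  exact: (measurable_adapted (W := W) aF).
by apply/seteqP; split => w /= /asboolP.
Qed.

Lemma law_adapted n m (A : (nat -> nat) -> (nat -> nat) -> Prop) :
  adapted n m A -> law W [set w | A (env W ^~ w) (walk W ^~ w)] =
  (\int[law W]_w ((`[< A (env W ^~ w) (walk W ^~ w) >]%:R : R))%:E)%E.
Proof.
move=> aA; have := integral_indic (law W) measurableT (measurable_adapted_set aA).
rewrite setIT => <-; apply: eq_integral => w _; rewrite indicE.
by congr (_%:R)%:E; apply: asbool_equiv_eq; rewrite ?inE.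
Qed.

Lemma adapted_legal n : adapted n.+1 n.+2 (fun e x => legal e x n).
Proof.
move=> e e' x x' He Hx; rewrite /legal.
rewrite (@adapted_tree s T0 n.+1 e e' x x') // => [|i i_n]; last exact/Hx/leqW.
by rewrite !Hx.
Qed.

(** The mass of an illegal step is the mean of a neighbour average all of whose terms are 0, and
    there are countably many times. *)
Lemma ae_legal : {ae law W, forall w, forall n, legal (env W ^~ w) (walk W ^~ w) n}.
Proof.
apply: (ae_foralln (P := fun n w => legal (env W ^~ w) (walk W ^~ w) n)) => n.
have aN : adapted n.+1 n.+2 (fun e x => ~ legal e x n).
  by move=> e e' x x' He Hx; rewrite (@adapted_legal n e e' x x').
exists [set w | ~ legal (env W ^~ w) (walk W ^~ w) n]; split => //.
  exact: measurable_adapted_set aN.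
rewrite [LHS](law_adapted aN) (@integral_walk_step _ _ _ _ _ xi_iid _ _ _ W n
    (fun e x => `[< ~ legal e x n >]%:R)) //; last first.
  by move=> e e' x x' He Hx; rewrite (aN e e' x x').
apply: integral0_eq => w _; congr _%:E.
rewrite /nbr_avg big_seq big1 ?mul0r // => a a_in.
case: asboolP => // -[]; rewrite /legal upd_eq upd_neq ?ltn_eqF //.
rewrite -(@adapted_tree s T0 n.+1 (env W ^~ w) (env W ^~ w) (walk W ^~ w)) //.
  exact: map_f.
by move=> i i_n; rewrite upd_neq ?ltn_eqF.
Qed.

Lemma tree_at_upd e x n j : tree_at s T0 (upd e n j) x n.+1 =
  if (s %| n)%N then attach (tree_at s T0 e x n) (x n) j else tree_at s T0 e x n.
Proof.
rewrite [LHS]/tree_at -/(tree_at s T0 (upd e n j) x n) upd_eq.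
rewrite (@adapted_tree s T0 n (upd e n j) e x x) // => i i_n.
by rewrite upd_neq // ltn_eqF.
Qed.

Definition step_avg n (F : (nat -> nat) -> (nat -> nat) -> R) (e x : nat -> nat) (j : nat) : R :=
  nbr_avg (tree_at s T0 (upd e n j) x n.+1) (x n)
    (fun y => F (upd e n j) (upd x n.+1 y)).

(** The conditional expectation of [F] one step later, given the past before the growth at time
    [n]. *)
Definition step_mean n F e x : \bar R := (\int[PE]_v (step_avg n F e x (xi 1%N v))%:E)%E.

Lemma adapted_step_mean n F : adapted n.+1 n.+2 F -> adapted n n.+1 (step_mean n F).
Proof.
move=> aF e e' x x' He Hx; apply: eq_integral => v _; congr _%:E.
rewrite /step_avg !tree_at_upd (@adapted_tree s T0 n e e' x x') // => [|i i_n]; last first.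
  by apply: Hx; exact: ltnW.
rewrite Hx //; apply: eq_nbr_avg => y; apply: aF => i i_n; rewrite /upd.
  by case: eqVneq => // i_neq; apply: He; rewrite ltn_neqAle i_neq -ltnS.
by case: eqVneq => // i_neq; apply: Hx; rewrite ltn_neqAle i_neq -ltnS.
Qed.

Lemma step_mean_ge0 n F e x : (forall e x, 0 <= F e x) -> (0 <= step_mean n F e x)%E.
Proof.
by move=> F0; apply: integral_ge0 => v _; rewrite lee_fin nbr_avg_ge0.
Qed.

Lemma integral_step n F : adapted n.+1 n.+2 F -> (forall e x, 0 <= F e x) ->
  (\int[law W]_w (F (env W ^~ w) (walk W ^~ w))%:E =
   \int[law W]_w step_mean n F (env W ^~ w) (walk W ^~ w))%E.
Proof.
move=> aF F0; rewrite (integral_walk_step xi_iid W aF F0).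
pose H e x := nbr_avg (tree_at s T0 e x n.+1) (x n) (fun y => F e (upd x n.+1 y)).
rewrite (@integral_env_step _ _ _ _ _ xi_iid _ _ _ W n H) //.
  move=> e e' x x' He Hx; rewrite /H (@adapted_tree s T0 n.+1 e e' x x') // Hx //.
  apply: eq_nbr_avg => y; apply: aF => i i_n; first exact: He.
  rewrite /upd; case: eqVneq => // i_neq; apply: Hx.
  by rewrite ltn_neqAle i_neq -ltnS.
by move=> e x; exact: nbr_avg_ge0.
Qed.

Let measurable_EFin_adapted n m (F : (nat -> nat) -> (nat -> nat) -> R) :
  adapted n m F -> measurable_fun setT (fun w => (F (env W ^~ w) (walk W ^~ w))%:E).
Proof.
move=> aF; apply: (measurable_adapted (n := n) (m := m) (F := fun e x => (F e x)%:E)) => e e' x x' He Hx.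
by congr _%:E; exact: aF.
Qed.

(** A supermartingale inequality with running cost [C], integrated. It is asked only along legal
    paths from [x0], which carry the full mass. *)
Lemma le_integral_step n (F H C : (nat -> nat) -> (nat -> nat) -> R) :
  adapted n.+1 n.+2 F -> adapted n n.+1 H -> adapted n n.+1 C ->
  (forall e x, 0 <= F e x) -> (forall e x, 0 <= H e x) -> (forall e x, 0 <= C e x) ->
  (forall e x, x 0%N = x0 -> (forall i, (i < n)%N -> legal e x i) ->
    ((C e x)%:E + step_mean n F e x <= (H e x)%:E)%E) ->
  (\int[law W]_w (C (env W ^~ w) (walk W ^~ w))%:E +
   \int[law W]_w (F (env W ^~ w) (walk W ^~ w))%:E <=
   \int[law W]_w (H (env W ^~ w) (walk W ^~ w))%:E)%E.
Proof.
move=> aF aH aC F0 H0 C0 le; rewrite (integral_step aF F0).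
have mC := measurable_EFin_adapted aC.
have mF := measurable_adapted (W := W) (adapted_step_mean aF).
rewrite -ge0_integralD //; last 2 first.
- by move=> w _; rewrite lee_fin.
- by move=> w _; exact: step_mean_ge0.
apply: ae_ge0_le_integral => //.
- by move=> w _; rewrite adde_ge0 ?lee_fin ?step_mean_ge0.
- exact: emeasurable_funD.
- by move=> w _; rewrite lee_fin.
- exact: measurable_EFin_adapted aH.
- apply: filterS ae_legal => w lw _; apply: le => // ; exact: walk0.
Qed.

(** The submartingale counterpart: [H] may drop by at most [C] on average. *)
Lemma ge_integral_step n (F H C : (nat -> nat) -> (nat -> nat) -> R) :
  adapted n.+1 n.+2 F -> adapted n n.+1 H -> adapted n n.+1 C ->
  (forall e x, 0 <= F e x) -> (forall e x, 0 <= H e x) -> (forall e x, 0 <= C e x) ->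
  (forall e x, x 0%N = x0 -> (forall i, (i < n)%N -> legal e x i) ->
    ((H e x)%:E <= (C e x)%:E + step_mean n F e x)%E) ->
  (\int[law W]_w (H (env W ^~ w) (walk W ^~ w))%:E <=
   \int[law W]_w (C (env W ^~ w) (walk W ^~ w))%:E +
   \int[law W]_w (F (env W ^~ w) (walk W ^~ w))%:E)%E.
Proof.
move=> aF aH aC F0 H0 C0 le; rewrite (integral_step aF F0).
have mC := measurable_EFin_adapted aC.
have mF := measurable_adapted (W := W) (adapted_step_mean aF).
rewrite -ge0_integralD //; last 2 first.
- by move=> w _; rewrite lee_fin.
- by move=> w _; exact: step_mean_ge0.
apply: ae_ge0_le_integral => //.
- by move=> w _; rewrite lee_fin.
- exact: measurable_EFin_adapted aH.
- by move=> w _; rewrite adde_ge0 ?lee_fin ?step_mean_ge0.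
- exact: emeasurable_funD.
- apply: filterS ae_legal => w lw _; apply: le => // ; exact: walk0.
Qed.

End Steps.

(** * The exit time from the root of a star *)

Section StarTree.
Variable R : realType.

Lemma parent_star l v : parent (star l) v = 0%N.
Proof.
rewrite /parent /star; case: v => [//|v] /=.
by rewrite nth_nseq; case: ifP.
Qed.

Lemma attach_star l j : attach (star l) 0%N j = star (l + j).
Proof. by rewrite /attach /star nseqD. Qed.

Lemma incident_star0 l : incident (star l) 0%N = [seq (0%N, v) | v <- iota 0 l.+1].
Proof.
rewrite /incident /edges /nvert size_nseq.
rewrite (eq_map (g := fun v => (0%N, v))); last by move=> v; rewrite parent_star.
by apply/all_filterP/allP => a /mapP[v _ ->].
Qed.

Lemma incident_star_leaf l v : (v < l)%N -> incident (star l) v.+1 = [:: (0%N, v.+1)].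
Proof.
move=> vl; rewrite /incident /edges /nvert size_nseq.
rewrite (eq_map (g := fun v => (0%N, v))); last by move=> u; rewrite parent_star.
rewrite filter_map (eq_filter (a2 := pred1 v.+1)); last by move=> u /=.
by rewrite filter_pred1_uniq ?iota_uniq // mem_iota.
Qed.

Lemma nbr_avg_star0 l (g : nat -> R) :
  nbr_avg (star l) 0%N g = (\sum_(v < l.+1) g v) / l.+1%:R.
Proof.
rewrite /nbr_avg incident_star0 size_map size_iota big_map.
by rewrite -[iota 0 _]/(index_iota 0 l.+1) big_mkord.
Qed.

Lemma nbr_avg_star_leaf l v (g : nat -> R) : (v < l)%N ->
  nbr_avg (star l) v.+1 g = g 0%N.
Proof. by move=> vl; rewrite /nbr_avg incident_star_leaf // big_seq1 /= divr1. Qed.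

End StarTree.

Section Star.
Context (R : realType) (d : measure_display) (OmegaE : measurableType d).
Context (PE : probability OmegaE R) (xi : nat -> {RV PE >-> nat}).
Hypothesis xi_iid : iid xi.
Context (k l : nat) (k_gt0 : (0 < k)%N) (W : TBRW xi (2 * k)%N (star l) 0%N).

Definition at_root n (x : nat -> nat) : bool := all (fun i => x (2 * i)%N == 0%N) (iota 0 n.+1).

Lemma at_rootP n x : reflect (forall i, (i <= n)%N -> x (2 * i)%N = 0%N) (at_root n x).
Proof.
apply: (iffP allP) => H i; first by move=> i_n; apply/eqP/H; rewrite mem_iota.
by rewrite mem_iota => /andP[_ i_n]; rewrite H.
Qed.

Lemma at_rootS n x : at_root n.+1 x = at_root n x && (x (2 * n.+1)%N == 0%N).
Proof. by rewrite /at_root -[n.+2]addn1 iotaD all_cat /= andbT add0n. Qed.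

(* [grown t n e] is the sum of [t (e i)] over the growth times [i < 2 n]. *)
Definition grown (t : nat -> nat) n (e : nat -> nat) : nat :=
  (\sum_(j < n | (k %| j)%N) t (e (2 * j)%N))%N.

Lemma grownS t n e : grown t n.+1 e = (grown t n e + (if (k %| n)%N then t (e (2 * n)%N) else 0))%N.
Proof. by rewrite /grown big_mkcond big_ord_recr /= -big_mkcond. Qed.

Lemma eq_grown t n e e' : (forall i, (i < n)%N -> e (2 * i)%N = e' (2 * i)%N) -> grown t n e = grown t n e'.
Proof. by move=> E; apply: eq_bigr => j _; rewrite E. Qed.

Lemma not_dvdn_odd n : ~~ (2 * k %| (2 * n).+1)%N.
Proof. by apply/negP => /(dvdn_trans (dvdn_mulr k (dvdnn 2))); lia. Qed.

(** Growth times are multiples of [2 * k], hence even, so all growth occurs at the root as long as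
    the even times are spent there. *)
Lemma tree_at_star_even n e x : at_root n x ->
  tree_at (2 * k)%N (star l) e x (2 * n)%N = star (l + grown id n e).
Proof.
elim: n => [|n IH]; first by rewrite /grown big_ord0 addn0.
rewrite at_rootS => /andP[An _]; move: (IH An) => {}IH.
have -> : (2 * n.+1 = (2 * n).+2)%N by lia.
rewrite /tree_at -/tree_at (negbTE (not_dvdn_odd n)) dvdn_pmul2l // IH grownS (elimT (at_rootP _ _) An n) //.
by case: ifP => _; rewrite ?addn0 // attach_star addnA.
Qed.

Lemma tree_at_star_odd n e x : at_root n x ->
  tree_at (2 * k)%N (star l) e x (2 * n).+1 = star (l + grown id n.+1 e).
Proof.
move=> An; rewrite /tree_at -/tree_at dvdn_pmul2l // tree_at_star_even // grownS.
rewrite (elimT (at_rootP _ _) An n) //.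
by case: ifP => _; rewrite ?addn0 // attach_star addnA.
Qed.

(** Two steps from the centre of a star of degree [D] come back with probability
    [1 / D ^ 2 + (D - 1) / D]: the loop twice, or a leaf and back. *)
Definition stay_prob (D : nat) : R := 1 - (D%:R - 1) / D%:R ^+ 2.

Lemma integral_star_step n (G : (nat -> nat) -> R) :
  (forall e, 0 <= G e) ->
  (forall e e', (forall i, (i < (2 * n).+1)%N -> e i = e' i) -> G e = G e') ->
  (\int[law W]_w ((at_root n.+1 (walk W ^~ w))%:R * G (env W ^~ w))%:E =
   \int[law W]_w \int[PE]_v ((at_root n (walk W ^~ w))%:R *
     (stay_prob (l + grown id n.+1 (upd (env W ^~ w) (2 * n) (xi 1%N v))).+1 *
      G (upd (env W ^~ w) (2 * n) (xi 1%N v))))%:E)%E.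
Proof.
move=> G0 aG.
have aR m x x' : (forall i, (i < (2 * m).+1)%N -> x i = x' i) -> at_root m x = at_root m x'.
  move=> H; apply/at_rootP/at_rootP => E i i_m.
    by rewrite -H ?E // ltnS leq_mul2l.
  by rewrite H ?E // ltnS leq_mul2l.
have e2 : (2 * n.+1 = (2 * n).+2)%N by lia.
(* Integrating out the position at [2 * n + 2] turns [F1] into [F2], integrating out that at
   [2 * n + 1] turns [F2] into [F3]; the environment value at [2 * n] comes last. *)
pose F1 e x : R := (at_root n.+1 x)%:R * G e.
have F10 e x : 0 <= F1 e x by rewrite mulr_ge0.
rewrite (@integral_walk_step _ _ _ _ _ xi_iid _ _ _ W (2 * n).+1 F1) //; last first.
  move=> e e' x x' He Hx; rewrite /F1 (aG e e'); last by move=> i i_n; apply: He; lia.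
  by rewrite (aR n.+1 x x') // => i; rewrite e2; exact: Hx.
pose F2 e x : R := nbr_avg (tree_at (2 * k) (star l) e x (2 * n).+2) (x (2 * n).+1)
   (fun y => F1 e (upd x (2 * n).+2 y)).
pose F3 e x : R := (at_root n x)%:R * (stay_prob (l + grown id n.+1 e).+1 * G e).
have F20 e x : 0 <= F2 e x by exact: nbr_avg_ge0.
have F1_upd e x y : F1 e (upd x (2 * n).+2 y) = (y == 0%N)%:R * ((at_root n x)%:R * G e).
  rewrite /F1 at_rootS e2 upd_eq (aR n _ x); last first.
    by move=> i i_n; rewrite upd_neq //; lia.
  by case: (at_root n x); case: (y == 0%N); rewrite ?(mul0r, mul1r, mulr0).
have tree2 e x : tree_at (2 * k) (star l) e x (2 * n).+2 = tree_at (2 * k) (star l) e x (2 * n).+1.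
  by rewrite [LHS]/tree_at -/tree_at (negbTE (not_dvdn_odd n)).
(* From the root the second step must use the self-loop; from a leaf the return is certain. *)
have F2E e x y : at_root n x -> (y < (l + grown id n.+1 e).+1)%N ->
    F2 e (upd x (2 * n).+1 y) =
    (if y == 0%N then (l + grown id n.+1 e).+1%:R^-1 else 1) * G e.
  move=> An yL; have Hx i : (i < (2 * n).+1)%N -> x i = upd x (2 * n).+1 y i.
    by move=> i_n; rewrite upd_neq // ltn_eqF.
  rewrite /F2 tree2 tree_at_star_odd -?(aR n x) // upd_eq.
  rewrite (eq_nbr_avg _ _ (h := fun z => (z == 0%N)%:R * G e)); last first.
    by move=> z; rewrite F1_upd -(aR n x) // An mul1r.
  case: y yL Hx => [|y] yL Hx /=; last by rewrite nbr_avg_star_leaf // mul1r eqxx mul1r.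
  rewrite nbr_avg_star0 big_ord_recl /= mul1r big1 ?addr0; first by rewrite mulrC.
  by move=> i _; rewrite mul0r.
have F23 e x : nbr_avg (tree_at (2 * k) (star l) e x (2 * n).+1) (x (2 * n)%N)
    (fun y => F2 e (upd x (2 * n).+1 y)) = F3 e x.
  rewrite /F3; case: (boolP (at_root n x)) => An; last first.
    rewrite mul0r /nbr_avg big1 ?mul0r // => a _; rewrite /F2 /nbr_avg big1 ?mul0r // => b _.
    rewrite F1_upd -(aR n x) ?(negbTE An) ?mul0r ?mulr0 // => i i_n.
    by rewrite upd_neq // ltn_eqF.
  rewrite mul1r (elimT (at_rootP _ _) An n) // tree_at_star_odd // nbr_avg_star0.
  set L := (l + grown id n.+1 e)%N.
  rewrite (eq_bigr (fun y : 'I_L.+1 => (if y == 0%N :> nat then L.+1%:R^-1 else 1) * G e)); last first.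
    by move=> y _; rewrite F2E.
  rewrite big_ord_recl /= (eq_bigr (fun _ => G e)); last by move=> i _; rewrite mul1r.
  rewrite sumr_const card_ord /stay_prob -natr1 -mulr_natr.
  have L1 : (L%:R + 1 : R) != 0 by rewrite natr1 pnatr_eq0.
  by field.
have aF2 : adapted (2 * n).+1 (2 * n).+2 F2.
  move=> e e' x x' He Hx.
  rewrite /F2 !tree2 (@adapted_tree (2 * k) (star l) (2 * n).+1 e e' x x') // ?Hx //; last first.
    by move=> i i_n; apply/Hx/leqW.
  apply: eq_nbr_avg => y; rewrite !F1_upd (aR n x x') ?(aG e e') //.
  by move=> i i_n; exact/Hx/leqW.
transitivity (\int[law W]_w (F2 (env W ^~ w) (walk W ^~ w))%:E)%E.
  by apply: eq_integral => w _; rewrite /F2 /tree.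
rewrite (@integral_walk_step _ _ _ _ _ xi_iid _ _ _ W (2 * n) F2) //.
under eq_integral => w _ do rewrite F23.
rewrite (@integral_env_step _ _ _ _ _ xi_iid _ _ _ W (2 * n) F3) //.
  move=> e e' x x' He Hx; rewrite /F3 (aR n x x') // (aG e e') // (@eq_grown _ _ e e') //.
  by move=> i i_n; apply: He; lia.
move=> e x; rewrite -F23; exact: nbr_avg_ge0.
Qed.

End Star.

(** * First-passage sums, supersolutions and subsolutions *)

Section Series.
Variable R : realType.

Lemma nneseries_cst_pinfty (c : R) : 0 < c -> (\sum_(i <oo) c%:E = +oo :> \bar R)%E.
Proof.
move=> c0; apply/eqyP => A A0.
have [n An] : exists n : nat, A <= n%:R * c.
  exists (Num.bound (A / c)); rewrite -ler_pdivrMr //; apply/ltW/archi_boundP.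
  by rewrite divr_ge0 // ltW.
apply: le_trans (nneseries_lim_ge n _); last by move=> i _; rewrite lee_fin ltW.
by rewrite sumEFin lee_fin big_mkord sumr_const card_ord -[c *+ n]mulr_natl.
Qed.

(** The first index where [Q] holds is the number of [i] such that [Q] has failed up to [i]; if [Q]
    never holds, both sides are infinite. *)
Lemma ereal_inf_first (c : nat) (Q : nat -> Prop) : (0 < c)%N ->
  ereal_inf [set (((c * m)%N%:R : R))%:E | m in Q] =
  (\sum_(i <oo) (c%:R * (`[< forall j, (j <= i)%N -> ~ Q j >])%:R)%:E)%E.
Proof.
move=> c0; have [[m Qm]|nQ] := pselect (exists m, Q m); last first.
  rewrite (_ : [set _ | m in Q] = set0); last first.
    by apply/seteqP; split => // y [m Qm]; exfalso; apply: nQ; exists m.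
  rewrite ereal_inf0 -(@nneseries_cst_pinfty c%:R) ?ltr0n //.
  apply: eq_eseriesr => i _; rewrite asboolT ?mulr1 // => j _ Qj; apply: nQ; by exists j.
have exQ : exists m, `[< Q m >] by exists m; exact/asboolP.
case: (ex_minnP exQ) => N /asboolP QN minN.
transitivity ((c * N)%N%:R%:E : \bar R).
  apply/eqP; rewrite eq_le; apply/andP; split.
    by apply: ereal_inf_lbound; exists N.
  apply: le_ereal_inf_tmp => _ [j Qj <-]; rewrite lee_fin ler_nat leq_mul2l.
  by rewrite minN ?orbT //; exact/asboolP.
rewrite (nneseries_split 0 N) => [|i _]; last by rewrite lee_fin mulr_ge0.
rewrite add0n [X in (_ + X)%E]eseries0 ?adde0 => [|i Ni _]; last first.
  by rewrite asboolF ?mulr0 // => /(_ N Ni).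
rewrite sumEFin big_mkord (eq_bigr (fun=> c%:R)).
  by rewrite sumr_const card_ord -[c%:R *+ N]mulr_natr natrM.
move=> i _; rewrite asboolT ?mulr1 // => j ji Qj.
have /asboolP/minN Nj := Qj.
by have := leq_ltn_trans (leq_trans Nj ji) (ltn_ord i); rewrite ltnn.
Qed.

(** Telescoping; the remainder [v n] is nonnegative and is dropped. *)
Lemma supersolution_bound (a v : nat -> \bar R) :
  (forall n, 0 <= a n)%E -> (forall n, 0 <= v n)%E ->
  (forall n, a n + v n.+1 <= v n)%E -> (\sum_(n <oo) a n <= v 0%N)%E.
Proof.
move=> a0 v0 le; apply: lime_le; first exact: is_cvg_nneseries.
apply: nearW => n; suff : (\sum_(0 <= i < n) a i + v n <= v 0%N)%E.
  by apply: le_trans; rewrite leeDl.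
elim: n => [|n IH]; first by rewrite big_nil add0e.
rewrite big_nat_recr //=; apply: le_trans IH.
by rewrite -addeA leeD2l.
Qed.

(** Telescoping leaves the remainder [v n], at most [M * a n]. If the series is finite, some [a n]
    is as small as desired; if it is infinite there is nothing to prove. *)
Lemma subsolution_bound (a v : nat -> \bar R) (c M : R) : 0 < c -> 0 <= M ->
  (forall n, 0 <= a n)%E -> (forall n, v n <= M%:E * a n)%E ->
  (forall n, v n <= c%:E * a n + v n.+1)%E ->
  (v 0%N <= c%:E * \sum_(n <oo) a n)%E.
Proof.
move=> c0 M0 a0 vM le.
have part n : (v 0%N <= c%:E * \sum_(0 <= i < n) a i + v n)%E.
  elim: n => [|n IH]; first by rewrite big_nil mule0 add0e.
  apply: (le_trans IH); rewrite big_nat_recr //= ge0_muleDr //; last first.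
    by rewrite sume_ge0.
  by rewrite -addeA leeD2l.
have [->|S_fin] := eqVneq (\sum_(n <oo) a n)%E +oo%E.
  by rewrite gt0_muley ?leey // lte_fin.
apply/lee_addgt0Pr => e e0.
have [n ane] : exists n, (M%:E * a n <= e%:E)%E.
  apply: contrapT => nex; move/eqP: S_fin; apply; apply/eqyP => A A0.
  (* [M + 1] serves as divisor because [M] may be 0. *)
  have M1 : 0 < M + 1 by rewrite ltr_wpDl.
  have big n : ((e / (M + 1))%:E <= a n)%E.
    rewrite leNgt; apply/negP => an; apply: nex; exists n.
    apply: (@le_trans _ _ (M%:E * (e / (M + 1))%:E)%E).
      by apply: lee_wpmul2l; rewrite ?lee_fin // ltW.
    rewrite -EFinM lee_fin mulrA ler_pdivrMr // mulrC ler_pM2l //; lra.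
  apply: (@le_trans _ _ (\sum_(i <oo) (e / (M + 1))%:E)%E).
    by rewrite nneseries_cst_pinfty ?leey // divr_gt0.
  by apply: lee_nneseries => // i _; rewrite lee_fin divr_ge0 // ltW.
apply: (le_trans (part n)); apply: leeD; last exact: le_trans (vM n) ane.
apply: lee_wpmul2l; first by rewrite lee_fin ltW.
exact: nneseries_lim_ge.
Qed.

End Series.

Section StarSolutions.
Context (R : realType) (d : measure_display) (OmegaE : measurableType d).
Context (PE : probability OmegaE R) (xi : nat -> {RV PE >-> nat}).
Hypothesis xi_iid : iid xi.
Context (k l : nat) (k_gt0 : (0 < k)%N) (W : TBRW xi (2 * k)%N (star l) 0%N).

Definition surv n : \bar R := (\int[law W]_w ((at_root n (walk W ^~ w))%:R : R)%:E)%E.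

Lemma adapted_at_root n : adapted 0 (2 * n).+1 (fun _ x => at_root n x).
Proof.
move=> _ _ x x' _ H; apply/at_rootP/at_rootP => E i i_m.
  by rewrite -H ?E // ltnS leq_mul2l.
by rewrite H ?E // ltnS leq_mul2l.
Qed.

Lemma surv_ge0 n : (0 <= surv n)%E.
Proof. by apply: integral_ge0 => w _; rewrite lee_fin. Qed.

Lemma expected_exit_time_surv :
  expected_exit_time W = (\sum_(n <oo) 2%:E * surv n)%E.
Proof.
rewrite /expected_exit_time.
under eq_integral => w _.
  rewrite /tau_exit (ereal_inf_first R (fun n => walk W (2 * n)%N w <> walk W 0%N w)) //.
  under eq_eseriesr => n _.
    rewrite (_ : `[< _ >] = at_root n (walk W ^~ w)); last first.
      apply/asboolP/at_rootP => H i /H; rewrite walk0; first by move/contrapT.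
      by move=> -> .
    rewrite EFinM; over.
  over.
have mA n : measurable_fun setT (fun w => ((at_root n (walk W ^~ w))%:R : R)%:E).
  apply: (measurable_adapted (n := 0) (m := (2 * n).+1) (F := fun _ x => ((at_root n x)%:R)%:E)).
  by move=> e e' x x' He Hx; rewrite (@adapted_at_root n e e' x x').
rewrite integral_nneseries //.
- apply: eq_eseriesr => n _; rewrite ge0_integralZl //.
- by move=> n; exact: measurable_funeM.
Qed.

Lemma adapted_at_root_grown n (f : nat -> R) t : adapted (2 * n) (2 * n).+1
  (fun e x => ((at_root n x)%:R * f (l + grown k t n e).+1 : R)).
Proof.
move=> e e' x x' He Hx; rewrite (@adapted_at_root n e e' x x') //.
by rewrite (@eq_grown _ _ _ e e') // => i i_n; apply: He; rewrite ltn_mul2l /=.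
Qed.

Lemma grown_upd t n e j : grown k t n.+1 (upd e (2 * n) j) =
  (grown k t n e + (if (k %| n)%N then t j else 0))%N.
Proof.
rewrite grownS upd_eq (@eq_grown _ _ _ _ e) // => i i_n; rewrite upd_neq //.
by rewrite neq_ltn ltn_mul2l i_n.
Qed.

(** The staying probability uses the true growth, while the value uses the growth filtered by [t]:
    this is how a truncated environment enters without a second process. *)
Lemma integral_star_value n (f : nat -> R) t :
  (forall D, 0 <= f D) ->
  (\int[law W]_w ((at_root n.+1 (walk W ^~ w))%:R * f (l + grown k t n.+1 (env W ^~ w)).+1)%:E =
  \int[law W]_w ((at_root n (walk W ^~ w))%:R%:E * \int[PE]_v
     (stay_prob R (l + (grown k id n (env W ^~ w) + if (k %| n)%N then xi 1%N v else 0)).+1 *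
      f (l + (grown k t n (env W ^~ w) + if (k %| n)%N then t (xi 1%N v) else 0)).+1)%:E))%E.
Proof.
move=> f0; rewrite (@integral_star_step _ _ _ _ _ xi_iid _ _ k_gt0 W n
  (fun e => f (l + grown k t n.+1 e).+1)) //; last first.
  move=> e e' He; rewrite (@eq_grown _ _ _ e e') // => i i_n; apply: He.
  by rewrite ltnS leq_mul2l.
apply: eq_integral => w _; case: (at_root n _).
  by rewrite mul1e; apply: eq_integral => v _; rewrite !grown_upd mul1r.
by rewrite mul0e; apply: integral0_eq => v _; rewrite mul0r.
Qed.

End StarSolutions.

Section StarBounds.
Context (R : realType) (d : measure_display) (OmegaE : measurableType d).
Context (PE : probability OmegaE R) (xi : nat -> {RV PE >-> nat}).
Hypothesis xi_iid : iid xi.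
Context (k l : nat) (k_gt0 : (0 < k)%N) (W : TBRW xi (2 * k)%N (star l) 0%N).

Lemma stay_prob_ge0 D : 0 <= stay_prob R D.
Proof.
rewrite /stay_prob; case: D => [|D]; first by rewrite expr0n /= invr0 mulr0 subr0.
rewrite subr_ge0 ler_pdivrMr ?exprn_gt0 ?ltr0n // mul1r -natr1 addrK.
have : (0 : R) <= D%:R by []. nra.
Qed.

(** This lets a truncated degree [D'] stand for the true degree [D]:
    [(D - 1) / D ^ 2 <= 1 / D <= 1 / D']. *)
Lemma stay_prob_ge D D' : (0 < D' <= D)%N -> 1 - D'%:R^-1 <= stay_prob R D.
Proof.
move=> /andP[D0 DD]; rewrite /stay_prob lerD2l lerN2.
have D0' : (0 : R) < D'%:R by rewrite ltr0n.
have DD' : (D'%:R : R) <= D%:R by rewrite ler_nat.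
have D0R : (0 : R) < D%:R by apply: lt_le_trans DD'.
apply: (@le_trans _ _ D%:R^-1); last by rewrite lef_pV2 ?posrE.
rewrite ler_pdivrMr ?exprn_gt0 // expr2 mulrA mulVf ?gt_eqF // mul1r.
by rewrite gerBl.
Qed.

(** [f n D] is evaluated just before the possible growth at time [2 * n], so the degree in force
    during the double step is the enlarged one. *)
Lemma star_supersolution (f : nat -> nat -> R) : (forall n D, 0 <= f n D) ->
  (forall n D, (l < D)%N ->
    (1 + \int[PE]_v (let D' := (D + if (k %| n)%N then xi 1%N v else 0)%N in
       stay_prob R D' * f n.+1 D')%:E <= (f n D)%:E)%E) ->
  (\sum_(n <oo) surv W n <= (f 0%N l.+1)%:E)%E.
Proof.
move=> f0 H; pose v n := (\int[law W]_w
   ((at_root n (walk W ^~ w))%:R * f n (l + grown k id n (env W ^~ w)).+1)%:E)%E.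
have -> : ((f 0%N l.+1)%:E = v 0%N :> \bar R)%E.
  rewrite /v (eq_integral (fun=> (f 0%N l.+1)%:E)).
    by rewrite integral_cst // -[LHS]mule1; congr (_ * _)%E; exact/esym/probability_setT.
  move=> w _; rewrite /grown big_ord0 addn0; congr _%:E.
  by rewrite (introT (at_rootP _ _)) ?mul1r // => -[|//] _; rewrite walk0.
apply: supersolution_bound => [n|n|n]; first exact: surv_ge0.
  by apply: integral_ge0 => w _; rewrite lee_fin mulr_ge0.
pose K (w : Defs.space W) := ((at_root n (walk W ^~ w))%:R%:E * \int[PE]_v
     (stay_prob R (l + (grown k id n (env W ^~ w) + if (k %| n)%N then xi 1%N v else 0)).+1 *
      f n.+1 (l + (grown k id n (env W ^~ w) + if (k %| n)%N then id (xi 1%N v) else 0)).+1)%:E)%E.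
have -> : v n.+1 = (\int[law W]_w K w)%E.
  exact: (@integral_star_value _ _ _ _ _ xi_iid _ _ k_gt0 W n (f n.+1) id (f0 n.+1)).
have aA : adapted (2 * n) (2 * n).+1 (fun (e x : nat -> nat) => (((at_root n x)%:R : R)%:E)).
  by move=> e e' x x' _ Hx; rewrite (@adapted_at_root n e e' x x').
have aK : adapted (2 * n) (2 * n).+1 (fun e x => ((at_root n x)%:R%:E * \int[PE]_v
     (stay_prob R (l + (grown k id n e + if (k %| n)%N then xi 1%N v else 0)).+1 *
      f n.+1 (l + (grown k id n e + if (k %| n)%N then id (xi 1%N v) else 0)).+1)%:E)%E).
  move=> e e' x x' He Hx; rewrite (@adapted_at_root n e e' x x') // (@eq_grown _ _ _ e e') //.
  by move=> i i_n; apply: He; rewrite ltn_mul2l.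
have K0 w : (0 <= K w)%E.
  rewrite /K mule_ge0 ?lee_fin // integral_ge0 // => u _.
  by rewrite lee_fin mulr_ge0 ?stay_prob_ge0.
have mA := measurable_adapted (W := W) aA.
have mK := measurable_adapted (W := W) aK.
have -> : (surv W n + \int[law W]_w K w =
    \int[law W]_w ((at_root n (walk W ^~ w))%:R%:E + K w))%E.
  by rewrite ge0_integralD.
apply: ge0_le_integral => //.
- by move=> w _; rewrite adde_ge0 ?lee_fin.
- exact: emeasurable_funD.
- apply: (measurable_adapted (W := W)
    (F := fun e x => ((at_root n x)%:R * f n (l + grown k id n e).+1)%:E)
    (n := (2 * n)%N) (m := (2 * n).+1)) => e e' x x' He Hx.
  congr _%:E; exact: adapted_at_root_grown.
- move=> w _; rewrite /K; case: (at_root n _); last by rewrite !mul0r mul0e adde0.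
  rewrite mul1r mul1e; apply: le_trans (H n _ (leq_addr _ _)).
  rewrite leeD2l // le_eqVlt; apply/orP; left; apply/eqP; apply: eq_integral => u _.
  by rewrite /= !addSn !addnA.
Qed.

(** The true degree [D] is not determined by the truncated one [D'], so the inequality is asked for
    every [D] above [D']. The bound [M] controls the remainder in [subsolution_bound]. *)
Lemma star_subsolution (f : nat -> nat -> R) (t : nat -> nat) (c M : R) :
  0 < c -> (forall n D, 0 <= f n D <= M) -> (forall j, (t j <= j)%N) ->
  (forall n D D', (l < D' <= D)%N ->
    ((f n D')%:E <= c%:E + \int[PE]_v
      (stay_prob R (D + if (k %| n)%N then xi 1%N v else 0) *
       f n.+1 (D' + if (k %| n)%N then t (xi 1%N v) else 0)%N)%:E)%E) ->
  ((f 0%N l.+1)%:E <= c%:E * \sum_(n <oo) surv W n)%E.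
Proof.
move=> c0 fM tj H; pose v n := (\int[law W]_w
   ((at_root n (walk W ^~ w))%:R * f n (l + grown k t n (env W ^~ w)).+1)%:E)%E.
have f0 n D : 0 <= f n D by have /andP[] := fM n D.
have M0 : 0 <= M by have /andP[f00 /(le_trans f00)] := fM 0%N 0%N.
have -> : ((f 0%N l.+1)%:E = v 0%N :> \bar R)%E.
  rewrite /v (eq_integral (fun=> (f 0%N l.+1)%:E)).
    by rewrite integral_cst // -[LHS]mule1; congr (_ * _)%E; exact/esym/probability_setT.
  move=> w _; rewrite /grown big_ord0 addn0; congr _%:E.
  by rewrite (introT (at_rootP _ _)) ?mul1r // => -[|//] _; rewrite walk0.
have aA n : adapted (2 * n) (2 * n).+1 (fun (e x : nat -> nat) => (((at_root n x)%:R : R)%:E)).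
  by move=> e e' x x' _ Hx; rewrite (@adapted_at_root n e e' x x').
have mA n := measurable_adapted (W := W) (aA n).
have mv n : measurable_fun setT (fun w =>
    ((at_root n (walk W ^~ w))%:R * f n (l + grown k t n (env W ^~ w)).+1)%:E).
  apply: (measurable_adapted (W := W)
    (F := fun e x => ((at_root n x)%:R * f n (l + grown k t n e).+1)%:E)
    (n := (2 * n)%N) (m := (2 * n).+1)) => e e' x x' He Hx.
  congr _%:E; exact: adapted_at_root_grown.
apply: (subsolution_bound c0 M0) => n; first exact: surv_ge0.
  rewrite /surv -ge0_integralZl //.
  apply: ge0_le_integral => //.
  - by move=> w _; rewrite lee_fin mulr_ge0.
  - exact: measurable_funeM.
  - move=> w _; rewrite -EFinM lee_fin mulrC ler_wpM2r //.
    by have /andP[] := fM n (l + grown k t n (env W ^~ w)).+1.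
pose K (w : Defs.space W) := ((at_root n (walk W ^~ w))%:R%:E * \int[PE]_v
     (stay_prob R (l + (grown k id n (env W ^~ w) + if (k %| n)%N then xi 1%N v else 0)).+1 *
      f n.+1 (l + (grown k t n (env W ^~ w) + if (k %| n)%N then t (xi 1%N v) else 0)).+1)%:E)%E.
have -> : v n.+1 = (\int[law W]_w K w)%E.
  exact: (@integral_star_value _ _ _ _ _ xi_iid _ _ k_gt0 W n (f n.+1) t (f0 n.+1)).
have aK : adapted (2 * n) (2 * n).+1 (fun e x => ((at_root n x)%:R%:E * \int[PE]_v
     (stay_prob R (l + (grown k id n e + if (k %| n)%N then xi 1%N v else 0)).+1 *
      f n.+1 (l + (grown k t n e + if (k %| n)%N then t (xi 1%N v) else 0)).+1)%:E)%E).
  move=> e e' x x' He Hx; rewrite (@adapted_at_root n e e' x x') //.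
  have He' i : (i < n)%N -> e (2 * i)%N = e' (2 * i)%N.
    by move=> i_n; apply: He; rewrite ltn_mul2l.
  by rewrite !(@eq_grown _ _ _ e e').
have K0 w : (0 <= K w)%E.
  rewrite /K mule_ge0 ?lee_fin // integral_ge0 // => u _.
  by rewrite lee_fin mulr_ge0 ?stay_prob_ge0.
have mK := measurable_adapted (W := W) aK.
have -> : (c%:E * surv W n + \int[law W]_w K w =
    \int[law W]_w (c%:E * (at_root n (walk W ^~ w))%:R%:E + K w))%E.
  rewrite ge0_integralD //; first by rewrite ge0_integralZl // lee_fin ltW.
  - by move=> w _; rewrite mule_ge0 ?lee_fin // ltW.
  - exact: measurable_funeM.
apply: ge0_le_integral => //.
- by move=> w _; rewrite lee_fin mulr_ge0.
- by apply: emeasurable_funD => //; exact: measurable_funeM.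
- move=> w _; rewrite /K; case: (at_root n _); last by rewrite !mul0r mul0e mule0 adde0.
  rewrite mul1r mul1e mule1.
  have DD : (l < (l + grown k t n (env W ^~ w)).+1 <= (l + grown k id n (env W ^~ w)).+1)%N.
    by rewrite ltnS leq_addr ltnS leq_add2l leq_sum.
  apply: (le_trans (H n _ _ DD)).
  rewrite leeD2l // le_eqVlt; apply/orP; left; apply/eqP; apply: eq_integral => u _.
  by rewrite !addSn !addnA.
Qed.

(** With the growth ignored in the value ([t = 0]), a double step loses at most [f / D' <= 1]; the
    minimum makes [f] bounded. *)
Lemma star_exit_ge : ((2 * l.+1%:R)%:E <= expected_exit_time W)%E.
Proof.
rewrite expected_exit_time_surv // nneseriesZl; last by move=> *; exact: surv_ge0.
rewrite EFinM; apply: lee_wpmul2l => //.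
pose f (n D : nat) : R := Num.min D%:R l.+1%:R.
have -> : (l.+1%:R)%:E = (f 0%N l.+1)%:E :> \bar R by rewrite /f minxx.
rewrite -[leRHS]mul1e; apply: (@star_subsolution f (fun=> 0%N) 1 l.+1%:R) => //.
  by move=> n D; rewrite /f le_min !ler0n ge_min lexx orbT.
move=> n D D' /andP[lD' D'D].
have D'0 : (0 < D')%N by apply: leq_ltn_trans lD'.
apply: (@le_trans _ _ (1 + ((1 - D'%:R^-1) * f n D')%:E)%E).
  rewrite -EFinD lee_fin.
  have : f n D' / D'%:R <= 1.
    by rewrite ler_pdivrMr ?ltr0n // mul1r /f ge_min lexx.
  rewrite mulrBl mul1r mulrC; lra.
rewrite leeD2l //; apply: (@ge_mean _ _ _ _ (xi 1%N)
   (fun j => stay_prob R (D + if (k %| n)%N then j else 0) *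
       f n.+1 (D' + if (k %| n)%N then 0 else 0)%N) (fun=> (1 - D'%:R^-1) * f n D')).
- by move=> j; rewrite mulr_ge0 ?stay_prob_ge0 // /f le_min !ler0n.
- move=> j; rewrite if_same addn0; apply: ler_pM => //.
  + by rewrite subr_ge0 invf_le1 ?ltr0n // ler1n.
  + by rewrite /f le_min !ler0n.
  + by rewrite stay_prob_ge // D'0 (leq_trans D'D) // leq_addr.
- exact: has_mean_cst.
Qed.

End StarBounds.

(* The number of double steps from time [2 n] to the next growth time. *)
Definition wait (k n : nat) : nat := ((k - n %% k) %% k)%N.

Lemma wait0 k n : (k %| n)%N -> wait k n = 0%N.
Proof. by rewrite /wait => /eqP ->; rewrite subn0 modnn. Qed.

Lemma wait_gt0 k n : (0 < k)%N -> ~~ (k %| n)%N -> (0 < wait k n)%N.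
Proof.
move=> k0 kn; have := ltn_pmod n k0; rewrite /dvdn in kn.
rewrite /wait; move: (n %% k)%N kn => j j0 jk.
by rewrite modn_small; lia.
Qed.

Lemma waitS k n : (0 < k)%N -> wait k n.+1 = (if (k %| n)%N then k else wait k n).-1.
Proof.
move=> k0; rewrite /wait modnS.
have := ltn_pmod n k0; case: ifPn => kn1; case: ifPn => kn jk.
- have : (k %| 1)%N by rewrite -(dvdn_addr 1 kn) addn1.
  by rewrite dvdn1 => /eqP ->.
- have : (k %| (n %% k).+1)%N by rewrite -addn1 /dvdn modnDml addn1.
  move=> /dvdn_leq -/(_ isT) jk'; rewrite subn0 modnn.
  have -> : (k - n %% k = 1)%N by lia.
  case: (k) k0 => [//|[|k'] _]; first by rewrite modn1.
  by rewrite modn_small.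
- by rewrite (eqP kn) subn1 modn_small ?prednK.
- have : (n %% k).+1 != k.
    apply: contraNneq kn1 => E; rewrite -addn1 /dvdn -modnDml addn1 E modnn //.
  rewrite /dvdn in kn; move: (n %% k)%N jk kn => j jk j0 jk1.
  by rewrite !modn_small; lia.
Qed.

Lemma bernoulli_le (R : realFieldType) (x : R) n : 0 <= x <= 1 -> 1 - n%:R * x <= (1 - x) ^+ n.
Proof.
move=> /andP[x0 x1]; elim: n => [|n IH]; first by rewrite expr0 mul0r subr0.
rewrite exprS; apply: (@le_trans _ _ ((1 - x) * (1 - n%:R * x))).
  have : 0 <= n%:R * x * x by rewrite !mulr_ge0.
  rewrite -natr1; lra.
by rewrite ler_wpM2l // subr_ge0.
Qed.

(** * Finite and infinite expected exit times *)

Section StarExit.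
Context (R : realType) (d : measure_display) (OmegaE : measurableType d).
Context (PE : probability OmegaE R) (xi : nat -> {RV PE >-> nat}).
Hypothesis xi_iid : iid xi.
Context (k l : nat) (k_gt0 : (0 < k)%N) (W : TBRW xi (2 * k)%N (star l) 0%N).

Lemma star_exit_le (mu : R) : has_mean (xi 1%N) (fun j => j%:R) mu -> 0 <= mu ->
  mu < k%:R -> (0 < l)%N ->
  (expected_exit_time W <= ((2 * (k%:R / (k%:R - mu)) * (mu + 4)) * l%:R)%:E)%E.
Proof.
move=> mean_mu mu0 muk l0; rewrite expected_exit_time_surv //.
rewrite nneseriesZl; last by move=> *; exact: surv_ge0.
have k0 : (0 : R) < k%:R by rewrite ltr0n.
have kmu : 0 < k%:R - mu by lra.
(* Each double step lowers the value by [C] through exits, while growth raises it by [C * mu / k] on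
   average; [C] makes the net loss equal to 1. *)
set C := k%:R / (k%:R - mu).
have C0 : 0 < C by rewrite divr_gt0.
have CE : C - C * mu / k%:R = 1.
  rewrite /C; field; by rewrite !gt_eqF.
(* The term in [wait] spreads the growth [mu] evenly over the period, and the first [mu] compensates
   for its sign, so that [f >= C * (D + 2)]. The [2] comes from [(D - 1) * (D + 2) >= D ^ 2] for
   [D >= 2]. *)
pose f (n D : nat) : R := C * (D%:R + mu - mu * (wait k n)%:R / k%:R + 2).
have w_k n : (wait k n)%:R <= k%:R :> R by rewrite ler_nat ltnW // ltn_pmod.
have muw n : mu * (wait k n)%:R / k%:R <= mu.
  by rewrite ler_pdivrMr // ler_wpM2l.
have f0 n D : 0 <= f n D.
  rewrite /f mulr_ge0 ?(ltW C0) //.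
  have : (0 : R) <= D%:R by []. have := muw n; lra.
have ineq n D : (1 < D)%N -> stay_prob R D * f n D <= f n D - C.
  move=> D1; rewrite /stay_prob mulrBl mul1r lerD2l lerN2.
  have D1R : (2 : R) <= D%:R by rewrite ler_nat.
  have fD : C * (D%:R + 2) <= f n D.
    rewrite /f ler_pM2l //; have := muw n; lra.
  apply: (@le_trans _ _ ((D%:R - 1) / D%:R ^+ 2 * (C * (D%:R + 2)))); last first.
    by rewrite ler_wpM2l // divr_ge0 ?sqr_ge0 // subr_ge0; lra.
  rewrite mulrAC ler_pdivlMr; last by rewrite exprn_gt0 //; lra.
  have : 0 <= C * (D%:R - 2) by rewrite mulr_ge0 ?subr_ge0 // ltW.
  rewrite expr2; lra.
have H := @star_supersolution _ _ _ _ _ xi_iid k l k_gt0 W f f0.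
apply: (@le_trans _ _ (2%:E * (f 0%N l.+1)%:E)%E).
  apply: lee_wpmul2l => //; apply: H => n D lD.
  have D1 : (1 < D)%N by apply: leq_ltn_trans lD.
  case: (boolP (k %| n)%N) => kn /=.
    apply: (@le_trans _ _ (1%:E + (C * mu + f n.+1 D - C)%:E)%E).
      rewrite leeD2l //; apply: (@le_mean _ _ _ _ (xi 1%N)
         (fun j => stay_prob R (D + j) * f n.+1 (D + j)%N)
         (fun j => C * j%:R + (f n.+1 D - C))).
      + by move=> j; rewrite mulr_ge0 ?stay_prob_ge0.
      + move=> j; apply: le_trans (ineq _ _ _) _; first by rewrite ltn_addr.
        rewrite /f natrD; lra.
      + rewrite -addrA; apply: has_meanD; last exact: has_mean_cst.
        exact: has_meanZ.
    rewrite -EFinD lee_fin /f waitS // kn wait0 // -subn1 natrB //.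
    rewrite -[X in _ <= X]addr0 -subr_le0 addr0.
    have -> : 1 + (C * mu + C * (D%:R + mu - mu * (k%:R - 1) / k%:R + 2) - C) -
        C * (D%:R + mu - mu * 0 / k%:R + 2) = 1 - (C - C * mu / k%:R).
      by field; rewrite gt_eqF.
    by rewrite CE subrr.
  rewrite addn0 integral_cst //.
  have -> : ((stay_prob R D * f n.+1 D)%:E * PE [set: OmegaE] =
      (stay_prob R D * f n.+1 D)%:E)%E.
    by rewrite -[RHS]mule1; congr (_ * _)%E; exact: probability_setT.
  rewrite -EFinD lee_fin; apply: (@le_trans _ _ (1 + (f n.+1 D - C))).
    by rewrite lerD2l ineq.
  rewrite /f waitS // (negbTE kn) -subn1 natrB ?wait_gt0 //.
  rewrite -subr_le0.
  have -> : 1 + (C * (D%:R + mu - mu * ((wait k n)%:R - 1) / k%:R + 2) - C) -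
        C * (D%:R + mu - mu * (wait k n)%:R / k%:R + 2) = 1 - (C - C * mu / k%:R).
    by field; rewrite gt_eqF.
  by rewrite CE subrr.
(* What remains is [l + 3 + mu <= (mu + 4) * l] for [l >= 1]. *)
rewrite -EFinM lee_fin /f wait0 // mulr0 mul0r subr0 -!mulrA ler_pM2l // ler_pM2l //.
have l1 : (1 : R) <= l%:R by rewrite ler1n.
have : 0 <= mu * (l%:R - 1) by rewrite mulr_ge0 // subr_ge0.
by rewrite -natr1 ler_pM2l ?invr_gt0 //; lra.
Qed.

(** The value [D * ln (N / D)] gains about [m1 * ln (N / D)] from a growth, which beats the loss
    [k * ln (N / D)] through exits during a period; the error terms are controlled by the first two
    moments of [t], uniformly in [N]. *)
Lemma star_exit_infinite (t : nat -> nat) (m1 m2 : R) : (forall j, (t j <= j)%N) ->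
  has_mean (xi 1%N) (fun j => (t j)%:R) m1 ->
  has_mean (xi 1%N) (fun j => (t j)%:R ^+ 2) m2 ->
  k%:R <= m1 -> expected_exit_time W = +oo%E.
Proof.
move=> tj mean1 mean2 km1; rewrite expected_exit_time_surv //.
rewrite nneseriesZl; last by move=> *; exact: surv_ge0.
have k0 : (0 : R) < k%:R by rewrite ltr0n.
have m2_ge0 : 0 <= m2.
  rewrite -lee_fin -(proj2 mean2); apply: integral_ge0 => v _.
  by rewrite lee_fin sqr_ge0.
set c := m1 + m2; have c0 : 0 < c by rewrite /c; lra.
(* As [c] does not depend on [N], letting [N] grow makes the left side exceed any bound. *)
suff bound (N : nat) : (0 < N)%N ->
    ((l.+1%:R * ln (N%:R / l.+1%:R))%:E <= c%:E * \sum_(n <oo) surv W n)%E.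
  have l0 : (0 : R) < l.+1%:R by rewrite ltr0n.
  suff -> : (\sum_(n <oo) surv W n = +oo)%E by rewrite gt0_muley // lte_fin.
  apply/eqyP => A A0; have cA : 0 < c * A by rewrite mulr_gt0.
  have [b b_ge] : exists b : nat, expR (c * A) <= b%:R.
    exists (Num.bound (expR (c * A))); apply/ltW/archi_boundP; exact: expR_ge0.
  have b0 : (0 : R) < b%:R by apply: lt_le_trans b_ge; exact: expR_gt0.
  have := bound (l.+1 * b)%N; rewrite muln_gt0 /= -(ltr0n R) b0 natrM => /(_ isT) H.
  rewrite -(@lee_pmul2l _ c%:E) ?lte_fin // -EFinM; apply: le_trans H.
  rewrite lee_fin mulrAC mulfV ?gt_eqF // mul1r.
  apply: (@le_trans _ _ (1 * ln b%:R)); last first.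
    rewrite ler_wpM2r ?ler1n //; apply: ln_ge0; apply: le_trans b_ge.
    by rewrite -expR0 ler_expR ltW.
  by rewrite mul1r -ler_expR lnK // posrE.
move=> N0; have NR : (0 : R) < N%:R by rewrite ltr0n.
pose F (D : nat) : R := D%:R * Num.max (ln (N%:R / D%:R)) 0.
have F0 D : 0 <= F D by rewrite mulr_ge0 // le_max lexx orbT.
have FN D : F D <= N%:R.
  rewrite /F; case: D => [|D]; first by rewrite mul0r.
  have DR : (0 : R) < D.+1%:R by rewrite ltr0n.
  rewrite mulrC -ler_pdivlMr // ge_max; apply/andP; split; last first.
    by rewrite divr_ge0 // ltW.
  have y0 : 0 < N%:R / D.+1%:R :> R by rewrite divr_gt0.
  set y := N%:R / D.+1%:R in y0 *.
  have H : ln (1 + (y - 1)) <= y - 1 by apply: le_ln1Dx; lra.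
  by move: H; rewrite addrC subrK; lra.
(* The power bounds from below the survival probability until the next growth, so that only growth
   times need an estimate. *)
pose f (n D : nat) : R := (1 - D%:R^-1) ^+ (wait k n) * F D.
have q01 (D : nat) : (0 < D)%N -> 0 <= (1 - D%:R^-1 : R) <= 1.
  by move=> D0; rewrite subr_ge0 invf_le1 ?ltr0n // ler1n D0 gerBl invr_ge0 ler0n.
have fM n D : 0 <= f n D <= N%:R.
  rewrite /f; case: D => [|D]; first by rewrite /F !mul0r mulr0 lexx ler0n.
  have /andP[q0 q1] := q01 D.+1 isT.
  rewrite mulr_ge0 ?exprn_ge0 //=; apply: le_trans (FN D.+1).
  by rewrite ler_piMl // exprn_ile1.
apply: (@le_trans _ _ (f 0%N l.+1)%:E).
  rewrite lee_fin /f wait0 // expr0 mul1r /F ler_pM2l ?ltr0n //.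
  by rewrite le_max lexx.
apply: (@star_subsolution _ _ _ _ _ xi_iid k l k_gt0 W f t c N%:R) => //.
move=> n D D' /andP[lD' D'D].
have D'0 : (0 < D')%N by apply: leq_ltn_trans lD'.
have /andP[q0 q1] := q01 D' D'0.
case: (boolP (k %| n)%N) => kn; last first.
  rewrite /= !addn0 integral_cst //.
  have -> : ((stay_prob R D * f n.+1 D')%:E * PE [set: OmegaE] =
      (stay_prob R D * f n.+1 D')%:E)%E.
    by rewrite -[RHS]mule1; congr (_ * _)%E; exact: probability_setT.
  rewrite -EFinD lee_fin; apply: (@le_trans _ _ (stay_prob R D * f n.+1 D')); last by lra.
  rewrite {1}/f -(prednK (wait_gt0 k_gt0 kn)) exprS -mulrA.
  have -> : (1 - D'%:R^-1) ^+ (wait k n).-1 * F D' = f n.+1 D'.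
    by rewrite /f waitS // (negbTE kn).
  by rewrite ler_wpM2r ?stay_prob_ge ?D'0 //; case/andP: (fM n.+1 D').
have -> : f n D' = F D' by rewrite /f wait0 // expr0 mul1r.
have DR' : (1 : R) <= D'%:R by rewrite ler1n.
have D'pos : (0 : R) < D'%:R by lra.
pose L : R := ln (N%:R / D'%:R).
have [L0|L0] := leP L 0.
  rewrite /F (max_idPr L0) mulr0 adde_ge0 // ?lee_fin ?(ltW c0) //.
  apply: integral_ge0 => v _; rewrite lee_fin mulr_ge0 ?stay_prob_ge0 //.
  by case/andP: (fM n.+1 (D' + t (xi 1%N v))%N).
have -> : F D' = D'%:R * L by rewrite /F (max_idPl (ltW L0)).
(* The minorant to be averaged is [(D' + t j - k) * L - t j - (t j) ^ 2]; adding [c] to its mean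
   leaves [D' * L + (m1 - k) * L]. *)
apply: (@le_trans _ _ (c%:E + (L * m1 + (- 1 * m1 + (- 1 * m2 + (D'%:R - k%:R) * L)))%:E)%E).
  rewrite -EFinD lee_fin /c.
  have : 0 <= L * (m1 - k%:R) by apply: mulr_ge0; [exact: ltW|rewrite subr_ge0].
  lra.
rewrite leeD2l //; apply: (@ge_mean _ _ _ _ (xi 1%N)
  (fun j => stay_prob R (D + j) * f n.+1 (D' + t j)%N)
  (fun j => L * (t j)%:R + (- 1 * (t j)%:R + (- 1 * (t j)%:R ^+ 2 + (D'%:R - k%:R) * L)))).
- by move=> j; rewrite mulr_ge0 ?stay_prob_ge0 //; case/andP: (fM n.+1 (D' + t j)%N).
- move=> j; set E := (D' + t j)%N.
  have E0 : (0 < E)%N by rewrite ltn_addr.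
  have ER : (0 : R) < E%:R by rewrite ltr0n.
  have EE : E%:R = D'%:R + (t j)%:R :> R by rewrite /E natrD.
  have tR : (0 : R) <= (t j)%:R by [].
  have /andP[p0 p1] := q01 E E0.
  apply: (@le_trans _ _ ((1 - E%:R^-1) ^+ k * F E)); last first.
    rewrite /f waitS // kn -{1}(prednK k_gt0) exprS -mulrA ler_wpM2r //.
      by rewrite mulr_ge0 ?exprn_ge0.
    by rewrite stay_prob_ge // E0 leq_add.
  (* If [E < k], the Bernoulli bound [1 - k / E] is negative, but the minorant is nonpositive as
     well. *)
  have [kE|Ek] := leqP k E; last first.
    apply: (@le_trans _ _ 0); last by rewrite mulr_ge0 ?exprn_ge0.
    have : (E%:R : R) <= k%:R by rewrite ler_nat ltnW.
    rewrite EE => ?; have : 0 <= L * (k%:R - (D'%:R + (t j)%:R)).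
      by rewrite mulr_ge0 ?(ltW L0) // subr_ge0.
    have := sqr_ge0 ((t j)%:R : R); lra.
  have kER : (k%:R : R) <= E%:R by rewrite ler_nat.
  have bern : (1 - k%:R / E%:R : R) <= (1 - E%:R^-1) ^+ k.
    by apply: bernoulli_le; rewrite invr_ge0 ler0n invf_le1 ?ler1n.
  pose lE : R := ln (N%:R / E%:R).
  have lEL : L - (t j)%:R / D'%:R <= lE.
    rewrite /L /lE !lnM ?posrE ?invr_gt0 // !lnV ?posrE //.
    have -> : E%:R = D'%:R * (1 + (t j)%:R / D'%:R) :> R.
      by rewrite EE; field; rewrite gt_eqF.
    have x0 : 0 <= (t j)%:R / D'%:R :> R by rewrite divr_ge0.
    have x1 : 0 < 1 + (t j)%:R / D'%:R :> R by lra.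
    rewrite (lnM _ x1) ?posrE //.
    have H : ln (1 + (t j)%:R / D'%:R) <= (t j)%:R / D'%:R :> R by apply: le_ln1Dx; lra.
    lra.
  apply: (@le_trans _ _ ((E%:R - k%:R) * lE)); last first.
    apply: (@le_trans _ _ ((1 - k%:R / E%:R) * F E)); last by rewrite ler_wpM2r.
    apply: (@le_trans _ _ ((1 - k%:R / E%:R) * (E%:R * lE))).
      rewrite le_eqVlt; apply/orP; left; apply/eqP; field; by rewrite gt_eqF.
    rewrite ler_wpM2l ?subr_ge0 ?ler_pdivrMr ?mul1r //.
    by rewrite ler_wpM2l // le_max lexx.
  apply: (@le_trans _ _ ((E%:R - k%:R) * (L - (t j)%:R / D'%:R))); last first.
    by rewrite ler_wpM2l // subr_ge0.
  have tD : (t j)%:R / D'%:R <= (t j)%:R :> R.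
    by rewrite ler_pdivrMr // ler_peMr.
  have : (E%:R - k%:R) * ((t j)%:R / D'%:R) <= E%:R * ((t j)%:R / D'%:R) :> R.
    by rewrite ler_wpM2r ?divr_ge0 // gerBl.
  have -> : E%:R * ((t j)%:R / D'%:R) = (t j)%:R + (t j)%:R * ((t j)%:R / D'%:R) :> R.
    by rewrite EE; field; rewrite gt_eqF.
  have : (t j)%:R * ((t j)%:R / D'%:R) <= (t j)%:R * (t j)%:R :> R by rewrite ler_wpM2l.
  rewrite EE; lra.
- apply: has_meanD; first exact: has_meanZ.
  apply: has_meanD; first exact: has_meanZ.
  apply: has_meanD; first exact: has_meanZ.
  exact: has_mean_cst.
Qed.

End StarExit.

(** * Moments of the environment *)

Section Moments.
Context (R : realType) (d : measure_display) (OmegaE : measurableType d).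
Context (PE : probability OmegaE R) (X : {RV PE >-> nat}).

Let mX (A : set nat) : measurable (X @^-1` A).
Proof. by rewrite -[X in measurable X]setTI; exact: measurable_funP. Qed.

Lemma has_mean_bounded (h : nat -> R) (B : R) : (forall j, 0 <= h j <= B) ->
  exists c, has_mean X h c.
Proof.
move=> hB; have h0 j : 0 <= h j by have /andP[] := hB j.
have fin : (\int[PE]_v (h (X v))%:E < +oo)%E.
  apply: (@le_lt_trans _ _ B%:E); last by rewrite ltry.
  apply: (le_mean (h := fun=> B)) => //; last exact: has_mean_cst.
  by move=> j; have /andP[] := hB j.
exists (fine (\int[PE]_v (h (X v))%:E)); apply: ge0_has_mean => //.
rewrite fineK // ge0_fin_numE //; apply: integral_ge0 => v _.
by rewrite lee_fin.
Qed.

(** Tonelli for the indicators of [m < X]. With [u = 1] it is the tail formula for the mean, with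
    [u m = 2 * m + 1] the one for the second moment. *)
Lemma integral_tail_sum (u : nat -> R) : (forall m, 0 <= u m) ->
  (\int[PE]_v (\sum_(m < X v) u m)%:E =
   \sum_(m <oo) (u m)%:E * PE [set v | (m < X v)%N])%E.
Proof.
move=> u0.
transitivity (\int[PE]_v \sum_(m <oo) ((u m)%:E * (\1_[set v | (m < X v)%N] v)%:E))%E.
  apply: eq_integral => v _; rewrite (nneseries_split 0 (X v)); last first.
    by move=> m _; rewrite mule_ge0 ?lee_fin.
  rewrite add0n [X in (_ + X)%E]eseries0 ?adde0; last first.
    by move=> m Xm _; rewrite indicE memNset ?mule0 //= ltnNge Xm.
  rewrite big_mkord -sumEFin; apply: eq_bigr => m _.
  by rewrite indicE mem_set ?mule1 /=.
have mS m : measurable [set v | (m < X v)%N] by exact: (mX [set j | (m < j)%N]).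
rewrite integral_nneseries //.
- apply: eq_eseriesr => m _; rewrite ge0_integralZl ?lee_fin //.
  + by congr (_ * _)%E; rewrite integral_indic // setIT.
  + by apply/measurable_EFinP; exact: measurable_indic.
- move=> m; apply: measurable_funeM.
  by apply/measurable_EFinP; exact: measurable_indic.
- by move=> m v _; rewrite mule_ge0 ?lee_fin.
Qed.

(** The truncated means are the partial sums of the tail series of [mu]; if all were below [k], so
    would be, weakly, the limit. *)
Lemma truncated_mean (mu k : R) : has_mean X (fun j => j%:R) mu -> k < mu ->
  exists M m1 m2, [/\ has_mean X (fun j => (minn j M)%:R) m1,
    has_mean X (fun j => (minn j M)%:R ^+ 2) m2 & k <= m1].
Proof.
move=> mean_mu k_mu.
suff [M [m1 [H km1]]] : exists M m1, has_mean X (fun j => (minn j M)%:R) m1 /\ k <= m1.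
  have [|m2 H2] := @has_mean_bounded (fun j => (minn j M)%:R ^+ 2) (M%:R ^+ 2).
    by move=> j; rewrite exprn_ge0 //= lerXn2r ?nnegrE // ler_nat geq_minr.
  by exists M, m1, m2.
apply: contrapT => nex; suff : mu <= k by rewrite leNgt k_mu.
rewrite -lee_fin -(proj2 mean_mu).
have -> : (\int[PE]_v ((X v)%:R)%:E = \int[PE]_v (\sum_(m < X v) (1 : R))%:E)%E.
  by apply: eq_integral => v _; rewrite sumr_const card_ord.
rewrite (@integral_tail_sum (fun=> 1)) //; apply: lime_le.
  by apply: is_cvg_nneseries => m _ _; rewrite mule_ge0 ?lee_fin.
apply: nearW => M.
have [|m1 H] := @has_mean_bounded (fun j => (minn j M)%:R) M%:R.
  by move=> j; rewrite ler0n ler_nat geq_minr.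
apply: (@le_trans _ _ m1%:E); last first.
  by rewrite lee_fin; apply: ltW; rewrite ltNge; apply/negP => km1; apply: nex; exists M, m1.
rewrite -(proj2 H) le_eqVlt; apply/orP; left; apply/eqP.
transitivity (\sum_(m <oo) (((m < M)%N%:R : R)%:E * PE [set v | (m < X v)%N]))%E.
  rewrite (nneseries_split 0 M); last by move=> m _; rewrite mule_ge0 ?lee_fin.
  rewrite add0n [X in (_ + X)%E]eseries0 ?adde0; last first.
    by move=> m Mm _; rewrite ltnNge Mm mul0e.
  by rewrite !big_mkord; apply: eq_bigr => m _; rewrite ltn_ord.
rewrite -(@integral_tail_sum (fun m => (m < M)%N%:R)) //; apply: eq_integral => v _; congr _%:E.
rewrite -natr_sum; congr _%:R.
elim: (X v) => [|j IH]; first by rewrite big_ord0 min0n.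
by rewrite big_ord_recr /= IH; case: (ltnP j M); lia.
Qed.

(** The value [k] is taken almost surely, whereas [star_exit_infinite] wants a truncation below the
    identity everywhere; hence all other values are sent to 0. *)
Lemma mean_of_constant (k : nat) : PE [set w | X w = k] = 1%E ->
  has_mean X (fun j => (if j == k then k else 0)%N%:R) k%:R /\
  has_mean X (fun j => (if j == k then k else 0)%N%:R ^+ 2) (k%:R ^+ 2).
Proof.
move=> Xk; have main (a : R) : 0 <= a -> has_mean X (fun j => a * (j == k)%:R) a.
  move=> a0; rewrite -{2}[a]mulr1; apply: has_meanZ; apply: ge0_has_mean => //.
  rewrite -Xk -[X in PE X]setIT -(integral_indic PE measurableT) //; last exact: (mX [set k]).
  apply: eq_integral => v _; rewrite indicE.
  by case: eqP => E; [rewrite mem_set|rewrite memNset].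
split.
  rewrite (_ : (fun j => _) = (fun j => k%:R * (j == k)%:R)); first exact: main.
  by apply/funext => j; case: eqP; rewrite ?mulr1 ?mulr0.
rewrite (_ : (fun j => _) = (fun j => k%:R ^+ 2 * (j == k)%:R)).
  by apply: main; rewrite exprn_ge0.
by apply/funext => j; case: eqP; rewrite ?mulr1 ?mulr0 // expr0n.
Qed.

(** Otherwise every positive value is null, and the mean, summed over the atoms, is 0. *)
Lemma pos_atom (mu : R) : has_mean X (fun j => j%:R) mu -> 0 < mu ->
  exists c : nat, (0 < c)%N /\ exists2 p : R, 0 < p & has_mean X (fun j => (j == c)%:R) p.
Proof.
move=> mean_mu mu0; apply: contrapT => nex; move: mu0; apply/negP; rewrite -leNgt.
rewrite -lee_fin -(proj2 mean_mu).
rewrite (ge0_integral_disintegration (Z := fun _ => tt) _ (fun y => mX [set y])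
  (K := fun _ y => PE (X @^-1` [set y])) (G := fun _ y => (y%:R)%:E)) //.
- rewrite integral0_eq // => v _; apply: eseries0 => c _ _.
  case: c => [|c]; first by rewrite mule0.
  have [->|Pc] := eqVneq (PE (X @^-1` [set c.+1])) 0%E; first by rewrite mul0e.
  exfalso; apply: nex; exists c.+1; split => //.
  have pE : PE (X @^-1` [set c.+1]) = (fine (PE (X @^-1` [set c.+1])))%:E.
    by rewrite fineK // fin_num_measure.
  exists (fine (PE (X @^-1` [set c.+1]))).
    by rewrite -lte_fin -pE lt_neqAle eq_sym Pc measure_ge0.
  apply: ge0_has_mean => //.
  have I := integral_indic PE measurableT (mX [set c.+1]); rewrite setIT in I.
  rewrite -pE -I.
  apply: eq_integral => w _; rewrite indicE.
  by case: eqP => E; [rewrite mem_set|rewrite memNset].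
- move=> u; rewrite (_ : _ @^-1` _ = setT) //; apply/seteqP; split => //; by case: u.
- move=> u y; rewrite (_ : _ @^-1` [set u] = setT); last first.
    by apply/seteqP; split => //; case: u.
  by rewrite setTI -[LHS]mul1e; congr (_ * _)%E; exact/esym/probability_setT.
Qed.

End Moments.

Section SecondMoment.
Context (R : realType) (d : measure_display) (OmegaE : measurableType d).
Context (PE : probability OmegaE R) (X : {RV PE >-> nat}).

Lemma tail_of_limsup :
  limn_esup (fun n : nat =>
      ((ln n%:R ^+ 2 / n%:R)%R%:E *
       lne (PE [set w | (n%:R / ln n%:R < (X w)%:R :> R)%R]))%E) = -oo%E ->
  exists N : nat, forall n, (N <= n)%N ->
    (PE [set w | (n < X w)%N] <= ((n%:R ^+ 3)^-1)%:E)%E.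
Proof.
rewrite /limn_esup limf_esupE => inf_oo.
(* The level 18 is [3 * 6]: with [x = ln n], the bounds [ln p <= - 18 * n / x ^ 2] and
   [x ^ 3 <= 6 * n] give [ln p <= - 3 * x]. *)
have : (ereal_inf [set ereal_sup ((fun n : nat =>
      ((ln n%:R ^+ 2 / n%:R)%R%:E *
       lne (PE [set w | (n%:R / ln n%:R < (X w)%:R :> R)%R]))%E) @` V) | V in \oo]
     < (- 18 : R)%:E)%E by rewrite inf_oo ltNyr.
move=> /ereal_inf_lt [_ [V [N _ NV] <-] supV].
(* Taking [n] above [expR 1] gives [ln n >= 1], so that [X > n] implies [X > n / ln n]. *)
exists (maxn N (Num.bound (expR 1 : R))) => n; rewrite geq_max => /andP[Nn n3].
have := le_lt_trans (ereal_sup_ubound _) supV.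
move=> /(_ _ (ex_intro2 _ _ n (NV n Nn) erefl)) => H.
have n3R : (expR 1 : R) <= n%:R.
  apply: le_trans (ltW (archi_boundP (expR_ge0 1))) _; by rewrite ler_nat.
have n0 : (0 : R) < n%:R by apply: lt_le_trans n3R; exact: expR_gt0.
set x := ln (n%:R : R) in H.
have x1 : 1 <= x.
  by rewrite -(expRK 1) ler_ln ?posrE ?expR_gt0.
have x3 : x ^+ 3 <= 6 * n%:R.
  have := @expR_ge1Dxn R x 2; rewrite /x lnK ?posrE // -/x.
  move=> /(_ (le_trans ler01 x1)); have -> : (3`!%:R : R) = 6 by [].
  lra.
have mS (A : set nat) : measurable (X @^-1` A).
  by rewrite -[X in measurable X]setTI; exact: measurable_funP.
set p := PE _ in H.
have pfin : p = (fine p)%:E.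
  by rewrite fineK // fin_num_measure //; exact: (mS [set j | n%:R / x < j%:R]).
apply: (@le_trans _ _ p).
  apply: le_measure; rewrite ?inE; [exact: (mS [set j | (n < j)%N])|
     exact: (mS [set j | n%:R / x < j%:R])|].
  move=> w /= nX; apply: (@le_lt_trans _ _ n%:R); last by rewrite ltr_nat.
  by rewrite ler_pdivrMr ?(lt_le_trans ltr01) // ler_peMr // ltW.
rewrite pfin lee_fin; rewrite pfin in H.
have [p0|p0] := leP (fine p) 0.
  by apply: (le_trans p0); rewrite invr_ge0 exprn_ge0 // ltW.
move: H; rewrite lne_EFin // -EFinM lte_fin => H.
rewrite -ler_ln ?posrE ?invr_gt0 ?exprn_gt0 //.
rewrite lnV ?posrE ?exprn_gt0 // lnXn // -/x -[x *+ 3]mulr_natl.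
have {}H : x ^+ 2 * ln (fine p) <= - 18 * n%:R.
  by move: H; rewrite mulrAC ltr_pdivrMr // => /ltW.
have x2 : 0 < x ^+ 2 by rewrite exprn_gt0 // (lt_le_trans ltr01).
rewrite -(ler_pM2l x2); apply: (le_trans H).
have : x ^+ 2 * - (3 * x) = - 3 * x ^+ 3 by ring.
lra.
Qed.

Lemma second_moment_of_tail (N : nat) :
  (forall n, (N <= n)%N -> (PE [set w | (n < X w)%N] <= ((n%:R ^+ 3)^-1)%:E)%E) ->
  exists m2, has_mean X (fun j => j%:R ^+ 2) m2.
Proof.
move=> tail.
have sq j : (j%:R ^+ 2 : R) = \sum_(m < j) (2 * m%:R + 1).
  elim: j => [|j IH]; first by rewrite big_ord0 expr0n.
  by rewrite big_ord_recr /= -IH -natr1; ring.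
suff fin : (\int[PE]_v ((X v)%:R ^+ 2)%:E < +oo)%E.
  exists (fine (\int[PE]_v ((X v)%:R ^+ 2 : R)%:E)); apply: ge0_has_mean => //.
  rewrite fineK // ge0_fin_numE //; apply: integral_ge0 => v _.
  by rewrite lee_fin sqr_ge0.
under eq_integral => v _ do rewrite sq.
rewrite (@integral_tail_sum _ _ _ _ _ (fun m => 2 * m%:R + 1)); last first.
  by move=> m; rewrite addr_ge0 ?mulr_ge0.
have u0 m : (0 <= (2 * m%:R + 1 : R)%:E)%E by rewrite lee_fin addr_ge0 ?mulr_ge0.
(* Starting at [N.+1] keeps [m] positive besides being in the range of [tail]. *)
rewrite (nneseries_split 0 N.+1); last by move=> m _; rewrite mule_ge0.
(* As [(2 * m + 1) / m ^ 3 <= 6 / (m * (m + 1))] for [m >= 1], the tail is dominated by a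
   telescoping sum. *)
have telesc M : \sum_(N.+1 <= m < N.+1 + M) (6 / (m%:R * (m%:R + 1))) <= 6 * (1 - (N.+1 + M)%:R^-1) :> R.
  elim: M => [|M IH].
    by rewrite addn0 big_geq // mulr_ge0 // subr_ge0 invf_le1 ?ler1n ?ltr0n.
  have Y0 : (0 < N.+1 + M)%N by rewrite addSn.
  rewrite addnS big_nat_recr ?leq_addr //; move: IH Y0; set Y := (N.+1 + M)%N => IH Y0 /=.
  apply: (le_trans (lerD IH (lexx _))); rewrite -natr1.
  have y0 : 0 < Y%:R :> R by rewrite ltr0n.
  rewrite le_eqVlt; apply/orP; left; apply/eqP; field.
  by rewrite !gt_eqF //; lra.
rewrite add0n; apply: lte_add_pinfty.
  apply: lte_sum_pinfty => m _; rewrite muleC -[PE _]fineK ?ltry //.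
  have mS : measurable (X @^-1` [set j | (m < j)%N]).
    by rewrite -[X in measurable X]setTI; exact: measurable_funP.
  exact: fin_num_measure.
apply: (@le_lt_trans _ _ 6%:E); last by rewrite ltry.
apply: lime_le; first by apply: is_cvg_nneseries => m _ _; rewrite mule_ge0.
apply: nearW => M.
have [MN|NM] := leqP M N.+1; first by rewrite big_geq.
apply: (@le_trans _ _ (\sum_(N.+1 <= m < M) (6 / (m%:R * (m%:R + 1)))%:E)%E).
  rewrite big_nat_cond [leRHS]big_nat_cond; apply: lee_sum => m /andP[/andP[Nm _] _].
  apply: (@le_trans _ _ ((2 * m%:R + 1)%:E * ((m%:R ^+ 3)^-1)%:E)%E).
    by apply: lee_wpmul2l => //; apply: tail; exact: ltnW.
  have m1 : (1 : R) <= m%:R by rewrite ler1n; apply: leq_ltn_trans Nm.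
  rewrite -EFinM lee_fin ler_pdivrMr ?exprn_gt0 ?(lt_le_trans ltr01) //.
  have -> : 6 / (m%:R * (m%:R + 1)) * m%:R ^+ 3 = 6 * m%:R ^+ 2 / (m%:R + 1) :> R.
    by field; rewrite !gt_eqF //; lra.
  rewrite ler_pdivlMr; last by lra.
  have : 0 <= (m%:R - 1) * (m%:R : R) by rewrite mulr_ge0 // subr_ge0.
  rewrite !expr2; lra.
rewrite sumEFin lee_fin -(subnKC (ltnW NM)); apply: (le_trans (telesc _)).
by rewrite ler_piMr // gerBl invr_ge0.
Qed.

End SecondMoment.

(** * Rooted trees and parity *)

Section Trees.
Implicit Types (T ext : rtree) (x y u v : nat).
Local Open Scope nat_scope.

(** One entry per incident edge; the self-loop makes the root a neighbour of itself. *)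
Definition nbrs T x : seq nat := [seq other_end x a | a <- incident T x].

Lemma nvert_cat T ext : nvert (T ++ ext) = nvert T + size ext.
Proof. by rewrite /nvert size_cat. Qed.

Lemma nvert_attach T x j : nvert (attach T x j) = nvert T + j.
Proof. by rewrite nvert_cat size_nseq. Qed.

Lemma parent_cat T ext v : v < nvert T -> parent (T ++ ext) v = parent T v.
Proof. by move=> vT; rewrite /parent -cat_cons nth_cat vT. Qed.

Lemma parent_cat_new T ext i : i < size ext ->
  parent (T ++ ext) (nvert T + i) = nth 0 ext i.
Proof.
by move=> _; rewrite /parent -cat_cons nth_cat /= ltnNge leq_addr /= addKn.
Qed.

Lemma parent_new_in T ext v : nvert T <= v < nvert (T ++ ext) -> parent (T ++ ext) v \in ext.
Proof.
rewrite nvert_cat => /andP[Tv vn]; have vs : v - nvert T < size ext by rewrite ltn_subLR.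
by rewrite -(subnKC Tv) parent_cat_new // mem_nth.
Qed.

Lemma parent_lt T v : is_rtree T -> v < nvert T -> parent T v < nvert T.
Proof.
move=> [/allP allT _]; rewrite /parent /nvert; case: v => [|v] //= vT.
by apply: allT; exact: mem_nth.
Qed.

Lemma iter_parent_lt T v i : is_rtree T -> v < nvert T -> iter i (parent T) v < nvert T.
Proof. by move=> rT vT; elim: i => //= i IH; exact: parent_lt. Qed.

Lemma parent0 T : parent T 0 = 0.
Proof. by []. Qed.

Lemma parent_neq T v : is_rtree T -> v < nvert T -> v != 0 -> parent T v != v.
Proof.
move=> [_ rT] vT v0; apply/eqP => E; have [j] := rT v vT.
by elim: j => [|j IH]; [move=> /eqP; rewrite (negbTE v0)|rewrite iterSr E].
Qed.

Lemma is_rtree_attach T x j : is_rtree T -> x < nvert T -> is_rtree (attach T x j).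
Proof.
move=> rT xT; have [/allP allT reach] := rT; split.
  apply/allP => p; rewrite mem_cat nvert_attach => /orP[/allT pT|].
    exact: leq_trans pT (leq_addr _ _).
  by rewrite mem_nseq => /andP[_ /eqP ->]; exact: leq_trans xT (leq_addr _ _).
have old v i : v < nvert T -> iter i (parent (attach T x j)) v = iter i (parent T) v.
  move=> vT; elim: i => //= i ->; apply: parent_cat.
  exact: iter_parent_lt.
move=> v; rewrite /is_vertex => vn.
have [vT|Tv] := ltnP v (nvert T).
  by have [i E] := reach v vT; exists i; rewrite old.
have [i E] := reach x xT; exists i.+1; rewrite iterSr.
have : parent (attach T x j) v \in nseq j x by apply: parent_new_in; rewrite Tv.
by rewrite mem_nseq => /andP[_ /eqP ->]; rewrite old.
Qed.

Lemma incidentE T x : incident T x =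
  [seq (parent T v, v) | v <- iota 0 (nvert T) & (parent T v == x) || (v == x)].
Proof. by rewrite /incident /edges filter_map. Qed.

Lemma mem_nbrs T x y : y \in nbrs T x ->
  y < nvert T /\ (parent T y = x \/ y = parent T x /\ x < nvert T) \/
  y = parent T x /\ x < nvert T.
Proof.
rewrite /nbrs incidentE => /mapP[a /mapP[v]].
rewrite mem_filter mem_iota add0n => /andP[vx vT] -> ->; rewrite /other_end /=.
case: eqP vx => [-> _|_ /= /eqP <-]; [by left; split => //; left|by right].
Qed.

Lemma child_nbrs T y : y < nvert T -> y \in nbrs T (parent T y).
Proof.
move=> yT; apply/mapP; exists (parent T y, y); last by rewrite /other_end eqxx.
rewrite incidentE; apply/mapP; exists y => //.
by rewrite mem_filter eqxx mem_iota.
Qed.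

Lemma parent_nbrs T x : is_rtree T -> x < nvert T -> parent T x \in nbrs T x.
Proof.
move=> rT xT; have [->|x0] := eqVneq x 0; first by rewrite -{2}(parent0 T) child_nbrs.
apply/mapP; exists (parent T x, x); last by rewrite /other_end /= (negbTE (parent_neq rT xT x0)).
rewrite incidentE; apply/mapP; exists x => //.
by rewrite mem_filter eqxx orbT mem_iota.
Qed.

Lemma nbrs_lt T x y : is_rtree T -> y \in nbrs T x -> y < nvert T.
Proof.
by move=> rT /mem_nbrs[[//]|[-> xT]]; exact: parent_lt.
Qed.

Lemma incident_attach T x j v : v < nvert T ->
  incident (attach T x j) v =
  incident T v ++ (if v == x then [seq (x, nvert T + i) | i <- iota 0 j] else [::]).
Proof.
move=> vT; rewrite !incidentE nvert_attach iotaD filter_cat map_cat add0n.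
congr (_ ++ _).
  rewrite (@eq_in_filter _ _ (fun u => (parent T u == v) || (u == v))); last first.
    by move=> u; rewrite mem_iota => uT; rewrite parent_cat.
  apply/eq_in_map => u; rewrite mem_filter mem_iota => /andP[_ uT].
  by rewrite parent_cat.
rewrite -[X in iota X j]addn0 iotaDl filter_map -map_comp.
have par i : i \in iota 0 j -> parent (attach T x j) (nvert T + i) = x.
  rewrite mem_iota add0n /= => ij; rewrite parent_cat_new ?size_nseq //.
  by rewrite nth_nseq ij.
rewrite (@eq_in_filter _ _ (fun=> v == x)); last first.
  move=> i ij /=; rewrite par // (eq_sym x); case: eqP => //= _.
  by apply/negbTE; rewrite neq_ltn orbC (leq_trans vT) ?leq_addr.
case: ifP => _; last by rewrite filter_pred0.
rewrite filter_predT; apply/eq_in_map => i ij /=; by rewrite par.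
Qed.

Lemma nbrs_attach T x j v y : v < nvert T -> y \in nbrs T v -> y \in nbrs (attach T x j) v.
Proof.
by move=> vT yv; rewrite /nbrs incident_attach // map_cat mem_cat yv.
Qed.

Lemma deg_attach T x j v : v < nvert T ->
  size (incident (attach T x j) v) = size (incident T v) + (if v == x then j else 0).
Proof.
move=> vT; rewrite incident_attach // size_cat; case: ifP => _ //.
by rewrite size_map size_iota.
Qed.

Lemma deg_gt0 T v : v < nvert T -> 0 < size (incident T v).
Proof.
move=> vT; rewrite lt0n size_eq0; apply/eqP => E.
have : (parent T v, v) \in incident T v.
  by rewrite incidentE; apply/mapP; exists v; rewrite ?mem_filter ?eqxx ?orbT ?mem_iota.
by rewrite E.
Qed.

(** The depth is the least number of parent steps leading to the root, made into a total function by
    [choice]. *)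
Lemma exists_depth T : is_rtree T -> exists dep : nat -> nat, dep 0 = 0 /\
  (forall v, v < nvert T -> v != 0 -> dep v = (dep (parent T v)).+1) /\
  (forall v, v < nvert T -> iter (dep v) (parent T) v = 0 /\
     forall i, i < dep v -> iter i (parent T) v != 0).
Proof.
move=> rT; have [_ reach] := rT.
have ex v : exists d, v < nvert T -> iter d (parent T) v = 0 /\
     forall i, i < d -> iter i (parent T) v != 0.
  have [vT|Tv] := ltnP v (nvert T); last by exists 0.
  have exj : exists j, iter j (parent T) v == 0 by have [j /eqP E] := reach v vT; exists j.
  case: (ex_minnP exj) => m /eqP Em minm; exists m => _; split => // i im.
  by apply: contraL im => /minm; rewrite -leqNgt.
have [dep depP] := choice ex; exists dep.
have uniq v m : v < nvert T -> iter m (parent T) v = 0 ->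
    (forall i, i < m -> iter i (parent T) v != 0) -> dep v = m.
  move=> vT Em minm; have [Ed mind] := depP v vT.
  apply/eqP; rewrite eqn_leq; apply/andP; split; rewrite leqNgt; apply/negP.
    by move=> /mind; rewrite Em eqxx.
  by move=> /minm; rewrite Ed eqxx.
split; first by apply: uniq.
split => // v vT v0; have [Ed mind] := depP _ (parent_lt rT vT).
apply: uniq => //; first by rewrite iterSr.
by case=> [_ //|i i_d]; rewrite iterSr; exact: mind.
Qed.

End Trees.

(** * Levels and their parity *)

Section Levels.
Variables (T : rtree) (dep : nat -> nat) (par : bool).
Hypotheses (rT : is_rtree T)
  (depS : forall v, (v < nvert T)%N -> v != 0%N -> dep v = (dep (parent T v)).+1).
Local Open Scope nat_scope.

(** [dep] is only meaningful on [T]; a vertex added later is placed one level below its parent,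
    which lies in [T] under [grows_old]. *)
Definition lvl (T' : rtree) (y : nat) : nat :=
  if y < nvert T then dep y else (dep (parent T' y)).+1.

Definition grows_old (T' : rtree) : Prop :=
  exists2 ext, T' = T ++ ext & forall u, u \in ext -> u < nvert T /\ odd (dep u) = par.

(* [par] is the parity of the level of the walker at even times, in particular at
   the growth times. *)
Definition on_class (n : nat) (T' : rtree) (x : nat) : Prop :=
  [/\ grows_old T', x < nvert T' & odd (lvl T' x + n) = par].

(** A new vertex sits just below a vertex whose level has parity [par], so it has the wrong parity
    at an even time. *)
Lemma on_class_even n T' x : on_class n T' x -> ~~ odd n -> x < nvert T /\ odd (dep x) = par.
Proof.
move=> [[ext -> extP] xT']; rewrite /lvl; have [xT|Tx] := ltnP x (nvert T) => lvlE n_even.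
  by split => //; rewrite -lvlE oddD (negbTE n_even) addbF.
have /extP[_ E] : parent (T ++ ext) x \in ext by apply: parent_new_in; rewrite Tx.
by move: lvlE; rewrite oddD /= E (negbTE n_even) addbF; case: (par).
Qed.

Lemma grows_old_step s n T' x j : ~~ odd s -> on_class n T' x ->
  grows_old (if s %| n then attach T' x j else T').
Proof.
move=> s_even xn; case: ifP => sn; last by case: xn.
have n_even : ~~ odd n.
  by apply: contraNN s_even => n_odd; have /dvdnP[q E] := sn; move: n_odd; rewrite E oddM => /andP[].
have [xT xpar] := on_class_even xn n_even.
have [[ext -> extP] _ _] := xn; exists (ext ++ nseq j x); first by rewrite /attach catA.
by move=> u; rewrite mem_cat mem_nseq => /orP[/extP //|/andP[_ /eqP ->]].
Qed.

Lemma lvl_attach T' x j y : y < nvert T' -> lvl (attach T' x j) y = lvl T' y.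
Proof. by move=> yT'; rewrite /lvl parent_cat. Qed.

Lemma new_leaf T' y z : grows_old T' -> nvert T <= y < nvert T' -> z < nvert T' -> parent T' z != y.
Proof.
move=> [ext -> extP] /andP[Ty yT'] zT'; apply/eqP => E.
have [zT|Tz] := ltnP z (nvert T).
  by move: Ty; rewrite leqNgt -E parent_cat // parent_lt.
have /extP[] : parent (T ++ ext) z \in ext by apply: parent_new_in; rewrite Tz.
by rewrite E ltnNge Ty.
Qed.

Lemma nbrs_new T' y z : grows_old T' -> nvert T <= y < nvert T' -> z \in nbrs T' y ->
  z = parent T' y /\ z < nvert T.
Proof.
move=> gT' yT' zy; suff -> : z = parent T' y.
  have [ext E extP] := gT'; split => //; rewrite E in yT' *.
  by have /extP[] := parent_new_in yT'.
by have [[zT' [E|[]]]|[]] := mem_nbrs zy => //; have := new_leaf gT' yT' zT'; rewrite E eqxx.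
Qed.

(** Every edge other than the self-loop of the root joins consecutive levels; this is where [x != 0]
    comes in. *)
Lemma on_class_step s n T' x j y : ~~ odd s -> on_class n T' x -> x != 0 ->
  let T'' := if s %| n then attach T' x j else T' in
  y \in nbrs T'' x -> on_class n.+1 T'' y.
Proof.
move=> s_even xn x0 T'' yx; have gT'' := grows_old_step j s_even xn.
have [gT' xT' xpar] := xn; rewrite -/T'' in gT''.
have xT'' : x < nvert T''.
  by rewrite /T''; case: ifP => // _; rewrite nvert_attach ltn_addr.
have lvlx : lvl T'' x = lvl T' x by rewrite /T''; case: ifP => // _; exact: lvl_attach.
have yT'' : y < nvert T''.
  have [[//]|[-> _]] := mem_nbrs yx; have [ext E extP] := gT''.
  have [xT|Tx] := ltnP x (nvert T).
    by rewrite E parent_cat // nvert_cat ltn_addr // parent_lt.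
  have /extP[] : parent T'' x \in ext by rewrite E; apply: parent_new_in; rewrite Tx -E.
  by rewrite E nvert_cat => pT _; rewrite ltn_addr.
split => //.
suff [E|E] : lvl T'' y = (lvl T'' x).+1 \/ lvl T'' x = (lvl T'' y).+1.
- by rewrite E lvlx addSnnS -addSnnS addSn /= addnS /= negbK.
- by move: xpar; rewrite -lvlx E addSn addnS.
have up z : z < nvert T'' -> z != 0 -> lvl T'' z = (lvl T'' (parent T'' z)).+1.
  move=> zT'' z0; have [ext E extP] := gT''; rewrite {1}/lvl.
  have [zT|Tz] := ltnP z (nvert T).
    by rewrite depS // E parent_cat // /lvl parent_lt.
  have /extP[pT _] : parent T'' z \in ext by rewrite E; apply: parent_new_in; rewrite Tz -E.
  by rewrite /lvl pT.
have [[_ [E|[E _]]]|[E _]] := mem_nbrs yx; [left|right|right]; last 2 first.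
- by rewrite E; exact: up.
- by rewrite E; exact: up.
rewrite -E; apply: up => //; apply: contraNneq x0 => y0.
by rewrite -E y0.
Qed.

End Levels.

(** * Recurrence *)

Section LegalPaths.
Context (R : realType) (d : measure_display) (OmegaE : measurableType d).
Variables (s : nat) (T0 : rtree) (x0 : nat).
Hypotheses (rT0 : is_rtree T0) (vx0 : is_vertex T0 x0) (s_even : ~~ odd s).
Variables (e x : nat -> nat).
Hypothesis x_start : x 0%N = x0.
Local Open Scope nat_scope.
Notation tr := (tree_at s T0 e x).

Lemma tree_atS n : tr n.+1 = if s %| n then attach (tr n) (x n) (e n) else tr n.
Proof. by rewrite {1}/tree_at. Qed.

Lemma tree_at_prefix n m : n <= m -> exists ext, tr m = tr n ++ ext.
Proof.
move=> nm; rewrite -(subnKC nm); elim: (m - n) => [|i [ext E]].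
  by exists [::]; rewrite addn0 cats0.
rewrite addnS tree_atS; case: ifP => _; last by exists ext.
by exists (ext ++ nseq (e (n + i)) (x (n + i))); rewrite E /attach catA.
Qed.

Lemma nvert_tree_at n m : n <= m -> nvert (tr n) <= nvert (tr m).
Proof. by move=> /tree_at_prefix[ext ->]; rewrite nvert_cat leq_addr. Qed.

Lemma legal_tree n : (forall i, i < n -> legal s T0 e x i) ->
  is_rtree (tr n) /\ x n < nvert (tr n).
Proof.
elim: n => [|n IH] leg; first by rewrite x_start.
have [rT xT] : is_rtree (tr n) /\ x n < nvert (tr n).
  by apply: IH => i i_n; apply: leg; exact: leqW.
have rT' : is_rtree (tr n.+1).
  by rewrite tree_atS; case: ifP => // _; exact: is_rtree_attach.
by split => //; apply: nbrs_lt rT' _; exact: leg.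
Qed.

Hypothesis legal_path : forall i, legal s T0 e x i.

Definition inf_often v := forall n, exists2 m, n <= m & x m = v.

Lemma not_inf_often v : ~ inf_often v -> exists N, forall m, N <= m -> x m != v.
Proof.
move=> /existsNP[N H]; exists N => m Nm; apply/eqP => xm; apply: H; by exists m.
Qed.

Lemma some_inf_often : exists v, inf_often v.
Proof.
apply: contrapT => none.
have [N0 xN0] : exists N, forall m, N <= m -> x m != 0.
  by apply: not_inf_often => H; apply: none; exists 0.
set T := tr N0; have [rT xT] := @legal_tree N0 (fun i _ => legal_path i).
have [dep [_ [depS _]]] := exists_depth rT.
pose par := odd (dep (x N0) + N0).
have inv n : on_class T dep par (N0 + n) (tr (N0 + n)) (x (N0 + n)).
  elim: n => [|n IH].
    rewrite addn0; split => //; last by rewrite /lvl xT.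
    by exists [::]; rewrite ?cats0.
  rewrite addnS tree_atS.
  apply: (on_class_step rT depS s_even IH); first by apply: xN0; rewrite leq_addr.
  by rewrite -tree_atS; exact: legal_path.
(* Since no vertex is visited infinitely often, the label of the current vertex tends to
   infinity. *)
have fin K : exists N, forall m, N <= m -> K <= x m.
  elim: K => [|K [N1 H1]]; first by exists 0.
  have [N2 H2] : exists N, forall m, N <= m -> x m != K.
    by apply: not_inf_often => H; apply: none; exists K.
  exists (maxn N1 N2) => m; rewrite geq_max => /andP[m1 m2].
  by rewrite ltn_neqAle eq_sym H2 //= H1.
have [N HN] := fin (nvert T).
(* From some time on all positions would be new vertices, but the neighbours of a new vertex are
   old. *)
have new i : nvert T <= x (N0 + N + i) by apply: HN; lia.
have inv1 := inv N; have [g1 x1 _] := inv1.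
have gS := grows_old_step (e (N0 + N)) s_even inv1.
rewrite -tree_atS in gS.
have n0 := new 0; rewrite addn0 in n0.
have xS : nvert T <= x (N0 + N) < nvert (tr (N0 + N).+1).
  by rewrite n0 /= (leq_trans x1) // nvert_tree_at.
have [_] := nbrs_new rT gS xS (legal_path (N0 + N)).
by apply/negP; rewrite -leqNgt; have := new 1; rewrite addn1.
Qed.

(** One visit after every time means infinitely many visits. The property climbs from some
    infinitely visited vertex to the root, then descends to any vertex. *)
Lemma all_inf_often :
  (forall n v w, v < nvert (tr n) -> w \in nbrs (tr n) v -> inf_often v ->
     exists2 m, n <= m & x m = w) ->
  forall n z, z < nvert (tr n) -> inf_often z.
Proof.
move=> nbr; have leg n := @legal_tree n (fun i _ => legal_path i).
have nbr' n v w : v < nvert (tr n) -> w \in nbrs (tr n) v -> inf_often v -> inf_often w.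
  move=> vT wv io m; have [] := nbr (n + m) v w; rewrite ?(leq_trans vT) ?nvert_tree_at ?leq_addr //.
    have [i E] : exists i, n + m = n + i by exists m.
    rewrite {}E; elim: i => [|i IH]; first by rewrite addn0.
    rewrite addnS tree_atS; case: ifP => // _; apply: nbrs_attach => //.
    by rewrite (leq_trans vT) // nvert_tree_at // leq_addr.
  by move=> j nj xj; exists j => //; apply: leq_trans nj; rewrite leq_addl.
have [v io] := some_inf_often; have [m _ xm] := io 0.
have [rT xT] := leg m; rewrite xm in xT.
have io0 : inf_often 0.
  have [_ reach] := rT; have [j E] := reach v xT; rewrite -E.
  elim: (j) => //= i IH; apply: (nbr' m _ _ _ _ IH); first exact: iter_parent_lt.
  by apply: parent_nbrs => //; exact: iter_parent_lt.
move=> n z zT; have [rTn _] := leg n; have [_ reach] := rTn.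
have [j E] := reach z zT; elim: j z zT E => [|j IH] z zT; first by move=> /= ->.
rewrite iterSr => E; apply: (nbr' n (parent (tr n) z)).
- exact: parent_lt.
- exact: child_nbrs.
- by apply: IH => //; exact: parent_lt.
Qed.

End LegalPaths.

Section AverageBounds.
Variable R : realType.
Implicit Types (T : rtree) (g : nat -> R).

Lemma sum_le_size (l : seq (nat * nat)) (h : nat * nat -> R) c :
  (forall a, a \in l -> h a <= c) -> \sum_(a <- l) h a <= (size l)%:R * c.
Proof.
elim: l => [|a l IH] H; first by rewrite big_nil mul0r.
rewrite big_cons /= -natr1 mulrDl mul1r addrC lerD //.
  by apply: IH => b bl; apply: H; rewrite in_cons bl orbT.
by apply: H; rewrite mem_head.
Qed.

Lemma nbr_avg_le T x g c : 0 <= c -> (forall y, y \in nbrs T x -> g y <= c) ->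
  nbr_avg T x g <= c.
Proof.
move=> c0 gc; rewrite /nbr_avg; set l := incident T x.
have [->|l0] := eqVneq (size l) 0%N; first by rewrite invr0 mulr0.
rewrite ler_pdivrMr ?ltr0n ?lt0n // mulrC; apply: sum_le_size => a al.
by apply: gc; exact: map_f.
Qed.

Lemma nbr_avg_le_avoid T x w g c : w \in nbrs T x -> g w = 0 -> 0 <= c ->
  (forall y, g y <= c) -> nbr_avg T x g <= (1 - (size (incident T x))%:R^-1) * c.
Proof.
move=> /mapP[a al ->] g0 c0 gc; rewrite /nbr_avg; set l := incident T x in al *.
have sl : (0 < size l)%N by case: (l) al.
have slR : (0 : R) < (size l)%:R by rewrite ltr0n.
rewrite (big_rem a) //= g0 add0r ler_pdivrMr // mulrAC mulrBl mul1r mulVf ?gt_eqF //.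
apply: (le_trans (sum_le_size (c := c) _)) => //.
by rewrite size_rem // -subn1 natrB.
Qed.

End AverageBounds.

(** * Potential for the avoidance of a neighbour *)

Section Potential.
Context (R : realType) (d : measure_display) (OmegaE : measurableType d).
Context (PE : probability OmegaE R) (X : {RV PE >-> nat}).
Variables (mu : R) (mu0 : 0 <= mu) (mean_mu : has_mean X (fun j => j%:R) mu).
Variables (N : nat) (N0 : (0 < N)%N).

(** [C] ensures [mu / D <= C / (D + mu)]: the chance [1 / D] of jumping to the neighbour pays for
    the average increase of [ln D]. *)
Let C : R := mu * (1 + mu) + 1.
Let phi (D : nat) : R := ln D%:R + C.
(** An upper bound for the probability of not choosing a given edge when the degree is at most
    [N]. *)
Let rho : R := 1 - N%:R^-1.

(* [r] is the number of visits still to be made to a vertex of degree [D]. *)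
Definition visit_potential (D r : nat) : R := phi D / phi N + rho ^+ r * (D <= N)%N%:R.
Notation K := visit_potential.

Let C1 : 1 <= C. Proof. by rewrite /C lerDr mulr_ge0 // addr_ge0. Qed.

Let phi_ge1 D : (0 < D)%N -> 1 <= phi D.
Proof.
move=> D0; rewrite /phi (le_trans C1) // lerDr ln_ge0 // ler1n //.
Qed.

Let phi_gt0 D : (0 < D)%N -> 0 < phi D.
Proof. by move=> D0; apply: lt_le_trans (phi_ge1 D0). Qed.

Let rho01 : 0 <= rho <= 1.
Proof. by rewrite /rho subr_ge0 invf_le1 ?ltr0n // ler1n N0 gerBl invr_ge0 ler0n. Qed.

Lemma visit_potential_ge0 D r : (0 < D)%N -> 0 <= K D r.
Proof.
move=> D0; rewrite /K addr_ge0 ?divr_ge0 ?mulr_ge0 ?exprn_ge0 //; last by case/andP: rho01.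
  exact: ltW (phi_gt0 D0).
exact: ltW (phi_gt0 N0).
Qed.

(** A degree above [N] makes the first term at least 1, a smaller degree the second one. So the
    potential dominates the indicator of having completed all the visits. *)
Lemma visit_potential0 D : (0 < D)%N -> 1 <= K D 0.
Proof.
move=> D0; rewrite /K expr0 mul1r; case: leqP => DN.
  by rewrite lerDr divr_ge0 // ltW // phi_gt0.
rewrite addr0 ler_pdivlMr ?phi_gt0 // mul1r /phi lerD2r ler_ln ?posrE ?ltr0n //.
by rewrite ler_nat ltnW.
Qed.

Let rho_step D D' r : (0 < D)%N -> (D <= D')%N ->
  (1 - D'%:R^-1) * (rho ^+ r.-1 * (D' <= N)%N%:R) <= rho ^+ r * (D <= N)%N%:R.
Proof.
move=> D0 DD'; have /andP[r0 r1] := rho01.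
have D'0 : (0 < D')%N by apply: leq_trans DD'.
case: (leqP D' N) => D'N; last by rewrite !mulr0 mulr_ge0 // exprn_ge0.
rewrite (leq_trans DD' D'N) !mulr1.
have q : 1 - D'%:R^-1 <= rho.
  by rewrite lerD2l lerN2 lef_pV2 ?posrE ?ltr0n // ler_nat.
case: r => [|r] /=; first by rewrite expr0 mulr1 (le_trans q).
by rewrite exprS ler_wpM2r // exprn_ge0.
Qed.

Lemma visit_potential_step D r : (0 < D)%N -> (1 - D%:R^-1) * K D r.-1 <= K D r.
Proof.
move=> D0; rewrite mulrDr lerD ?rho_step // ler_piMl //.
  by rewrite divr_ge0 // ltW // phi_gt0.
Qed.

(* Only a first moment is needed: [ln] is bounded by its tangent at [D], and
   [1 / (D + j)] from below by its tangent at [D + mu]. *)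
Lemma visit_potential_growth D r : (0 < D)%N ->
  (\int[PE]_v ((1 - (D + X v)%:R^-1) * K (D + X v) r.-1)%:E <= (K D r)%:E)%E.
Proof.
move=> D0; have DR : (0 : R) < D%:R by rewrite ltr0n.
have D1 : (1 : R) <= D%:R by rewrite ler1n.
set z := D%:R + mu; have z0 : 0 < z by rewrite /z ltr_pwDl.
(* [a * j + b] is the affine majorant obtained from the two tangents. *)
pose b := (ln D%:R + C - C / z - C * mu / z ^+ 2) / phi N + rho ^+ r * (D <= N)%N%:R.
pose a := (D%:R^-1 + C / z ^+ 2) / phi N.
have pN := phi_gt0 N0.
have C0 : 0 < C by apply: lt_le_trans C1.
apply: (@le_trans _ _ (a * mu + b)%:E).
  apply: (@le_mean _ _ _ _ X (fun j => (1 - (D + j)%:R^-1) * K (D + j) r.-1)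
    (fun j => a * j%:R + b)).
  - move=> j; rewrite mulr_ge0 ?visit_potential_ge0 ?ltn_addr //.
    by rewrite subr_ge0 invf_le1 ?ltr0n ?ltn_addr // ler1n ltn_addr.
  - move=> j; have E0 : (0 < D + j)%N by rewrite ltn_addr.
    rewrite mulrDr /b addrA lerD ?rho_step ?leq_addr //.
    have -> : a * j%:R + (ln D%:R + C - C / z - C * mu / z ^+ 2) / phi N =
      ((D%:R^-1 + C / z ^+ 2) * j%:R + (ln D%:R + C - C / z - C * mu / z ^+ 2)) / phi N.
      by rewrite /a; ring.
    rewrite mulrA ler_pM2r ?invr_gt0 //.
    set y : R := (D + j)%:R; have y0 : 0 < y by rewrite ltr0n.
    have yE : y = D%:R + j%:R by rewrite /y natrD.
    have ln0 : 0 <= ln y by rewrite ln_ge0 // ler1n.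
    have -> : phi (D + j) = ln y + C by [].
    clearbody y.
    have lny : ln y <= ln D%:R + j%:R / D%:R.
      have -> : y = D%:R * (1 + j%:R / D%:R) by rewrite yE; field; rewrite gt_eqF.
      have x0 : 0 <= j%:R / D%:R :> R by rewrite divr_ge0.
      have x1 : 0 < 1 + j%:R / D%:R :> R by lra.
      rewrite (lnM _ x1) ?posrE // lerD2l.
      by apply: le_ln1Dx; lra.
    have invy : z^-1 - (y - z) / z ^+ 2 <= y^-1.
      rewrite -subr_ge0.
      have -> : y^-1 - (z^-1 - (y - z) / z ^+ 2) = (y - z) ^+ 2 / (y * z ^+ 2).
        by field; rewrite !gt_eqF.
      by rewrite divr_ge0 ?sqr_ge0 // mulr_ge0 ?sqr_ge0 // ltW.
    have : 0 <= y^-1 * ln y by rewrite mulr_ge0 // invr_ge0 ltW.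
    have : C * (z^-1 - (y - z) / z ^+ 2) <= C * y^-1 by rewrite ler_pM2l.
    have -> : C * (z^-1 - (y - z) / z ^+ 2) =
       C / z - C / z ^+ 2 * j%:R + C * mu / z ^+ 2.
      have -> : y - z = j%:R - mu by rewrite yE /z; ring.
      by field; rewrite gt_eqF.
    lra.
  - by apply: has_meanD; [exact: has_meanZ|exact: has_mean_cst].
rewrite lee_fin /visit_potential /b addrA lerD2r.
have -> : a * mu + (ln D%:R + C - C / z - C * mu / z ^+ 2) / phi N =
  ((D%:R^-1 + C / z ^+ 2) * mu + (ln D%:R + C - C / z - C * mu / z ^+ 2)) / phi N.
  by rewrite /a; ring.
rewrite ler_pM2r ?invr_gt0 // {1}/phi.
(* After averaging, [ln] has gained [mu / D] and the avoidance has cost [C / z]; the value of [C]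
   decides. *)
have : mu / D%:R <= C / z.
  rewrite ler_pdivrMr // mulrAC ler_pdivlMr // /z /C.
  have : 0 <= mu * mu * (D%:R - 1) by rewrite !mulr_ge0 // subr_ge0.
  lra.
lra.
Qed.

Lemma visit_potential_small (D : nat) (eps : R) : 0 < eps ->
  phi D / phi N <= eps / 2 -> exists J, K D J <= eps.
Proof.
move=> eps0 phi_small.
have /andP[r0 r1] := rho01.
have r1' : rho < 1 by rewrite /rho gtrBl invr_gt0 ltr0n.
have := @cvg_expr R rho; rewrite ger0_norm // => /(_ r1').
move=> /cvgrPdist_lt /(_ (eps / 2)); rewrite divr_gt0 // => /(_ isT) [J _ /(_ J (leqnn J))].
rewrite /= sub0r normrN ger0_norm ?exprn_ge0 // => rJ.
exists J; rewrite /K [leRHS]splitr lerD //.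
by apply: le_trans (ltW rJ); rewrite ler_piMr ?exprn_ge0 //; case: (D <= N)%N.
Qed.

End Potential.

(** First [N] is taken so large that the degree term is at most [eps / 2], then [J] so large that
    the geometric term is. *)
Lemma visit_potential_vanish (R : realType) (mu : R) D (eps : R) :
  0 <= mu -> (0 < D)%N -> 0 < eps ->
  exists N J, (0 < N)%N /\ visit_potential mu N D J <= eps.
Proof.
move=> mu0 D0 eps0; set A := (ln D%:R + (mu * (1 + mu) + 1)) / (eps / 2) : R.
have C0 : 0 < mu * (1 + mu) + 1 by rewrite ltr_wpDl // mulr_ge0 // addr_ge0.
have [N An] : exists N : nat, expR A <= N%:R.
  exists (Num.bound (expR A)); apply/ltW/archi_boundP; exact: expR_ge0.
have NR : (0 : R) < N%:R by apply: lt_le_trans An; exact: expR_gt0.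
have N0 : (0 < N)%N by rewrite -(ltr0n R).
have A0 : 0 <= A.
  by rewrite /A divr_ge0 ?divr_ge0 ?(ltW eps0) // addr_ge0 ?(ltW C0) // ln_ge0 // ler1n.
have lnN : A <= ln N%:R by rewrite -ler_expR lnK ?posrE.
have [|J HJ] := @visit_potential_small R mu N N0 D eps eps0; last by exists N, J.
rewrite ler_pdivrMr; last by apply: ltr_wpDl => //; apply: le_trans lnN.
rewrite -ler_pdivrMl ?divr_gt0 // mulrC -/A; apply: (le_trans lnN).
by rewrite lerDl ltW.
Qed.

(** * Infinitely many visits spread to neighbours *)

Section Neighbour.
Context (R : realType) (d : measure_display) (OmegaE : measurableType d).
Context (PE : probability OmegaE R) (xi : nat -> {RV PE >-> nat}).
Hypothesis xi_iid : iid xi.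
Variables (mu : R) (mu0 : 0 <= mu) (mean_mu : has_mean (xi 1%N) (fun j => j%:R) mu).
Variables (s : nat) (T0 : rtree) (x0 : nat).
Hypotheses (rT0 : is_rtree T0) (vx0 : is_vertex T0 x0).
Context (W : TBRW xi s T0 x0).
Variables (n0 : nat) (T : rtree) (v w : nat).
Hypotheses (vT : (v < nvert T)%N) (wv : w \in nbrs T v).

Notation tr e x n := (tree_at s T0 e x n).

Definition avoids i (e x : nat -> nat) : bool :=
  (tr e x n0 == T) && all (fun j => x (n0 + j)%N != w) (iota 0 i.+1).

(** The current time is left out: a visit counts once the step that follows it has been made. *)
Definition visits i (x : nat -> nat) : nat := (\sum_(j < i) (x (n0 + j) == v))%N.

Let deg i e x := size (incident (tr e x (n0 + i)) v).

Lemma adapted_avoids i : adapted (n0 + i) (n0 + i).+1 (avoids i).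
Proof.
move=> e e' x x' He Hx; rewrite /avoids (@adapted_tree s T0 n0 e e' x x').
- congr (_ && _); apply: eq_in_all => j; rewrite mem_iota => /andP[_ ji].
  by rewrite Hx // ltnS leq_add2l -ltnS.
- by move=> j jn; apply: He; rewrite ltn_addr.
- by move=> j jn; apply: Hx; rewrite ltnW // ltnS ltn_addr.
Qed.

Lemma adapted_visits i : adapted (n0 + i) (n0 + i) (fun _ x => visits i x).
Proof.
by move=> e e' x x' He Hx; apply: eq_bigr => j _; rewrite Hx // ltn_add2l.
Qed.

Let adapted_deg i : adapted (n0 + i) (n0 + i) (deg i).
Proof. by move=> e e' x x' He Hx; rewrite /deg (@adapted_tree s T0 _ e e' x x'). Qed.

Variables (N J : nat) (N0 : (0 < N)%N).
Notation K := (visit_potential mu N).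

Let V i (e x : nat -> nat) : R := (avoids i e x)%:R * K (deg i e x) (J - visits i x).

Let adapted_V i : adapted (n0 + i) (n0 + i).+1 (V i).
Proof.
move=> e e' x x' He Hx; rewrite /V (@adapted_avoids i e e' x x') // (@adapted_deg i e e' x x') //.
  by rewrite (@adapted_visits i e e' x x') // => j ji; apply: Hx; exact: ltnW.
by move=> j ji; apply: Hx; exact: ltnW.
Qed.

Let v_in i e x : avoids i e x -> (v < nvert (tr e x (n0 + i)))%N.
Proof.
move=> /andP[/eqP E _]; have vT' := vT; rewrite -E in vT'.
by apply: leq_trans vT' _; apply: nvert_tree_at; rewrite leq_addr.
Qed.

Let deg_pos i e x : avoids i e x -> (0 < deg i e x)%N.
Proof. by move=> /v_in vi; exact: deg_gt0. Qed.

Let V_ge0 i e x : 0 <= V i e x.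
Proof.
rewrite /V; case A : (avoids i e x); last by rewrite mul0r.
by rewrite mul1r; apply: visit_potential_ge0 => //; exact: deg_pos A.
Qed.

Let avoidsS i e x : avoids i.+1 e x = avoids i e x && (x (n0 + i.+1)%N != w).
Proof. by rewrite /avoids -[i.+2]addn1 iotaD all_cat /= andbT add0n andbA. Qed.

Let visitsS i x : visits i.+1 x = (visits i x + (x (n0 + i)%N == v))%N.
Proof. by rewrite /visits big_ord_recr. Qed.

Let w_nbr i e x : avoids i e x -> w \in nbrs (tr e x (n0 + i)) v.
Proof.
move=> A; have /andP[/eqP E _] := A; elim: i {A} => [|i IH]; first by rewrite addn0 E.
rewrite addnS tree_atS; case: ifP => // _; apply: nbrs_attach => //.
by have vT' := vT; rewrite -E in vT'; apply: leq_trans vT' _; apply: nvert_tree_at; rewrite leq_addr.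
Qed.

(** [V] is a supermartingale: it vanishes once [w] is hit, the degree of [v] does not change while
    the walker is elsewhere, and a visit to [v] is handled by the one-step estimates of the
    potential. *)
Lemma avoid_step i :
  (\int[law W]_w (V i.+1 (env W ^~ w) (walk W ^~ w))%:E <=
   \int[law W]_w (V i (env W ^~ w) (walk W ^~ w))%:E)%E.
Proof.
have := @le_integral_step _ _ _ _ _ xi_iid s T0 x0 W (n0 + i) (V i.+1) (V i) (fun _ _ => 0).
rewrite integral0_eq // add0e; apply => //; first by rewrite -addnS; exact: adapted_V.
move=> e x x_start leg; rewrite add0e.
pose n := (n0 + i)%N.
have updE j y : avoids i (upd e n j) (upd x n.+1 y) = avoids i e x.
  apply: adapted_avoids => m mn; rewrite upd_neq // ltn_eqF //.
have updV y : visits i (upd x n.+1 y) = visits i x.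
  by apply: (@adapted_visits i e e) => // m mn; rewrite upd_neq // ltn_eqF // ltnW // ltnS.
case A : (avoids i e x); last first.
  rewrite /step_mean integral0_eq ?lee_fin // => u _; congr _%:E.
  rewrite /step_avg /nbr_avg big1 ?mul0r // => a _.
  by rewrite /V avoidsS updE A mul0r.
have vn := v_in A; have dp := deg_pos A.
have degS j y : deg i.+1 (upd e n j) (upd x n.+1 y) =
    (deg i e x + (if (v == x n) && (s %| n)%N then j else 0))%N.
  rewrite /deg addnS -/n (@adapted_tree s T0 n.+1 _ (upd e n j) _ x) //; last first.
    by move=> m mn; rewrite upd_neq // ltn_eqF.
  rewrite tree_at_upd; case: ifP => sn; last by rewrite andbF addn0.
  by rewrite deg_attach // andbT.
have trE j : tr (upd e n j) x n.+1 =
    if (s %| n)%N then attach (tr e x n) (x n) j else tr e x n by exact: tree_at_upd.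
have VS j y : V i.+1 (upd e n j) (upd x n.+1 y) = (y != w)%:R *
    K (deg i e x + (if (v == x n) && (s %| n)%N then j else 0))%N
      (J - (visits i x + (x n == v))).
  rewrite /V degS /= visitsS updV avoidsS updE A /= -/n addnS upd_eq upd_neq // ltn_eqF //.
rewrite /V A mul1r /=.
have Kpos D r : (0 < D)%N -> 0 <= K D r by exact: visit_potential_ge0.
have [xv|xv] := eqVneq (x n) v; last first.
  apply: (@le_trans _ _ (\int[PE]_u (K (deg i e x) (J - visits i x))%:E)%E); last first.
    by rewrite integral_cst // -[leRHS]mule1 lee_wpmul2l ?lee_fin ?Kpos // probability_le1.
  apply: ge0_le_integral => //.
  - by move=> u _; rewrite lee_fin nbr_avg_ge0 // => y; exact: V_ge0.
  - exact: (measurable_comp_RV (xi 1%N) (fun j => (step_avg s T0 n (V i.+1) e x j)%:E)).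
  - move=> u _; rewrite lee_fin /step_avg; apply: nbr_avg_le; first exact: Kpos.
    move=> y _; rewrite [leLHS]VS [v == _]eq_sym (negbTE xv) /= !addn0.
    by rewrite ler_piMl ?Kpos //; case: (_ != _).
(* From here on the walker is at [v]: one of its edges leads to [w], where [V] vanishes, whence the
   factor [1 - 1 / D]. *)
have rE : (J - (visits i x + 1) = (J - visits i x).-1)%N by lia.
have bound j : step_avg s T0 n (V i.+1) e x j <=
    (1 - (deg i e x + (if (s %| n)%N then j else 0))%:R^-1) *
    K (deg i e x + (if (s %| n)%N then j else 0)) (J - visits i x).-1.
  set D := (deg i e x + _)%N.
  have D0 : (0 < D)%N by rewrite ltn_addr.
  have DE : size (incident (tr (upd e n j) x n.+1) (x n)) = D.
    rewrite trE /D /deg -/n xv; case: ifP => _; last by rewrite addn0.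
    by rewrite deg_attach // eqxx.
  rewrite /step_avg -{1}DE; apply: (@nbr_avg_le_avoid _ _ _ w).
  - by rewrite trE xv; case: ifP => _; [apply: nbrs_attach => //|]; exact: w_nbr.
  - by rewrite [LHS]VS eqxx mul0r.
  - exact: Kpos.
  - move=> y; rewrite [leLHS]VS xv eqxx /= -rE -/D.
    by rewrite ler_piMl ?Kpos //; case: (_ != _).
apply: (@le_trans _ _ (\int[PE]_u ((1 - (deg i e x + (if (s %| n)%N then xi 1%N u else 0))%:R^-1) *
    K (deg i e x + (if (s %| n)%N then xi 1%N u else 0)) (J - visits i x).-1)%:E)%E).
  apply: ge0_le_integral => //.
  - by move=> u _; rewrite lee_fin nbr_avg_ge0 // => y; exact: V_ge0.
  - exact: (measurable_comp_RV (xi 1%N) (fun j => (step_avg s T0 n (V i.+1) e x j)%:E)).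
  - exact: (measurable_comp_RV (xi 1%N) (fun j =>
      ((1 - (deg i e x + (if (s %| n)%N then j else 0))%:R^-1) *
       K (deg i e x + (if (s %| n)%N then j else 0)) (J - visits i x).-1)%:E)).
  - by move=> u _; rewrite lee_fin; exact: bound.
case: (s %| n)%N; first by apply: (@visit_potential_growth _ _ _ _ (xi 1%N) mu mu0 mean_mu N N0).
rewrite addn0 integral_cst // -[leRHS]mule1.
apply: lee_pmul => //.
- rewrite lee_fin mulr_ge0 ?Kpos // subr_ge0 invf_le1 ?ltr0n // ler1n //.
- by rewrite lee_fin; exact: visit_potential_step.
- exact: probability_le1.
Qed.

(** Markov's inequality: [V] is at least 1 on this event, and its mean never exceeds its initial
    bound at time [n0]. *)
Lemma law_avoid i :
  (law W [set w' | avoids i (env W ^~ w') (walk W ^~ w') /\ (J <= visits i (walk W ^~ w'))%N] <=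
   (K (size (incident T v)) J)%:E)%E.
Proof.
pose B (e x : nat -> nat) := avoids i e x /\ (J <= visits i x)%N.
have aB : adapted (n0 + i) (n0 + i).+1 B.
  move=> e e' x x' He Hx; rewrite /B (@adapted_avoids i e e' x x') //.
  by rewrite (@adapted_visits i e e' x x') // => j ji; apply: Hx; exact: ltnW.
have dT : (0 < size (incident T v))%N by exact: deg_gt0.
rewrite [leLHS](law_adapted W aB).
apply: (@le_trans _ _ (\int[law W]_w' (V i (env W ^~ w') (walk W ^~ w'))%:E)%E).
  apply: ge0_le_integral => //.
  - apply: (measurable_adapted (W := W) (n := (n0 + i)%N) (m := (n0 + i).+1)
      (F := fun e x => (`[< B e x >]%:R)%:E)) => e e' x x' He Hx.
    by rewrite (aB e e' x x').
  - apply: (measurable_adapted (W := W) (n := (n0 + i)%N) (m := (n0 + i).+1)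
      (F := fun e x => (V i e x)%:E)) => e e' x x' He Hx.
    by rewrite (adapted_V He Hx).
  - move=> w' _; rewrite lee_fin; case: asboolP => [[A Jv]|_]; last exact: V_ge0.
    have J0 : (J - visits i (walk W ^~ w') = 0)%N by apply/eqP; rewrite subn_eq0.
    by rewrite /V A mul1r J0; apply: visit_potential0 => //; exact: deg_pos A.
elim: (i) => [|i' IH]; last exact: le_trans (avoid_step i') IH.
apply: (@le_trans _ _ (\int[law W]_w' (K (size (incident T v)) J)%:E)%E); last first.
  rewrite integral_cst // -[leRHS]mule1 lee_wpmul2l ?lee_fin ?visit_potential_ge0 //.
  exact: probability_le1.
apply: ge0_le_integral => //.
- by move=> w' _; rewrite lee_fin V_ge0.
- apply: (measurable_adapted (W := W) (n := (n0 + 0)%N) (m := (n0 + 0).+1)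
      (F := fun e x => (V 0 e x)%:E)) => e e' x x' He Hx.
  by rewrite (adapted_V He Hx).
- move=> w' _; rewrite lee_fin /V; case A : (avoids 0 _ _); last first.
    by rewrite mul0r; exact: visit_potential_ge0.
  rewrite mul1r /deg addn0; have /andP[/eqP -> _] := A.
  by rewrite /visits big_ord0 subn0.
Qed.

End Neighbour.

Section Recurrence.
Context (R : realType) (d : measure_display) (OmegaE : measurableType d).
Context (PE : probability OmegaE R) (xi : nat -> {RV PE >-> nat}).
Hypothesis xi_iid : iid xi.
Variables (mu : R) (mu0 : 0 <= mu) (mean_mu : has_mean (xi 1%N) (fun j => j%:R) mu).
Variables (s : nat) (s_even : ~~ odd s) (T0 : rtree) (x0 : nat).
Hypotheses (rT0 : is_rtree T0) (vx0 : is_vertex T0 x0).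
Context (W : TBRW xi s T0 x0).

Lemma visits_unbounded n0 v (x : nat -> nat) J : inf_often x v ->
  exists i, (J <= visits n0 v i x)%N.
Proof.
move=> io; elim: J => [|J [i Ji]]; first by exists 0%N.
have [m nm xm] := io (n0 + i)%N; exists (m - n0).+1.
rewrite /visits big_ord_recr /= subnKC ?(leq_trans _ nm) ?leq_addr //.
rewrite xm eqxx addn1 ltnS; apply: leq_trans Ji _.
have im : (i <= m - n0)%N by lia.
by rewrite /visits -(subnKC im) big_split_ord /= leq_addr.
Qed.

(** The bound of [law_avoid] does not depend on [i], so it survives the limit in [i]; then [N] and
    [J] make it arbitrarily small. *)
Lemma neighbour_negligible n0 T v w : (v < nvert T)%N -> w \in nbrs T v ->
  (law W).-negligible [set w' | [/\ tree n0 w' = T,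
     forall j, walk W (n0 + j)%N w' != w & inf_often (walk W ^~ w') v]].
Proof.
move=> vT wv.
pose A i w' := avoids s T0 n0 T w i (env W ^~ w') (walk W ^~ w').
pose H J i := (\bigcap_i' [set w' | A i' w']) `&` [set w' | (J <= visits n0 v i (walk W ^~ w'))%N].
have mA i : measurable [set w' | A i w'].
  apply: (measurable_adapted_set W (n := n0 + i) (m := (n0 + i).+1)
    (A := fun e x => avoids s T0 n0 T w i e x)) => e e' x x' He Hx.
  by rewrite (@adapted_avoids s T0 n0 T w i e e' x x').
have mH J i : measurable (H J i).
  apply: measurableI; first exact: bigcapT_measurable.
  apply: (measurable_adapted_set W (n := n0 + i) (m := n0 + i)
    (A := fun e x => (J <= visits n0 v i x)%N)) => e e' x x' He Hx.
  by rewrite (@adapted_visits n0 v i e e' x x').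
have mU J : measurable (\bigcup_i H J i) by exact: bigcupT_measurable.
exists (\bigcap_J \bigcup_i H J i); split.
- exact: bigcapT_measurable.
- apply/eqP; rewrite eq_le measure_ge0 andbT; apply/lee_addgt0Pr => eps eps0.
  rewrite add0e.
  have [N [J [N0 KJ]]] := visit_potential_vanish mu0 (deg_gt0 vT) eps0.
  apply: (@le_trans _ _ (law W (\bigcup_i H J i))).
    apply: le_measure; [rewrite inE; exact: bigcapT_measurable|rewrite inE; exact: mU|].
    by move=> w' HJ; exact: (HJ J).
  have cv : law W (H J i) @[i --> \oo] --> law W (\bigcup_i H J i).
    apply: nondecreasing_cvg_mu => // i i' ii'; apply/subsetPset => w' [HA Hv]; split => //=.
    apply: leq_trans Hv _.
    by rewrite /visits -(subnKC ii') big_split_ord /= leq_addr.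
  rewrite -(cvg_lim _ cv) //; apply: lime_le; first by apply/cvg_ex; exists (law W (\bigcup_i H J i)).
  apply: nearW => i; apply: (@le_trans _ _ (visit_potential mu N (size (incident T v)) J)%:E); last first.
    by rewrite lee_fin.
  apply: le_trans _ (law_avoid xi_iid mu0 mean_mu W n0 vT wv J N0 i).
  apply: le_measure; rewrite ?inE //.
    apply: (measurable_adapted_set W (n := n0 + i) (m := (n0 + i).+1)
      (A := fun e x => avoids s T0 n0 T w i e x /\ (J <= visits n0 v i x)%N)) => e e' x x' He Hx.
    rewrite (@adapted_avoids s T0 n0 T w i e e' x x') // (@adapted_visits n0 v i e e' x x') //.
    by move=> j ji; apply: Hx; exact: ltnW.
  by move=> w' [HA Hv]; split => //; exact: (HA i).
- move=> w' [Tw' aw io] J _; have [i Ji] := visits_unbounded n0 J io.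
  exists i => //; split => // i' _; rewrite /mkset /A /avoids [_ == T](introT eqP Tw') andTb.
  by apply/allP => j _; exact: aw.
Qed.

(** The exceptional events are indexed by a time, a tree and two vertices, a countable type, so
    their union is null; outside it, [all_inf_often] applies to legal paths. *)
Lemma ae_all_inf_often : {ae law W, forall w', forall n z,
  (z < nvert (tree n w'))%N -> inf_often (walk W ^~ w') z}.
Proof.
pose bad (c : nat * seq nat * nat * nat) := [set w' | [/\ tree c.1.1.1 w' = c.1.1.2,
     forall j, walk W (c.1.1.1 + j)%N w' != c.2 & inf_often (walk W ^~ w') c.1.2]].
pose ok (c : nat * seq nat * nat * nat) := (c.1.2 < nvert c.1.1.2)%N && (c.2 \in nbrs c.1.1.2 c.1.2).
have ae_nbr : {ae law W, forall w', forall i : nat,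
    forall c, choice.unpickle i = Some c -> ok c -> ~ bad c w'}.
  apply: ae_foralln => i; case: (choice.unpickle i) => [c|]; last by apply: nearW => w' c.
  have [/andP[vT wv]|nok] := boolP (ok c); last first.
    by apply: nearW => w' _ [<-]; rewrite (negbTE nok).
  have := neighbour_negligible c.1.1.1 vT wv; apply: negligibleS => w' /= nall.
  by apply: contrapT => nbad; apply: nall => _ [<-] _.
apply: filterS2 (ae_legal xi_iid W) ae_nbr => w' leg nbr n z zT.
have x_start : walk W 0%N w' = x0 by exact: walk0.
apply: (all_inf_often rT0 vx0 s_even x_start leg _ zT) => m v w vT wv io.
have := nbr (choice.pickle (m, tree m w', v, w)) _ (choice.pickleK _).
rewrite /ok /= vT wv => /(_ isT) nbad.
apply: contrapT => nex; apply: nbad; split => // j; apply/eqP => E; apply: nex.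
by exists (m + j)%N; rewrite ?leq_addr.
Qed.

Lemma measurable_state_event n T x : measurable (@state_event _ _ _ _ _ _ _ _ W n T x).
Proof.
apply: (measurable_adapted_set W (n := n) (m := n.+1)
   (A := fun e y => tree_at s T0 e y n = T /\ y n = x)) => e e' y y' He Hy.
rewrite (@adapted_tree s T0 n e e' y y') // ?Hy // => i i_n.
by apply: Hy; exact: leqW.
Qed.

Lemma recurrent_TBRW : recurrent W.
Proof.
move=> n T x att z zT; rewrite /cond_prob.
set B : set (Defs.space W) := state_event n T x in att *.
set A := lim_sup_set _.
have mB : measurable B by exact: measurable_state_event.
have mA : measurable A.
  rewrite /A /lim_sup_set; apply: bigcapT_measurable => i; apply: bigcup_measurable => j _.
  exact: (measurable_walk_eq W j z).
have AB : law W (A `&` B) = law W B.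
  have D0 : law W (B `\` A) = 0%E.
    apply: measure_negligible; first exact: measurableD.
    have := ae_all_inf_often; apply: negligibleS => w' [[Tw' xw'] nA] /= H; apply: nA => i _.
    have zt : (z < nvert (tree n w'))%N by rewrite Tw'.
    by have [j ij xj] := H n z zt i; exists j.
  rewrite setIC; apply/esym; apply: (etrans (measureDI (law W) mB mA)).
  rewrite -[RHS]add0e; congr (_ + _)%E; exact: D0.
rewrite AB mulfV // gt_eqF // fine_gt0 // att /=.
exact: le_lt_trans (probability_le1 _ _) (ltry _).
Qed.

End Recurrence.

(** * Infinite expected hitting time of the root *)

Section Attained.
Context (R : realType) (d : measure_display) (OmegaE : measurableType d).
Context (PE : probability OmegaE R) (xi : nat -> {RV PE >-> nat}).
Hypothesis xi_iid : iid xi.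
Variables (c : nat) (c_gt0 : (0 < c)%N) (p : R) (p_gt0 : 0 < p).
Hypothesis mean_c : has_mean (xi 1%N) (fun j => (j == c)%:R) p.
Variables (s : nat) (T0 : rtree) (x0 : nat) (W : TBRW xi s T0 x0).

Definition state_ind n (T : rtree) (z : nat) (e x : nat -> nat) : bool :=
  (tree_at s T0 e x n == T) && (x n == z).

Lemma adapted_state_ind n T z : adapted n n.+1 (state_ind n T z).
Proof.
move=> e e' x x' He Hx; rewrite /state_ind (@adapted_tree s T0 n e e' x x') // ?Hx //.
by move=> i i_n; apply: Hx; exact: leqW.
Qed.

Lemma law_state_event n T z : law W (state_event n T z) =
  (\int[law W]_w ((state_ind n T z (env W ^~ w) (walk W ^~ w))%:R : R)%:E)%E.
Proof.
have aA : adapted n n.+1 (fun e x => tree_at s T0 e x n = T /\ x n = z).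
  move=> e e' x x' He Hx; rewrite (@adapted_tree s T0 n e e' x x') // ?Hx //.
  by move=> i i_n; apply: Hx; exact: leqW.
rewrite [LHS](law_adapted W aA); apply: eq_integral => w _.
rewrite (_ : `[< _ >] = state_ind n T z (env W ^~ w) (walk W ^~ w)) //.
by apply/asboolP/andP; [move=> [-> ->]|move=> [/eqP -> /eqP ->]].
Qed.

(** [c] leaves appear with probability [p], and an edge to [y] is then chosen with probability at
    least [1 / D]. The factor [p] is charged at every time, to treat both cases at once. *)
Lemma attained_step n T z y : attained W n T z ->
  let T' := if (s %| n)%N then attach T z c else T in
  y \in nbrs T' z -> attained W n.+1 T' y.
Proof.
move=> att T' yz; rewrite /attained law_state_event.
set D : R := (size (incident T' z))%:R.
have D0 : 0 < D.
  by rewrite ltr0n lt0n size_eq0; apply: contraTneq yz => E; rewrite /nbrs E.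
pose F e x : R := (state_ind n.+1 T' y e x)%:R.
pose H e x : R := p / D * (state_ind n T z e x)%:R.
have H0 e x : 0 <= H e x by rewrite mulr_ge0 // divr_ge0 // ltW.
have aF : adapted n.+1 n.+2 F.
  by move=> e e' x x' He Hx; rewrite /F (@adapted_state_ind n.+1 T' y e e' x x').
have aH : adapted n n.+1 H.
  by move=> e e' x x' He Hx; rewrite /H (@adapted_state_ind n T z e e' x x').
have := @ge_integral_step _ _ _ _ _ xi_iid s T0 x0 W n F H (fun _ _ => 0) aF aH.
rewrite [X in (X + _)%E]integral0_eq // add0e => ge.
apply: (@lt_le_trans _ _ (\int[law W]_w (H (env W ^~ w) (walk W ^~ w))%:E)%E).
  under eq_integral do rewrite EFinM.
  rewrite ge0_integralZl //; last 2 first.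
  - apply: (measurable_adapted (W := W) (n := n) (m := n.+1)
      (F := fun e x => ((state_ind n T z e x)%:R)%:E)) => e e' x x' He Hx.
    by rewrite (@adapted_state_ind n T z e e' x x').
  - by rewrite lee_fin divr_ge0 // ltW.
  by rewrite mule_gt0 // ?lte_fin ?divr_gt0 // -law_state_event.
apply: ge => // e x x_start leg; rewrite add0e /H.
case A : (state_ind n T z e x); last by rewrite mulr0; apply: step_mean_ge0.
have /andP[/eqP ET /eqP Ez] := A; rewrite mulr1.
apply: (@ge_mean _ _ _ _ (xi 1%N) (step_avg s T0 n F e x) (fun j => D^-1 * (j == c)%:R)).
- by move=> j; apply: nbr_avg_ge0.
- move=> j; case: eqP => [->|_]; last by rewrite mulr0; apply: nbr_avg_ge0.
  rewrite mulr1 /step_avg tree_at_upd ET Ez -/T' /nbr_avg -/D.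
  rewrite -[leLHS]mul1r ler_wpM2r ?invr_ge0 ?(ltW D0) //.
  have [a al ya] := mapP yz; rewrite (big_rem a) //= -[leLHS]addr0 lerD ?sumr_ge0 //.
  rewrite /F /state_ind upd_eq -ya eqxx andbT.
  rewrite (@adapted_tree s T0 n.+1 _ (upd e n c) _ x) //; last first.
    by move=> i i_n; rewrite upd_neq // ltn_eqF.
  by rewrite tree_at_upd ET Ez -/T' eqxx.
- by rewrite mulrC; apply: has_meanZ.
Qed.

Definition reachable n T z := [/\ attained W n T z, is_rtree T & (z < nvert T)%N].

Lemma reachable_step n T z y : reachable n T z ->
  let T' := if (s %| n)%N then attach T z c else T in
  y \in nbrs T' z -> reachable n.+1 T' y.
Proof.
move=> [att rT zT] T' yz.
have rT' : is_rtree T' by rewrite /T'; case: ifP => // _; exact: is_rtree_attach.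
by split => //; [exact: attained_step|exact: nbrs_lt yz].
Qed.

(** A growth met on the way only adds leaves to the vertex being left; [ext] records them. *)
Lemma reachable_move n T z y : reachable n T z -> y \in nbrs T z ->
  exists2 ext, reachable n.+1 (T ++ ext) y & forall u, u \in ext -> u = z.
Proof.
move=> rz yz; have [_ _ zT] := rz.
have := @reachable_step n T z y rz; case: ifP => sn H.
  exists (nseq c z); first by apply: H; exact: nbrs_attach.
  by move=> u; rewrite mem_nseq => /andP[_ /eqP].
by exists [::]; rewrite ?cats0 //; exact: H.
Qed.

Lemma iter_parent_cat T ext u i : is_rtree T -> (u < nvert T)%N ->
  iter i (parent (T ++ ext)) u = iter i (parent T) u.
Proof.
move=> rT uT; elim: i => //= i ->; apply: parent_cat; exact: iter_parent_lt.
Qed.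

Lemma reachable_up n T z h : reachable n T z ->
  exists2 ext, reachable (n + h)%N (T ++ ext) (iter h (parent T) z) &
    forall u, u \in ext -> exists i, u = iter i (parent T) z.
Proof.
move=> rz; have [_ rT zT] := rz; elim: h => [|h [ext re extP]].
  by exists [::]; rewrite ?cats0 ?addn0.
have hT : (iter h (parent T) z < nvert T)%N by exact: iter_parent_lt.
have [_ rTe _] := re.
have [|ext' re' ext'P] := @reachable_move _ _ _ (parent T (iter h (parent T) z)) re.
  rewrite -(parent_cat ext hT); apply: parent_nbrs => //.
  by rewrite nvert_cat ltn_addr.
exists (ext ++ ext'); first by rewrite addnS catA.
by move=> u; rewrite mem_cat => /orP[/extP //|/ext'P ->]; exists h.
Qed.

(** Growth on the way occurs before arrival, hence at ancestors reached after at least one step: a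
    [u] other than the root gets no child. [h] may exceed the depth of [u], the surplus being spent
    on the self-loop. *)
Lemma reachable_down n T u h : reachable n T 0%N -> (u < nvert T)%N ->
  iter h (parent T) u = 0%N ->
  exists2 ext, reachable (n + h)%N (T ++ ext) u &
    forall y, y \in ext -> exists i, y = iter i.+1 (parent T) u.
Proof.
move=> r0; have [_ rT zT] := r0; elim: h u => [|h IH] u uT.
  by move=> /= ->; exists [::]; rewrite ?cats0 ?addn0.
rewrite iterSr => Eu; have [ext re extP] := IH _ (parent_lt rT uT) Eu.
have [|ext' re' ext'P] := @reachable_move _ _ _ u re.
  by rewrite -(parent_cat ext uT); apply: child_nbrs; rewrite nvert_cat ltn_addr.
exists (ext ++ ext'); first by rewrite addnS catA.
move=> y; rewrite mem_cat => /orP[/extP[i ->]|/ext'P ->]; last by exists 0%N.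
by exists i.+1; rewrite -iterSr.
Qed.

(** [T] lists the parents, so [z \notin T] says that [z] has no child; the last clause says that its
    depth is at least [m]. *)
Definition deep_leaf m T z := [/\ z != 0%N, z \notin T &
  forall i, (i < m)%N -> iter i (parent T) z != 0%N].

(** Leaves are grown at [z], and one of them, [y], is reached by way of the root: there the
    self-loop allows the arrival to be adjusted to a growth time. *)
Lemma deepen n T z m : (0 < s)%N -> reachable n T z -> (s %| n)%N ->
  (forall i, (i < m)%N -> iter i (parent T) z != 0%N) ->
  exists n' T' z', [/\ reachable n' T' z', (s %| n')%N & deep_leaf m.+1 T' z'].
Proof.
move=> s0 rz sn zm; have [_ rT zT] := rz.
set T1 := attach T z c; set y := nvert T.
have rT1 : is_rtree T1 by exact: is_rtree_attach.
have zT1 : (z < nvert T1)%N by rewrite nvert_attach ltn_addr.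
have yT1 : (y < nvert T1)%N by rewrite nvert_attach -[ltnLHS]addn0 ltn_add2l.
have r1 : reachable n.+1 T1 (parent T1 z).
  have := @reachable_step n T z (parent T1 z) rz; rewrite sn; apply.
  exact: parent_nbrs.
have pz : (parent T1 z < nvert T)%N by rewrite parent_cat //; exact: parent_lt.
have parent_y : parent T1 y = z.
  by rewrite -[y]addn0 parent_cat_new ?size_nseq // nth_nseq c_gt0.
have [j Ej] : exists j, iter j (parent T1) (parent T1 z) = 0%N.
  by apply: (proj2 rT1); exact: parent_lt.
have [ext re extP] := reachable_up j r1; rewrite Ej in re.
have extP' u : u \in ext -> (u < nvert T)%N.
  by move=> /extP[i ->]; rewrite iter_parent_cat //; exact: iter_parent_lt.
have [_ rTe _] := re.
have yTe : (y < nvert (T1 ++ ext))%N by rewrite nvert_cat ltn_addr.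
set m0 := (n.+1 + j)%N in re.
(* The arrival time [m0 + h] is a multiple of [s], and [h] is at least [j.+2], a number of parent
   steps from [y] to the root. *)
pose h := (s * (m0 + j.+2) - m0)%N.
have hj : (j.+2 <= h)%N by rewrite /h; nia.
have Eh : iter h (parent (T1 ++ ext)) y = 0%N.
  have Ey : iter j.+2 (parent (T1 ++ ext)) y = 0%N.
    by rewrite iter_parent_cat // iterSr parent_y iterSr.
  by rewrite -(subnK hj) iterD Ey; elim: (h - _)%N => //= i ->.
have [ext' re' ext'P] := reachable_down re yTe Eh.
exists (m0 + h)%N, ((T1 ++ ext) ++ ext'), y; split => //.
  by rewrite /h subnKC ?dvdn_mulr //; nia.
have y0 : y != 0%N by [].
split => //.
- rewrite !mem_cat !negb_or mem_nseq; apply/andP; split; last first.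
    apply/negP => /ext'P[i E].
    have : (iter i.+1 (parent (T1 ++ ext)) y < y)%N.
      rewrite iter_parent_cat // iterSr parent_y /T1 /attach iter_parent_cat //.
      exact: iter_parent_lt.
    by rewrite -E ltnn.
  apply/andP; split; last by apply/negP => /extP'; rewrite ltnn.
  apply/andP; split; first by apply/negP => /(allP (proj1 rT)); rewrite ltnn.
  by rewrite negb_and gtn_eqF ?orbT.
- case=> [_ //|i im]; rewrite iter_parent_cat // iter_parent_cat // iterSr parent_y.
  by rewrite /T1 /attach iter_parent_cat //; exact: zm.
Qed.

Lemma deep_leaf_reachable m : (0 < s)%N -> is_rtree T0 -> is_vertex T0 x0 ->
  exists n T z, [/\ reachable n T z, (s %| n)%N & deep_leaf m.+1 T z].
Proof.
move=> s0 rT0 vx0.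
have r0 : reachable 0 T0 x0.
  split => //; rewrite /attained (_ : state_event 0 T0 x0 = setT).
    by rewrite [X in (_ < X)%E](_ : _ = 1%E) ?lte_fin //; exact: probability_setT.
  by apply/seteqP; split => // w _; split => //; exact: walk0.
elim: m => [|m [n [T [z [rz sn [z0 zT zm]]]]]]; last exact: deepen rz sn zm.
by apply: (deepen s0 r0).
Qed.

(** After each growth the walker goes back and forth between [z] and one of its new leaves, and is
    at [z] again at the next growth time. *)
Lemma thicken k q n T z : s = (2 * k)%N -> (0 < k)%N -> reachable n T z -> (s %| n)%N -> 
  exists n', reachable n' (T ++ nseq (q * c) z) z /\ (s %| n')%N.
Proof.
move=> sk k0; elim: q n => [|q IH] n rz sn; first by exists n; rewrite mul0n cats0.
have [n1 [r1 sn1]] := IH n rz sn.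
set T1 := T ++ nseq (q * c) z in r1.
have [_ rT1 zT1] := r1.
set T2 := attach T1 z c; set y := nvert T1.
have rT2 : is_rtree T2 by exact: is_rtree_attach.
have zT2 : (z < nvert T2)%N by rewrite nvert_attach ltn_addr.
have yT2 : (y < nvert T2)%N by rewrite nvert_attach -[ltnLHS]addn0 ltn_add2l.
have parent_y : parent T2 y = z.
  by rewrite -[y]addn0 parent_cat_new ?size_nseq // nth_nseq c_gt0.
have yz : y \in nbrs T2 z by rewrite -parent_y; exact: child_nbrs.
have zy : z \in nbrs T2 y by rewrite -{1}parent_y; exact: parent_nbrs.
have odd_n m : (2 %| m)%N -> (s %| m.+1)%N = false.
  move=> m2; apply/negP => sm1; have : (2 %| 1)%N.
    by rewrite -(dvdn_addr 1 m2) addn1; apply: dvdn_trans sm1; rewrite sk dvdn_mulr.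
  by [].
have n12 : (2 %| n1)%N by apply: dvdn_trans sn1; rewrite sk dvdn_mulr.
suff H i : (i < k)%N -> reachable (n1 + 2 * i.+1)%N T2 z.
  exists (n1 + 2 * k)%N; rewrite -sk dvdn_addl // sn1; split => //.
  have := H k.-1; rewrite prednK // leqnn => /(_ isT).
  by rewrite -sk /T2 /attach /T1 -catA -nseqD -mulSnr.
have bounce m : (s %| m.+1)%N = false -> reachable m.+1 T2 y -> reachable m.+2 T2 z.
  by move=> sm ry; have := @reachable_step m.+1 T2 y z ry; rewrite sm; apply.
elim: i => [|i IHi] ik.
  rewrite muln1 addn2; apply: bounce; first exact: odd_n.
  by have := @reachable_step n1 T1 z y r1; rewrite sn1; apply.
have ri := IHi (ltnW ik).
have -> : (n1 + 2 * i.+2 = (n1 + 2 * i.+1).+2)%N by lia.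
apply: bounce; first by apply: odd_n; rewrite dvdn_addr // dvdn_mulr.
have sm : (s %| n1 + 2 * i.+1)%N = false.
  by rewrite dvdn_addr // sk dvdn_pmul2l //; apply/negP => /dvdn_leq; lia.
by have := @reachable_step _ T2 z y ri; rewrite sm; apply.
Qed.

End Attained.

(** * Voltage along a branch *)

Section BranchPotential.
Variables (B : rtree) (v : nat) (dep : nat -> nat).
Hypotheses (rB : is_rtree B) (vB : (v < nvert B)%N) (v0 : v != 0%N).
Hypothesis dep0 : dep 0%N = 0%N.
Hypothesis depS : forall u, (u < nvert B)%N -> u != 0%N -> dep u = (dep (parent B u)).+1.
Hypothesis dep_root : forall u, (u < nvert B)%N -> iter (dep u) (parent B) u = 0%N /\
     forall i, (i < dep u)%N -> iter i (parent B) u != 0%N.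

Definition on_branch (u : nat) : bool := u \in traject (parent B) v (dep v).

(* The number of vertices of the branch from the root (excluded) to [v] that are
   ancestors of [u]: this is the voltage at [u] when unit current flows along the
   branch, so it is harmonic off the root and [v]. *)
Definition meet_height (u : nat) : nat :=
  (\sum_(i < dep u) on_branch (iter i (parent B) u))%N.

Lemma meet_height0 : meet_height 0 = 0%N.
Proof. by rewrite /meet_height dep0 big_ord0. Qed.

Lemma meet_heightS u : (u < nvert B)%N -> u != 0%N ->
  meet_height u = (on_branch u + meet_height (parent B u))%N.
Proof.
move=> uB u0; rewrite /meet_height depS // big_ord_recl /=; congr (_ + _)%N.
by apply: eq_bigr => i _; rewrite -iterSr.
Qed.

Lemma meet_height_tip : meet_height v = dep v.
Proof.
rewrite /meet_height (eq_bigr (fun=> 1%N)) ?sum1_card ?card_ord // => i _.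
by rewrite /on_branch (_ : _ \in _) //; apply/trajectP; exists i.
Qed.

Lemma meet_height_parent_tip : meet_height (parent B v) = (dep v).-1.
Proof.
rewrite -meet_height_tip (meet_heightS vB v0) (_ : on_branch v) //.
by apply/trajectP; exists 0%N => //; rewrite depS.
Qed.

Lemma dep_iter i : (i <= dep v)%N -> dep (iter i (parent B) v) = (dep v - i)%N.
Proof.
elim: i => [|i IH] iv; first by rewrite subn0.
have := IH (ltnW iv); rewrite (@depS (iter i (parent B) v)); [|exact: iter_parent_lt|].
  by rewrite iterS => E; rewrite subnS -E.
by apply: (proj2 (dep_root vB)).
Qed.

(** A branch vertex other than the tip has exactly one child on the branch, any other vertex none.
    The root is excluded: it is not counted in the branch, yet the branch starts at one of its
    children. *)
Lemma branch_children X : X != 0%N -> X != v ->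
  (\sum_(u <- iota 0 (nvert B) | parent B u == X) on_branch u = on_branch X)%N.
Proof.
move=> X0 Xv.
have inj i u : (i < dep v)%N -> on_branch u -> parent B u = iter i (parent B) v ->
    (0 < i)%N /\ u = iter i.-1 (parent B) v.
  move=> iv /trajectP[j jv ->]; rewrite -iterS => E.
  have := dep_iter jv; rewrite E dep_iter ?(ltnW iv) // => Ed.
  have -> : i = j.+1 by lia.
  by [].
case: (boolP (on_branch X)) => [/trajectP[[|i] iv XE]|nX].
- by rewrite XE eqxx in Xv.
- have iB : (iter i (parent B) v < nvert B)%N by exact: iter_parent_lt.
  rewrite big_mkcond (bigD1_seq (iter i (parent B) v)) ?iota_uniq ?mem_iota //=.
  rewrite -iterS -XE eqxx (_ : on_branch _ = true); last first.
    by apply/trajectP; exists i => //; exact: ltnW.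
  rewrite big1 ?addn0 // => u ui; case: eqP => // pu; apply/eqP; rewrite eqb0.
  by apply: contraNN ui => ou; have [_ ->] := inj i.+1 u iv ou (etrans pu XE).
- rewrite big1 // => u /eqP pu; apply/eqP; rewrite eqb0; apply: contraNN nX => /trajectP[j jv uE].
  move: pu; rewrite uE -iterS => XE.
  have [jv'|jv'] := ltnP j.+1 (dep v); first by apply/trajectP; exists j.+1.
  have jE : j.+1 = dep v by apply/eqP; rewrite eqn_leq jv jv'.
  by move: X0; rewrite -XE jE (proj1 (dep_root vB)) eqxx.
Qed.

(** A leaf added later takes the value of its parent, so that no current flows into it. *)
Definition meet_height_in (T : rtree) (y : nat) : nat :=
  if (y < nvert B)%N then meet_height y else meet_height (parent T y).

(** In the sum of the differences, the edge to the parent of [X] contributes [- on_branch X], the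
    edge to an old child [u] contributes [on_branch u], and a new leaf nothing; [branch_children]
    makes the total 0. *)
Lemma meet_height_harmonic (R : realFieldType) ext X :
  (forall u, u \in ext -> (u < nvert B)%N) ->
  (X < nvert B)%N -> X != 0%N -> X != v ->
  \sum_(a <- incident (B ++ ext) X) ((meet_height_in (B ++ ext) (other_end X a))%:R : R) =
  (size (incident (B ++ ext) X))%:R * (meet_height X)%:R.
Proof.
move=> extP XB X0 Xv; set T := B ++ ext; set l := incident T X.
apply/eqP; rewrite -subr_eq0; apply/eqP.
have -> : (size l)%:R * (meet_height X)%:R = \sum_(a <- l) ((meet_height X)%:R : R).
  by rewrite big_const_seq count_predT iter_addr_0 mulr_natl.
rewrite -sumrB /l incidentE big_map big_filter.
have XT : (X < nvert T)%N by rewrite nvert_cat ltn_addr.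
have pX : parent T X != X by rewrite parent_cat // parent_neq.
transitivity (\sum_(u <- iota 0 (nvert T))
   (if u == X then - (on_branch X)%:R else
    ((parent T u == X) && (u < nvert B)%N && on_branch u)%:R : R)).
  rewrite big_mkcond /=; apply: eq_bigr => u _; rewrite /other_end /=.
  have [->|uX] := eqVneq u X.
    rewrite orbT (negbTE pX) parent_cat // /meet_height_in parent_lt //.
    by rewrite (meet_heightS XB X0) natrD opprD addrCA subrr addr0.
  rewrite orbF; case: (eqVneq (parent T u) X) => //= puX.
  rewrite /meet_height_in; case: (ltnP u (nvert B)) => uB /=.
    have u0 : u != 0%N by apply: contraNneq X0 => u0; rewrite -puX u0.
    rewrite (meet_heightS uB u0) -(parent_cat ext uB) -/T puX natrD addrK //.
  by rewrite puX subrr.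
have nTE : nvert T = (nvert B + size ext)%N by exact: nvert_cat.
move: (nvert T) nTE XT => nT nTE XT.
rewrite (bigD1_seq X) ?iota_uniq ?mem_iota //= eqxx.
rewrite (eq_bigr (fun u => ((parent T u == X) && (u < nvert B)%N && on_branch u)%:R)); last first.
  by move=> u /negbTE ->.
rewrite addrC -[X in _ - X]/((on_branch X)%:R).
apply/eqP; rewrite subr_eq0 -(branch_children X0 Xv) natr_sum; apply/eqP.
have [nB nBE] : exists nB, nB = nvert B by exists (nvert B).
rewrite -!nBE in nTE *.
rewrite [in RHS]big_mkcond /= nTE iotaD big_cat /= [X in _ + X]big1_seq ?addr0; last first.
  move=> u /andP[_]; rewrite mem_iota add0n => /andP[Bu _].
  by rewrite [(u < _)%N]ltnNge Bu /= andbF.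
rewrite big_mkcond /=; apply: eq_big_seq => u; rewrite mem_iota /= add0n => uB.
rewrite parent_cat -?nBE // uB andbT.
have [->|uX] := eqVneq u X.
  by rewrite (negbTE (parent_neq rB XB X0)).
by case: (parent B u == X).
Qed.

End BranchPotential.

(** * Square-root potential of the degree of the tip *)

Section SqrtPotential.
Context (R : realType) (d : measure_display) (OmegaE : measurableType d).
Context (PE : probability OmegaE R) (X : {RV PE >-> nat}).
Variables (mu : R) (mu0 : 0 <= mu) (mean_mu : has_mean X (fun j => j%:R) mu).
Variables (c : nat) (c_gt0 : (0 < c)%N) (p : R).
Hypothesis mean_c : has_mean X (fun j => (j == c)%:R) p.
Variables (S : R) (S0 : 0 <= S).

Definition sqrt_potential (D : nat) : R := Num.max (S * Num.sqrt D%:R - D%:R) 0.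
Notation f := sqrt_potential.

Lemma sqrt_potential_ge0 D : 0 <= f D.
Proof. by rewrite le_max lexx orbT. Qed.

Lemma sqrt_potential_le D : f D <= S ^+ 2.
Proof.
rewrite ge_max sqr_ge0 andbT.
have := sqr_ge0 (S - Num.sqrt (D%:R : R)); have := sqr_ge0 (Num.sqrt (D%:R : R)).
rewrite sqrrB sqr_sqrtr // => H.
have : 0 <= S * Num.sqrt (D%:R : R) by rewrite mulr_ge0 // sqrtr_ge0.
have : (0 : R) <= D%:R by []. have := sqr_ge0 S. lra.
Qed.

(** Escape costs at most [S * kappa / sqrt D]. An arrival of [c] leaves, of probability [p], raises
    [S * sqrt D] by at least [S / (3 * sqrt D)], which suffices when [kappa <= p / 3]; the allowance
    [mu] pays for the term [- D]. *)
Lemma sqrt_potential_growth D kappa : (0 < D)%N -> 0 <= kappa -> kappa <= D%:R ->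
  kappa <= p / 3 ->
  ((f D)%:E <= mu%:E + \int[PE]_v ((1 - kappa / (D + X v)%:R) * f (D + X v))%:E)%E.
Proof.
move=> D0 k0 kD kp; have DR : (0 : R) < D%:R by rewrite ltr0n.
have D1 : (1 : R) <= D%:R by rewrite ler1n.
have pos j : 0 <= (1 - kappa / (D + j)%:R) :> R.
  rewrite subr_ge0 ler_pdivrMr ?ltr0n ?ltn_addr // mul1r (le_trans kD) //.
  by rewrite ler_nat leq_addr.
have [fD|fD] := leP (S * Num.sqrt D%:R - D%:R) 0.
  rewrite /f (max_idPr fD) adde_ge0 ?lee_fin //; apply: integral_ge0 => v _.
  by rewrite lee_fin mulr_ge0 ?pos ?sqrt_potential_ge0.
rewrite {1}/f (max_idPl (ltW fD)).
set r := Num.sqrt D%:R : R; have r0 : 0 < r by rewrite sqrtr_gt0.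
have rr : r * r = D%:R by rewrite -expr2 sqr_sqrtr // ltW.
pose b := S * (r - kappa / r) - D%:R.
pose a := S / (3 * r).
apply: (@le_trans _ _ (mu%:E + (a * p + (- 1 * mu + b))%:E)%E).
  rewrite -EFinD lee_fin /a /b.
  have : 0 <= S / r * (p / 3 - kappa) by rewrite mulr_ge0 ?divr_ge0 ?(ltW r0) // subr_ge0.
  have -> : S / r * (p / 3 - kappa) = S / (3 * r) * p - S * (kappa / r).
    by field; rewrite gt_eqF.
  lra.
rewrite leeD2l //; apply: (@ge_mean _ _ _ _ X
  (fun j => (1 - kappa / (D + j)%:R) * f (D + j)%N)
  (fun j => a * (j == c)%:R + (- 1 * j%:R + b))).
- by move=> j; rewrite mulr_ge0 ?pos ?sqrt_potential_ge0.
- move=> j; set E := (D + j)%N.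
  have EE : E%:R = D%:R + j%:R :> R by rewrite /E natrD.
  have jR : (0 : R) <= j%:R by [].
  set q := Num.sqrt E%:R : R; have q0 : 0 < q by rewrite sqrtr_gt0 ltr0n /E ltn_addr.
  have qq : q * q = E%:R by rewrite -expr2 sqr_sqrtr.
  have rq : r <= q by rewrite ler_sqrt // EE lerDl.
  apply: (@le_trans _ _ ((1 - kappa / E%:R) * (S * q - E%:R))); last first.
    by rewrite ler_wpM2l ?pos // le_max lexx.
  have -> : (1 - kappa / E%:R) * (S * q - E%:R) = S * (q - kappa / q) - E%:R + kappa.
    by rewrite -qq; field; rewrite gt_eqF.
  have kq : kappa / q <= kappa / r by rewrite ler_wpM2l // lef_pV2 ?posrE.
  (* For [j = c], either [q <= 2 * r] and [(q - r) * (q + r) = j >= 1] gives the bound, or [q - r]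
     exceeds [r >= 1]. *)
  have step : (j == c)%:R / (3 * r) <= q - r.
    case: eqP => [jc|_]; last by rewrite mul0r subr_ge0.
    rewrite (_ : true%:R = 1) //.
    have j1 : (1 : R) <= j%:R by rewrite ler1n jc.
    have q2r : q <= q * 1 by rewrite mulr1.
    have qr0 : 0 < q + r by rewrite addr_gt0.
    have prod : (q - r) * (q + r) = j%:R.
      have -> : (q - r) * (q + r) = q * q - r * r by ring.
      by rewrite qq rr EE; ring.
    have [q2|q2] := leP q (2 * r).
      rewrite ler_pdivrMr ?mulr_gt0 //.
      have : 0 <= (q - r) * (3 * r - (q + r)) by rewrite mulr_ge0 ?subr_ge0 //; lra.
      rewrite mulrBr prod; lra.
    have r1 : 1 <= r by rewrite -(sqrtr1 R) ler_sqrt.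
    rewrite ler_pdivrMr ?mulr_gt0 //.
    have : 0 <= (q - 2 * r) * r by rewrite mulr_ge0 ?subr_ge0 // ltW.
    rewrite mulrBl -mulrA rr => H.
    have -> : (q - r) * (3 * r) = 3 * (q * r) - 3 * (r * r) by ring.
    rewrite rr /=; lra.
  have : S * ((j == c)%:R / (3 * r)) <= S * (q - r) by rewrite ler_wpM2l.
  have : S * (kappa / q) <= S * (kappa / r) by rewrite ler_wpM2l.
  have -> : a * (j == c)%:R = S * ((j == c)%:R / (3 * r)).
    by rewrite /a; field; rewrite gt_eqF.
  rewrite /b EE; lra.
- apply: has_meanD; first exact: has_meanZ.
  apply: has_meanD; first exact: has_meanZ.
  exact: has_mean_cst.
Qed.

End SqrtPotential.

(** * Submartingale on a long branch *)

Section BranchValue.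
Context (R : realType) (d : measure_display) (OmegaE : measurableType d).
Context (PE : probability OmegaE R) (X : {RV PE >-> nat}).
Variables (mu : R) (mu0 : 0 <= mu) (mean_mu : has_mean X (fun j => j%:R) mu).
Variables (c : nat) (c_gt0 : (0 < c)%N) (p : R).
Hypothesis mean_c : has_mean X (fun j => (j == c)%:R) p.
Variables (S : R) (S0 : 0 <= S).
Variables (B : rtree) (v : nat) (dep : nat -> nat).
Hypotheses (rB : is_rtree B) (vB : (v < nvert B)%N) (v0 : v != 0%N) (vleaf : v \notin B).
Hypothesis dep0 : dep 0%N = 0%N.
Hypothesis depS : forall u, (u < nvert B)%N -> u != 0%N -> dep u = (dep (parent B u)).+1.
Hypothesis dep_root : forall u, (u < nvert B)%N -> iter (dep u) (parent B) u = 0%N /\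
     forall i, (i < dep u)%N -> iter i (parent B) u != 0%N.
Variables (k : nat) (k_gt0 : (0 < k)%N).
Hypothesis deep : 6 * k%:R <= p * (dep v)%:R.

Let s := (2 * k)%N.
Let m := dep v.
(** From the parent of the tip, the root is reached before the tip with probability [1 / m], as the
    heights show. *)
Let g : R := m%:R^-1.
Notation f := (sqrt_potential S).
Notation height := (meet_height B v dep).
Notation height_in := (meet_height_in B v dep).
Notation par := (odd (dep v)).

Definition tip_degree (T : rtree) : nat := size (incident T v).

(* The value at the tip decreases with the waiting time until the next growth;
   away from the tip the walker may come back at any phase, so the least
   favourable phase is used there. *)
Definition tip_value (w D : nat) : R := (1 - 2 * g * w%:R / D%:R) * f D.

Definition near_tip (T : rtree) (x : nat) : bool :=
  (x == v) || (nvert B <= x)%N && (parent T x == v).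

(** Harmonic measure of the tip times the value there. A new leaf on [v] counts as the tip, because
    the walker must return from it; it is occupied at odd times, whence [uphalf]. The condition on
    the degree keeps the factor in [tip_value] nonnegative. *)
Definition branch_value (n : nat) (T : rtree) (x : nat) : R :=
  if `[< on_class B dep par n T x >] && (x != 0%N) && (2 * k <= tip_degree T)%N then
    if near_tip T x then tip_value (wait k (uphalf n)) (tip_degree T)
    else (height_in T x)%:R / m%:R * tip_value k.-1 (tip_degree T)
  else 0.

Let m_gt0 : (0 < m)%N. Proof. by rewrite /m depS. Qed.
Let mR : (0 : R) < m%:R. Proof. by rewrite ltr0n. Qed.
Let g0 : 0 < g. Proof. by rewrite invr_gt0. Qed.
Let g1 : g <= 1. Proof. by rewrite invf_le1 // ler1n. Qed.

Let k2_gt0 : (0 < 2 * k)%N. Proof. by rewrite muln_gt0. Qed.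

Let f0 D : 0 <= f D. Proof. exact: sqrt_potential_ge0. Qed.

Let small (w D : nat) : (w <= k.-1)%N -> (2 * k <= D)%N ->
  0 <= 2 * g * w%:R / D%:R <= (1 : R) /\ (2 : R) * w%:R / D%:R <= 1.
Proof.
move=> wk kD; have D0 : (0 : R) < D%:R by rewrite ltr0n; exact: leq_trans k2_gt0 kD.
have wD : (2 : R) * w%:R <= D%:R.
  by rewrite -natrM ler_nat (leq_trans _ kD) // leq_mul2l /= (leq_trans wk) // leq_pred.
have w0 : (0 : R) <= 2 * w%:R by rewrite mulr_ge0.
have H : (2 : R) * w%:R / D%:R <= 1 by rewrite ler_pdivrMr // mul1r.
split => //; rewrite !mulr_ge0 ?invr_ge0 ?(ltW g0) ?(ltW D0) //=.
apply: le_trans H; rewrite ler_pM2r ?invr_gt0 // -mulrA [g * _]mulrC mulrA.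
by rewrite ler_piMr.
Qed.

Let tip_value_ge0 w D : (w <= k.-1)%N -> (2 * k <= D)%N -> 0 <= tip_value w D.
Proof.
by move=> wk kD; have [/andP[_ w1] _] := small wk kD; rewrite mulr_ge0 ?f0 // subr_ge0.
Qed.

Let tip_value_le w D : (w <= k.-1)%N -> (2 * k <= D)%N -> tip_value w D <= f D.
Proof.
by move=> wk kD; have [/andP[w0 _] _] := small wk kD; rewrite ler_piMl ?f0 // gerBl.
Qed.

Let tip_value_mono w w' D : (w <= w')%N -> tip_value w' D <= tip_value w D.
Proof.
move=> ww; rewrite ler_wpM2r ?f0 // lerD2l lerN2 ler_wpM2r ?invr_ge0 //.
by rewrite ler_wpM2l ?ler_nat // mulr_ge0 // ltW.
Qed.

Let wait_le n : (wait k n <= k.-1)%N.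
Proof. by rewrite -ltnS prednK // ltn_pmod. Qed.

Let height_v : height v = m. Proof. exact: meet_height_tip. Qed.
Let height_pv : height (parent B v) = m.-1.
Proof. by apply: meet_height_parent_tip. Qed.

Let pv_B : (parent B v < nvert B)%N. Proof. exact: parent_lt. Qed.
Let pv_neq : parent B v != v. Proof. exact: parent_neq. Qed.

Let no_old_child u : (u < nvert B)%N -> parent B u != v.
Proof.
case: u => [|u] uB; first by rewrite parent0 eq_sym.
apply: contraNneq vleaf => <-; rewrite /parent /=.
by apply: mem_nth.
Qed.

Let old_parent T u : grows_old B dep par T -> (u < nvert B)%N -> parent T u = parent B u.
Proof. by move=> [ext -> _] uB; rewrite parent_cat. Qed.

Let old_lt T u : grows_old B dep par T -> (u < nvert B)%N -> (u < nvert T)%N.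
Proof. by move=> [ext -> _] uB; rewrite nvert_cat ltn_addr. Qed.

Let new_parent T u : grows_old B dep par T -> (nvert B <= u < nvert T)%N ->
  (parent T u < nvert B)%N.
Proof. by move=> [ext -> extP] uB; have /extP[] := parent_new_in uB. Qed.

Let near_height T y : grows_old B dep par T -> near_tip T y -> height_in T y = m.
Proof.
rewrite /near_tip /meet_height_in => gT /orP[/eqP ->|/andP[By /eqP ->]].
  by rewrite vB height_v.
by rewrite ltnNge By height_v.
Qed.

(** A minorant common to both cases of the definition: near the tip the height is [m], and the
    current phase is at least as good as the worst one. *)
Lemma branch_value_ge n T y : on_class B dep par n T y -> (2 * k <= tip_degree T)%N ->
  (height_in T y)%:R / m%:R * tip_value k.-1 (tip_degree T) <= branch_value n T y.
Proof.
move=> ony kD; have [gT yT _] := ony.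
rewrite /branch_value asboolT // kD andbT /=.
have [->|y0] := eqVneq y 0%N.
  rewrite /meet_height_in meet_height0 // (leq_ltn_trans _ vB) // mul0r mul0r.
  by rewrite lexx.
case: ifP => // near; rewrite near_height // divff ?gt_eqF // mul1r.
exact: tip_value_mono.
Qed.

Lemma branch_value_ge0 n T y : 0 <= branch_value n T y.
Proof.
rewrite /branch_value; case: ifP => // /andP[_ kD].
case: ifP => _; first exact: tip_value_ge0.
by rewrite mulr_ge0 ?divr_ge0 ?tip_value_ge0.
Qed.

(** A bound uniform in [n], [T] and [y] is wanted for [subsolution_bound]; the sum of the heights
    crudely dominates their maximum. *)
Lemma branch_value_le n T y :
  branch_value n T y <= S ^+ 2 * (1 + (\sum_(u < nvert B) height u)%N%:R).
Proof.
have M0 : 0 <= S ^+ 2 * (1 + (\sum_(u < nvert B) height u)%N%:R).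
  by rewrite mulr_ge0 ?sqr_ge0 // addr_ge0.
have hle u : (u < nvert B)%N -> (height u <= \sum_(u < nvert B) height u)%N.
  by move=> uB; rewrite (bigD1 (Ordinal uB)) //= leq_addr.
rewrite /branch_value; case: ifP => // /andP[/andP[/asboolP[gT yT _] y0] kD].
case: ifP => near.
  apply: (le_trans (tip_value_le _ kD)) => //; apply: (le_trans (sqrt_potential_le S0 _)).
  by rewrite ler_peMr ?sqr_ge0 // lerDl.
rewrite mulrC; apply: ler_pM; rewrite ?tip_value_ge0 ?divr_ge0 //.
  by apply: (le_trans (tip_value_le _ kD)) => //; exact: sqrt_potential_le.
apply: (@le_trans _ _ (height_in T y)%:R).
  by rewrite ler_pdivrMr // ler_peMr // ler1n.
apply: (@le_trans _ _ (\sum_(u < nvert B) height u)%N%:R); last by rewrite lerDr.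
rewrite ler_nat /meet_height_in; case: ifP => yB; first exact: hle.
by apply: hle; apply: new_parent => //; rewrite leqNgt yB.
Qed.

Let uphalf_even n : ~~ odd n -> uphalf n = n./2.
Proof. by move=> /negbTE n_even; rewrite uphalf_half n_even. Qed.

Let s_dvd n : ~~ odd n -> (s %| n)%N = (k %| uphalf n)%N.
Proof.
move=> n_even; rewrite uphalf_even // -{1}(odd_double_half n) (negbTE n_even) add0n.
by rewrite -mul2n dvdn_pmul2l.
Qed.

Let s_odd n : odd n -> (s %| n)%N = false.
Proof.
move=> n_odd; apply/negP => /(dvdn_trans (dvdn_mulr k (dvdnn 2))).
by rewrite dvdn2 n_odd.
Qed.

Let s_even : ~~ odd s. Proof. by rewrite /s mul2n odd_double. Qed.

Let nbr_avg_const T x (h : nat -> R) a : (x < nvert T)%N ->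
  (forall y, y \in nbrs T x -> h y = a) -> nbr_avg T x h = a.
Proof.
move=> xT ha; have D0 : ((size (incident T x))%:R : R) != 0 by rewrite pnatr_eq0 -lt0n deg_gt0.
rewrite /nbr_avg (eq_big_seq (fun=> a)); last by move=> b bI; apply: ha; exact: map_f.
by rewrite big_const_seq count_predT iter_addr_0 -[a *+ _]mulr_natr mulfK.
Qed.

Section Step.
Variables (n : nat) (T : rtree) (x : nat).
Hypotheses (onx : on_class B dep par n T x) (x0 : x != 0%N) (kT : (2 * k <= tip_degree T)%N).

Let T' j := if (s %| n)%N then attach T x j else T.

Let onx' j y : y \in nbrs (T' j) x -> on_class B dep par n.+1 (T' j) y.
Proof. exact: (on_class_step rB depS s_even onx x0). Qed.

Let gT' j : grows_old B dep par (T' j).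
Proof. exact: (grows_old_step j s_even onx). Qed.

Let tipT' j : tip_degree (T' j) = (tip_degree T + (if (v == x) && (s %| n)%N then j else 0))%N.
Proof.
have vT : (v < nvert T)%N by case: onx => gT _ _; exact: old_lt gT vB.
rewrite /tip_degree /T'; case: (s %| n)%N; last by rewrite andbF addn0.
by rewrite deg_attach // andbT.
Qed.

Let xT' j : (x < nvert (T' j))%N.
Proof. by case: onx => _ xT _; rewrite /T'; case: ifP => // _; rewrite nvert_attach ltn_addr. Qed.

Let kT' j : (2 * k <= tip_degree (T' j))%N.
Proof. by rewrite tipT' (leq_trans kT) // leq_addr. Qed.

(** The only neighbour of such a leaf is [v], and [uphalf] takes the same value at an odd time and
    at the next one. *)
Let step_new : (nvert B <= x)%N -> near_tip T x -> forall j,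
  nbr_avg (T' j) x (branch_value n.+1 (T' j)) = branch_value n T x.
Proof.
move=> Bx near j; have [gT xT xpar] := onx.
have n_odd : odd n.
  by apply: contraTT Bx => /(on_class_even onx)[xB _]; rewrite -ltnNge.
have TE : T' j = T by rewrite /T' s_odd.
have xv : (x == v) = false by apply/negbTE; rewrite neq_ltn (leq_trans vB Bx) orbT.
have pv : parent T x = v by move: near; rewrite /near_tip xv Bx => /eqP.
have xnew : (nvert B <= x < nvert (T' j))%N by rewrite Bx xT'.
apply: nbr_avg_const => // y yx.
have [yE _] := nbrs_new rB (gT' j) xnew yx.
have ony := onx' yx; rewrite TE in yE ony *; rewrite {}yE pv in ony *.
rewrite /branch_value !asboolT // v0 x0 kT /near_tip eqxx xv Bx pv eqxx /=.
by congr tip_value; congr wait; move: n_odd; clear; lia.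
Qed.

(** The degree of the tip does not change here, so the averaging acts on the height alone, which is
    harmonic off the root and [v]. *)
Let step_away : ~~ near_tip T x -> forall j,
  branch_value n T x <= nbr_avg (T' j) x (branch_value n.+1 (T' j)).
Proof.
move=> near j; have [gT xT xpar] := onx.
have xv : x != v by move: near; rewrite negb_or => /andP[].
have tE : tip_degree (T' j) = tip_degree T by rewrite tipT' eq_sym (negbTE xv) addn0.
rewrite {1}/branch_value asboolT // x0 kT (negbTE near) /=.
set F1 := tip_value k.-1 (tip_degree T).
have F10 : 0 <= F1 by exact: tip_value_ge0.
have D0 : (0 : R) < (size (incident (T' j) x))%:R by rewrite ltr0n deg_gt0.
apply: (@le_trans _ _ (nbr_avg (T' j) x (fun y => (height_in (T' j) y)%:R / m%:R * F1))); last first.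
  rewrite /nbr_avg ler_pM2r ?invr_gt0 // !big_seq; apply: ler_sum => a aI.
  by rewrite /F1 -tE; apply: branch_value_ge => //; apply: onx'; exact: map_f.
rewrite le_eqVlt; apply/orP; left; apply/eqP.
have [xB|Bx] := ltnP x (nvert B); last first.
  have xnew : (nvert B <= x < nvert (T' j))%N by rewrite Bx xT'.
  have parE : parent (T' j) x = parent T x by rewrite /T'; case: ifP => // _; exact: parent_cat.
  rewrite (@nbr_avg_const _ _ _ ((height_in T x)%:R / m%:R * F1)) // => y yx.
  have [-> yB] := nbrs_new rB (gT' j) xnew yx.
  rewrite parE in yB *.
  by rewrite /meet_height_in yB [(x < nvert B)%N]ltnNge Bx.
have [ext TE extP] := gT' j.
rewrite /nbr_avg; under eq_bigr do rewrite -mulrA mulrC.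
rewrite -mulr_sumr.
have -> : \sum_(a <- incident (T' j) x) ((height_in (T' j) (other_end x a))%:R : R) =
    (size (incident (T' j) x))%:R * (height x)%:R.
  rewrite TE; apply: meet_height_harmonic => //.
  by move=> u /extP[].
rewrite {1}/meet_height_in xB; field.
by rewrite !gt_eqF.
Qed.

Let uniq_incident U : uniq (incident U v).
Proof.
rewrite incidentE map_inj_uniq; last by move=> a b [].
by rewrite filter_uniq // iota_uniq.
Qed.

(** [v] has no child in [B], so all its edges but one lead to leaves added later; the other leads to
    its parent, of relative height [1 - g]. *)
Let step_tip_sum : x = v -> forall j D, D = tip_degree (T' j) ->
  (D%:R - 1) * tip_value (wait k (uphalf n.+1)) D + (1 - g) * tip_value k.-1 D <=
  \sum_(a <- incident (T' j) v) branch_value n.+1 (T' j) (other_end v a).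
Proof.
move=> xv j D DE; have vT' : (v < nvert (T' j))%N by exact: old_lt (gT' j) vB.
have pE : parent (T' j) v = parent B v by exact: old_parent.
have a0I : (parent B v, v) \in incident (T' j) v.
  rewrite incidentE; apply/mapP; exists v; rewrite ?pE //.
  by rewrite mem_filter eqxx orbT mem_iota.
rewrite (big_rem _ a0I) /= addrC; apply: lerD; last first.
  rewrite {1}/other_end /= (negbTE pv_neq).
  have pI : parent B v \in nbrs (T' j) x.
    rewrite xv; apply/mapP; exists (parent B v, v) => //.
    by rewrite /other_end /= (negbTE pv_neq).
  apply: le_trans (branch_value_ge (onx' pI) (kT' j)).
  have gE : (m.-1%:R / m%:R : R) = 1 - g.
    by rewrite -subn1 natrB // mulrBl divff ?gt_eqF // mul1r.
  by rewrite /meet_height_in pv_B height_pv -DE gE.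
rewrite (eq_big_seq (fun=> tip_value (wait k (uphalf n.+1)) D)).
  rewrite big_const_seq count_predT iter_addr_0 size_rem // -/(tip_degree _) -DE -[_ *+ _.-1]mulr_natl.
  by rewrite -subn1 natrB // DE; exact: leq_trans k2_gt0 (kT' j).
move=> a; rewrite mem_rem_uniq // inE => /andP[a_neq aI].
have aN : other_end v a \in nbrs (T' j) x by rewrite xv; exact: map_f.
have := aI; rewrite incidentE => /mapP[u]; rewrite mem_filter mem_iota /= => /andP[uv uT'] aE.
have uv' : u != v by apply: contraNneq a_neq => E; rewrite aE E pE.
rewrite (negbTE uv') orbF in uv.
have oE : other_end v a = u by rewrite aE /other_end /= uv.
rewrite oE in aN *.
have u0 : u != 0%N by apply: contraTneq uv => ->; rewrite parent0 eq_sym.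
have uB : (nvert B <= u)%N.
  rewrite leqNgt; apply/negP => uB; move: (no_old_child uB).
  by rewrite -(old_parent (gT' j) uB) uv.
by rewrite /branch_value DE asboolT ?u0 ?kT' /near_tip ?uv ?uB ?orbT //; exact: onx'.
Qed.

Lemma branch_value_step : ((branch_value n T x)%:E <=
  mu%:E + \int[PE]_u (nbr_avg (T' (X u)) x (branch_value n.+1 (T' (X u))))%:E)%E.
Proof.
have avg0 j : 0 <= nbr_avg (T' j) x (branch_value n.+1 (T' j)).
  by apply: nbr_avg_ge0 => y; exact: branch_value_ge0.
have free : (forall j, branch_value n T x <= nbr_avg (T' j) x (branch_value n.+1 (T' j))) ->
    ((branch_value n T x)%:E <=
    mu%:E + \int[PE]_u (nbr_avg (T' (X u)) x (branch_value n.+1 (T' (X u))))%:E)%E.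
  move=> H; apply: (@le_trans _ _ (mu%:E + (branch_value n T x)%:E)%E).
    by rewrite leeDr ?lee_fin.
  rewrite leeD2l //; apply: (@ge_mean _ _ _ _ X
    (fun j => nbr_avg (T' j) x (branch_value n.+1 (T' j))) (fun=> branch_value n T x)) => //.
  exact: has_mean_cst.
have [near|away] := boolP (near_tip T x); last by apply: free => j; exact: step_away.
have [xB|Bx] := ltnP x (nvert B); last by apply: free => j; rewrite step_new.
have xv : x = v by move: near; rewrite /near_tip [(nvert B <= x)%N]leqNgt xB /= orbF => /eqP.
have n_even : ~~ odd n.
  have [_ _] := onx; rewrite /lvl xB xv oddD.
  by case: (odd n); case: (odd (dep v)).
have upS : uphalf n.+1 = (uphalf n).+1 by move: n_even; clear; lia.
have VE : branch_value n T x = tip_value (wait k (uphalf n)) (tip_degree T).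
  by rewrite /branch_value asboolT // x0 kT near.
have avg_ge j D : D = tip_degree (T' j) ->
   ((D%:R - 1) * tip_value (wait k (uphalf n.+1)) D + (1 - g) * tip_value k.-1 D) / D%:R <=
   nbr_avg (T' j) x (branch_value n.+1 (T' j)).
  move=> DE; rewrite /nbr_avg xv -/(tip_degree _) -DE.
  by apply: ler_wpM2r; [rewrite invr_ge0|exact: step_tip_sum].
(* Without growth the waiting time decreases by one, which raises [tip_value] by [2 * g * f D / D];
   this covers the jump to the parent. *)
have [sn|sn] := boolP (s %| n)%N; last first.
  apply: free => j; apply: le_trans (avg_ge j _ erefl); rewrite VE tipT' (negbTE sn) andbF addn0.
  rewrite s_dvd // in sn; have w0 := wait_gt0 k_gt0 sn.
  rewrite upS waitS // (negbTE sn).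
  set w := wait k (uphalf n) in w0 *; set D := tip_degree T.
  have D0 : (0 : R) < D%:R by rewrite ltr0n; exact: leq_trans k2_gt0 kT.
  have [_ kD] := small (leqnn k.-1) kT; rewrite -/D in kD.
  rewrite ler_pdivlMr // /tip_value -/D -(prednK w0) /= -[w.-1.+1%:R]natr1.
  set y := (k.-1%:R : R) in kD *; set z := (w.-1%:R : R).
  have z0 : 0 <= z by [].
  have y0 : 0 <= y by [].
  rewrite -subr_ge0.
  have -> : (D%:R - 1) * ((1 - 2 * g * z / D%:R) * f D) + (1 - g) * ((1 - 2 * g * y / D%:R) * f D) -
      (1 - 2 * g * (z + 1) / D%:R) * f D * D%:R =
      g * f D * ((1 - 2 * y / D%:R) + 2 * z / D%:R + 2 * g * y / D%:R).
    by field; rewrite gt_eqF.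
  have t1 : 0 <= 2 * z / D%:R by apply: divr_ge0; [exact: mulr_ge0|exact: ltW].
  have t2 : 0 <= 2 * g * y / D%:R.
    by apply: divr_ge0; [rewrite !mulr_ge0 // ltW|exact: ltW].
  apply: mulr_ge0; first by apply: mulr_ge0; [exact: ltW|exact: f0].
  by lra.
(* At a growth time a whole period must be paid for: [kappa = 2 * g * k], and [deep] amounts to
   [kappa <= p / 3]. *)
have sn' := sn; rewrite s_dvd // in sn'.
rewrite VE wait0 // /tip_value mulr0 mul0r subr0 mul1r.
have T0 : (0 < tip_degree T)%N by exact: leq_trans k2_gt0 kT.
have kappa0 : 0 <= 2 * g * k%:R by rewrite !mulr_ge0 // ltW.
have kappa_k : 2 * g * k%:R <= 2 * k%:R.
  by rewrite -mulrA [g * _]mulrC mulrA ler_piMr // mulr_ge0.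
have kappaD : 2 * g * k%:R <= (tip_degree T)%:R.
  by apply: (le_trans kappa_k); rewrite -natrM ler_nat.
have kappa_p : 2 * g * k%:R <= p / 3.
  rewrite ler_pdivlMr //.
  have -> : 2 * g * k%:R * 3 = 6 * k%:R / m%:R by rewrite /g; ring.
  by rewrite ler_pdivrMr.
apply: (le_trans (sqrt_potential_growth mu0 mean_mu c_gt0 mean_c S0 T0 kappa0 kappaD kappa_p)).
rewrite leeD2l //; apply: ge0_le_integral => //.
- move=> u _; rewrite lee_fin mulr_ge0 ?f0 // subr_ge0 ler_pdivrMr ?ltr0n ?ltn_addr // mul1r.
  by apply: (le_trans kappaD); rewrite ler_nat leq_addr.
- exact: (measurable_comp_RV X (fun j =>
    ((1 - 2 * g * k%:R / (tip_degree T + j)%:R) * f (tip_degree T + j))%:E)).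
- exact: (measurable_comp_RV X (fun j => (nbr_avg (T' j) x (branch_value n.+1 (T' j)))%:E)).
move=> u _; rewrite lee_fin; apply: le_trans (avg_ge (X u) _ erefl).
rewrite tipT' xv eqxx sn upS waitS // sn' /=.
set D := (tip_degree T + X u)%N.
have kDn : (2 * k <= D)%N by rewrite (leq_trans kT) // leq_addr.
have D0 : (0 : R) < D%:R by rewrite ltr0n; exact: leq_trans k2_gt0 kDn.
rewrite ler_pdivlMr // /tip_value -{1}(prednK k_gt0) -[k.-1.+1%:R]natr1.
set y := (k.-1%:R : R); have y0 : 0 <= y by [].
rewrite -subr_ge0.
have -> : (D%:R - 1) * ((1 - 2 * g * y / D%:R) * f D) + (1 - g) * ((1 - 2 * g * y / D%:R) * f D) -
      (1 - 2 * g * (y + 1) / D%:R) * f D * D%:R =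
      g * f D * (1 + 2 * g * y / D%:R).
  by field; rewrite gt_eqF.
have t2 : 0 <= 2 * g * y / D%:R.
  by apply: divr_ge0; [rewrite !mulr_ge0 // ltW|exact: ltW].
apply: mulr_ge0; first by apply: mulr_ge0; [exact: ltW|exact: f0].
by lra.
Qed.

End Step.

End BranchValue.

Section NotPositiveRecurrent.
Context (R : realType) (d : measure_display) (OmegaE : measurableType d).
Context (PE : probability OmegaE R) (xi : nat -> {RV PE >-> nat}).
Hypothesis xi_iid : iid xi.
Variables (mu : R) (mu0 : 0 < mu) (mean_mu : has_mean (xi 1%N) (fun j => j%:R) mu).
Variables (c : nat) (c_gt0 : (0 < c)%N) (p : R) (p_gt0 : 0 < p).
Hypothesis mean_c : has_mean (xi 1%N) (fun j => (j == c)%:R) p.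
Variables (k : nat) (k_gt0 : (0 < k)%N) (T0 : rtree) (x0 : nat).
Context (W : TBRW xi (2 * k)%N T0 x0).

Section Branch.
Variables (B : rtree) (v : nat) (dep : nat -> nat).
Hypotheses (rB : is_rtree B) (vB : (v < nvert B)%N) (v0 : v != 0%N) (vleaf : v \notin B).
Hypothesis dep0 : dep 0%N = 0%N.
Hypothesis depS : forall u, (u < nvert B)%N -> u != 0%N -> dep u = (dep (parent B u)).+1.
Hypothesis dep_root : forall u, (u < nvert B)%N -> iter (dep u) (parent B) u = 0%N /\
     forall i, (i < dep u)%N -> iter i (parent B) u != 0%N.
Hypothesis deep : 6 * k%:R <= p * (dep v)%:R.
Variables (n0 q : nat) (n0k : (2 * k %| n0)%N) (kq : (2 * k <= q)%N).
Let T := B ++ nseq q v.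
Hypothesis att : attained W n0 T v.

Let alive i (e x : nat -> nat) : bool :=
  avoids (2 * k) T0 n0 T 0 i e x && (x n0 == v).

Let adapted_alive i : adapted (n0 + i) (n0 + i).+1 (alive i).
Proof.
move=> e e' x x' He Hx; rewrite /alive (@adapted_avoids (2 * k)%N T0 n0 T 0%N i e e' x x') //.
by rewrite Hx // ltnS leq_addr.
Qed.

Let aliveS i e x : alive i.+1 e x = alive i e x && (x (n0 + i.+1)%N != 0%N).
Proof.
by rewrite /alive /avoids -[i.+2]addn1 iotaD all_cat /= andbT add0n andbA andbAC.
Qed.

Let a i : \bar R := (\int[law W]_w ((alive i (env W ^~ w) (walk W ^~ w))%:R : R)%:E)%E.

Let measurable_alive i : measurable_fun setT
  (fun w => ((alive i (env W ^~ w) (walk W ^~ w))%:R : R)%:E).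
Proof.
apply: (measurable_adapted (W := W) (n := (n0 + i)%N) (m := (n0 + i).+1)
  (F := fun e x => ((alive i e x)%:R)%:E)) => e e' x x' He Hx.
by rewrite (@adapted_alive i e e' x x').
Qed.

Let alive0 w : alive 0 (env W ^~ w) (walk W ^~ w) =
  state_ind (2 * k) T0 n0 T v (env W ^~ w) (walk W ^~ w).
Proof.
rewrite /alive /avoids /state_ind /= andbT addn0; case: (_ == T) => //=.
by case: (walk W n0 w =P v) => [->|_]; rewrite ?v0 ?andbT ?andbF.
Qed.

Let n0_even : ~~ odd n0.
Proof. by apply/negP => n_odd; have := dvdn_trans (dvdn_mulr k (dvdnn 2)) n0k; rewrite dvdn2 n_odd. Qed.

Let kT : (2 * k <= tip_degree v T)%N.
Proof.
by rewrite /tip_degree /T -/(attach B v q) deg_attach // eqxx (leq_trans kq) // leq_addl.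
Qed.

(** [ereal_inf_first] with unit step. Index 0, excluded from the infimum, makes no difference since
    the walker starts at [v], which is not the root. *)
Let hitting_sum w : ((hitting_after n0 0 : Defs.space W -> \bar R) \_ (state_event n0 T v)) w =
  (\sum_(i <oo) ((alive i (env W ^~ w) (walk W ^~ w))%:R : R)%:E)%E.
Proof.
rewrite /patch; case: ifPn => [|]; rewrite (inE, notin_setE) => Bw; last first.
  rewrite eseries0 // => i _ _; rewrite /alive; case: eqP => [E|_]; rewrite ?andbF //.
  rewrite /avoids; case: eqP => [E'|_] //; exfalso; apply: Bw; by split.
have [Tw vw] := Bw.
rewrite /hitting_after.
pose Q m := (1 <= m)%N /\ walk W (n0 + m)%N w = 0%N.
rewrite (_ : [set _ | m in _] = [set (((1 * m)%N%:R : R))%:E | m in Q]); last first.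
  by apply/seteqP; split => y [m Qm <-]; exists m => //; rewrite mul1n.
rewrite (ereal_inf_first R) //; apply: eq_eseriesr => i _; rewrite mul1r.
congr (_%:R)%:E; congr nat_of_bool; apply/asboolP/idP.
  move=> H; rewrite /alive /avoids [_ == T](introT eqP Tw) vw eqxx andbT andTb.
  apply/allP => j; rewrite mem_iota add0n => /andP[_ ji]; apply/eqP => E.
  case: j ji E => [|j] ji E; first by rewrite addn0 vw in E; move: v0; rewrite E.
  by apply: (H j.+1).
move=> /andP[/andP[_ /allP H] _] j ji [j1 E].
by have := H j; rewrite mem_iota add0n ltnS ji E eqxx => /(_ isT).
Qed.

Section Potential.
Variables (S : R) (S0 : 0 <= S).

Let V n T' x := branch_value S B v dep k n T' x.

Let U i (e x : nat -> nat) : R :=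
  (alive i e x)%:R * V (n0 + i) (tree_at (2 * k) T0 e x (n0 + i)) (x (n0 + i)%N).

Let V0 n T' x : 0 <= V n T' x.
Proof. by apply: branch_value_ge0. Qed.

Let adapted_U i : adapted (n0 + i) (n0 + i).+1 (U i).
Proof.
move=> e e' x x' He Hx; rewrite /U (@adapted_alive i e e' x x') //.
rewrite (@adapted_tree (2 * k)%N T0 (n0 + i)%N e e' x x') // ?Hx //.
by move=> j ji; apply: Hx; exact: leqW.
Qed.

(** The mean loss per step is at most [mu] while the root is avoided; stopping at the root costs
    nothing more, [branch_value] being 0 there. *)
Let U_step i : (\int[law W]_w (U i (env W ^~ w) (walk W ^~ w))%:E <=
  mu%:E * a i + \int[law W]_w (U i.+1 (env W ^~ w) (walk W ^~ w))%:E)%E.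
Proof.
have U0 j e x : 0 <= U j e x by rewrite mulr_ge0.
pose C e x : R := mu * (alive i e x)%:R.
have aC : adapted (n0 + i) (n0 + i).+1 C.
  by move=> e e' x x' He Hx; rewrite /C (@adapted_alive i e e' x x').
have -> : (mu%:E * a i = \int[law W]_w (C (env W ^~ w) (walk W ^~ w))%:E)%E.
  rewrite /a -ge0_integralZl ?lee_fin ?(ltW mu0) //.
have aU1 : adapted (n0 + i).+1 (n0 + i).+2 (U i.+1) by rewrite -addnS; exact: adapted_U.
apply: (@ge_integral_step _ _ _ _ _ xi_iid (2 * k)%N T0 x0 W (n0 + i)%N (U i.+1) (U i) C) => //.
  by move=> e x; rewrite mulr_ge0 // ltW.
move=> e x x_start leg; rewrite /U /C.
case A : (alive i e x); last by rewrite mul0r mulr0 add0e; apply: step_mean_ge0 => ? ?; exact: U0.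
rewrite mul1r mulr1; set n := (n0 + i)%N.
have sm0 : (0 <= step_mean xi (2 * k) T0 n (U i.+1) e x)%E.
  by apply: step_mean_ge0 => ? ?; exact: U0.
set T' := tree_at (2 * k) T0 e x n.
have [ok|nok] := boolP (`[< on_class B dep (odd (dep v)) n T' (x n) >] && (x n != 0%N) &&
   (2 * k <= tip_degree v T')%N); last first.
  by rewrite /V /branch_value (negbTE nok) adde_ge0 // lee_fin ltW.
have /andP[/andP[/asboolP onx xn0] kT'] := ok.
apply: le_trans (branch_value_step (ltW mu0) mean_mu c_gt0 mean_c S0 rB vB v0 vleaf dep0 depS
  dep_root k_gt0 deep onx xn0 kT') _.
rewrite leeD2l // le_eqVlt; apply/orP; left; apply/eqP.
apply: eq_integral => u _; congr _%:E; rewrite /step_avg tree_at_upd -/T'.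
apply: eq_nbr_avg => y; rewrite /U aliveS addnS -/n upd_eq.
rewrite (_ : alive i _ _ = true); last first.
  rewrite -A; apply: adapted_alive => j ji; rewrite upd_neq // ltn_eqF //.
rewrite (@adapted_tree (2 * k)%N T0 n.+1 _ (upd e n (xi 1%N u)) _ x) //; last first.
  by move=> j ji; rewrite upd_neq // ltn_eqF.
rewrite tree_at_upd -/T' /=; case: eqP => [->|_]; last by rewrite mul1r.
by rewrite mul0r /V /branch_value eqxx andbF.
Qed.

(** At [n0] the walker is at the tip at a growth time, where the value is exactly the square-root
    potential of the degree. *)
Lemma survival_bound : (((fine (law W (state_event n0 T v))) * sqrt_potential S (tip_degree v T))%:E <=
  mu%:E * \sum_(i <oo) a i)%E.
Proof.
pose M := S ^+ 2 * (1 + (\sum_(u < nvert B) meet_height B v dep u)%N%:R).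
have M0 : 0 <= M by rewrite mulr_ge0 ?sqr_ge0 // addr_ge0.
have a0 i : (0 <= a i)%E by apply: integral_ge0 => w _; rewrite lee_fin.
have := @subsolution_bound R a (fun i => \int[law W]_w (U i (env W ^~ w) (walk W ^~ w))%:E)%E
  mu M mu0 M0 a0 _ U_step.
have -> : (\int[law W]_w (U 0 (env W ^~ w) (walk W ^~ w))%:E =
    ((fine (law W (state_event n0 T v))) * sqrt_potential S (tip_degree v T))%:E)%E.
  rewrite EFinM fineK ?fin_num_measure //; last exact: measurable_state_event.
  rewrite law_state_event muleC -ge0_integralZl //; last 2 first.
  - apply: (measurable_adapted (W := W) (n := n0) (m := n0.+1)
      (F := fun e x => ((state_ind (2 * k) T0 n0 T v e x)%:R)%:E)) => e e' x x' He Hx.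
    by rewrite (@adapted_state_ind (2 * k)%N T0 n0 T v e e' x x').
  - by rewrite lee_fin sqrt_potential_ge0.
  apply: eq_integral => w _; rewrite -EFinM; congr _%:E; rewrite /U alive0.
  case: (boolP (state_ind _ _ _ _ _ _ _)) => [/andP[/eqP ET /eqP Ev]|_]; last by rewrite mul0r mulr0.
  rewrite mul1r mulr1 addn0 ET Ev /V /branch_value asboolT ?v0 ?kT /near_tip ?eqxx /=.
    rewrite /tip_value wait0 ?mulr0 ?mul0r ?subr0 ?mul1r //.
    rewrite uphalf_half (negbTE n0_even) add0n.
    by move: n0k; rewrite -{1}(odd_double_half n0) (negbTE n0_even) add0n -mul2n dvdn_pmul2l.
  split.
  - by exists (nseq q v) => // u; rewrite mem_nseq => /andP[_ /eqP ->].
  - by rewrite nvert_cat ltn_addr.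
  - by rewrite /lvl vB oddD (negbTE n0_even) addbF.
apply => i; rewrite /a -ge0_integralZl //.
apply: ge0_le_integral => //.
- by move=> w _; rewrite lee_fin mulr_ge0.
- apply: (measurable_adapted (W := W) (n := (n0 + i)%N) (m := (n0 + i).+1)
    (F := fun e x => (U i e x)%:E)) => e e' x x' He Hx.
  by rewrite (@adapted_U i e e' x x').
- exact: measurable_funeM.
- move=> w _; rewrite -EFinM lee_fin mulrC /U ler_wpM2l //.
  by apply: branch_value_le.
Qed.

End Potential.

Lemma infinite_hitting :
  (cond_expectation (hitting_after n0 0 : Defs.space W -> \bar R) (state_event n0 T v) = +oo)%E.
Proof.
have law_fin : law W (state_event n0 T v) \is a fin_num.
  by rewrite fin_num_measure //; exact: measurable_state_event.
have L0 : 0 < fine (law W (state_event n0 T v)).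
  by rewrite fine_gt0 // att /= -ge0_fin_numE // measure_ge0.
have a0 i : (0 <= a i)%E by apply: integral_ge0 => w _; rewrite lee_fin.
rewrite /cond_expectation integral_mkcond.
under eq_integral do rewrite hitting_sum.
rewrite integral_nneseries //.
rewrite (_ : (\sum_(i <oo) _ = +oo)%E); first by rewrite gt0_muley // lte_fin invr_gt0.
set L := fine _ in L0; set D := tip_degree v T.
apply/eqyP => A A0.
have D0 : (0 < D)%N by apply: leq_trans kT; lia.
have r0 : 0 < Num.sqrt (D%:R : R) by rewrite sqrtr_gt0 ltr0n.
(* [S] solves [S * sqrt D - D = mu * A / L]. *)
pose S := (mu * A / L + D%:R) / Num.sqrt D%:R.
have S0 : 0 <= S.
  by rewrite divr_ge0 ?(ltW r0) // addr_ge0 // divr_ge0 ?(ltW L0) // mulr_ge0 ?ltW.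
have := survival_bound S0; rewrite -/L -/D => H.
rewrite -(@lee_pmul2l _ mu%:E) ?lte_fin // -EFinM; apply: le_trans H.
rewrite lee_fin; apply: (@le_trans _ _ (L * (mu * A / L))).
  by rewrite mulrCA mulfV ?gt_eqF // mulr1.
rewrite ler_pM2l // le_max; apply/orP; left.
by rewrite /S divfK ?gt_eqF // addrK.
Qed.

End Branch.

Lemma not_positive_recurrent : is_rtree T0 -> is_vertex T0 x0 -> ~ positive_recurrent W.
Proof.
move=> rT0 vx0 [_ pos].
(* [M] is a depth sufficient for [deep]. *)
have [M HM] : exists M : nat, 6 * k%:R / p <= M%:R.
  exists (Num.bound (6 * k%:R / p)); apply/ltW/archi_boundP.
  by rewrite divr_ge0 ?mulr_ge0 // ltW.
have s0 : (0 < 2 * k)%N by lia.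
have [n [B [v [rn sn [v0 vleaf vdeep]]]]] :=
  deep_leaf_reachable xi_iid c_gt0 p_gt0 mean_c W M s0 rT0 vx0.
(* [2 * k] rounds of [c >= 1] leaves give the tip at least [2 * k] edges. *)
have [n1 [r1 sn1]] := thicken xi_iid c_gt0 p_gt0 mean_c (2 * k) (erefl _) k_gt0 rn sn.
have [_ rB vB] := rn; have [att rT vT] := r1.
have [dep [dep0 [depS dep_root]]] := exists_depth rB.
have deep : 6 * k%:R <= p * (dep v)%:R.
  rewrite ler_pdivrMr // in HM; apply: (le_trans HM); rewrite mulrC ler_pM2l // ler_nat.
  rewrite leqNgt; apply/negP => lt_dep.
  by have := vdeep _ (leqW lt_dep); rewrite (proj1 (dep_root _ vB)).
have kq : (2 * k <= 2 * k * c)%N by rewrite leq_pmulr.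
have vert0 : is_vertex (B ++ nseq (2 * k * c) v) 0%N by [].
have := pos _ _ _ att 0%N vert0.
by rewrite (infinite_hitting rB vB v0 vleaf dep0 depS dep_root deep sn1 kq att) ltxx.
Qed.

End NotPositiveRecurrent.

Theorem theorem3p4 (R : realType) (d : measure_display)
    (OmegaE : measurableType d) (PE : probability OmegaE R)
    (xi : nat -> {RV PE >-> nat}) (k : nat) (mu : R)
    (k_ge1 : (1 <= k)%N)
    (xi_iid : iid xi)
    (mu_mean : ('E_PE[fun w => ((xi 1%N w)%:R)%R] = mu%:E)%E)
    (mu_gt0 : 0 < mu) :
  (forall (T0 : rtree) (x0 : nat), is_rtree T0 -> is_vertex T0 x0 ->
     forall W : TBRW xi (2 * k)%N T0 x0, null_recurrent W) /\
  (k%:R < mu ->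
     forall l : nat, (1 <= l)%N -> forall W : TBRW xi (2 * k)%N (star l) 0%N,
       expected_exit_time W = +oo%E) /\
  (PE [set w | xi 1%N w = k] = 1%E \/
   (k%:R = mu /\
    limn_esup (fun n : nat =>
      ((ln n%:R ^+ 2 / n%:R)%R%:E *
       lne (PE [set w | (n%:R / ln n%:R < (xi 1%N w)%:R :> R)%R]))%E) = -oo%E) ->
     forall l : nat, (1 <= l)%N -> forall W : TBRW xi (2 * k)%N (star l) 0%N,
       expected_exit_time W = +oo%E) /\
  (mu < k%:R ->
     (exists2 gamma : R, 0 < gamma &
        forall l : nat, (1 <= l)%N -> forall W : TBRW xi (2 * k)%N (star l) 0%N,
          ((gamma * l%:R)%:E <= expected_exit_time W)%E) /\
     ((exists2 eps : R, 0 < eps &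
         ('E_PE[fun w => ((xi 1%N w)%:R `^ (2 + eps))%R] < +oo)%E) ->
      exists c C : R, [/\ 0 < c, 0 < C &
        forall l : nat, (1 <= l)%N -> forall W : TBRW xi (2 * k)%N (star l) 0%N,
          ((c * l%:R)%:E <= expected_exit_time W)%E /\
          (expected_exit_time W <= (C * l%:R)%:E)%E])).
Proof.
have mean_mu : has_mean (xi 1%N) (fun j => j%:R) mu.
  by apply: ge0_has_mean => //; rewrite -mu_mean unlock.
split; [|split; [|split]].
- move=> T0 x0 rT0 vx0 W; have [c [c_gt0 [p p_gt0 mean_c]]] := pos_atom mean_mu mu_gt0.
  split.
    by apply: (recurrent_TBRW xi_iid (ltW mu_gt0) mean_mu _ rT0 vx0); rewrite oddM.
  exact: (not_positive_recurrent xi_iid mu_gt0 mean_mu c_gt0 p_gt0 mean_c k_ge1 rT0 vx0).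
- move=> k_mu l _ W; have [M [m1 [m2 [mean1 mean2 k_m1]]]] := truncated_mean mean_mu k_mu.
  apply: (star_exit_infinite xi_iid k_ge1 W _ mean1 mean2 k_m1) => j.
  exact: geq_minl.
(* In the first case the truncation sends values other than [k] to 0; in the second the environment
   is kept as it is. *)
- case=> [/mean_of_constant [mean1 mean2]|[k_mu /tail_of_limsup [N tail]]] l _ W.
    apply: (star_exit_infinite xi_iid k_ge1 W _ mean1 mean2 (lexx _)) => j.
    by case: eqP => [->|].
  have [m2 mean2] := second_moment_of_tail tail.
  apply: (star_exit_infinite xi_iid k_ge1 W (t := id) _ mean_mu mean2) => //.
  by rewrite k_mu.
- move=> mu_k.
  have lower l (W : TBRW xi (2 * k)%N (star l) 0%N) :
      ((1 * l%:R)%:E <= expected_exit_time W)%E.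
    apply: le_trans (star_exit_ge xi_iid k_ge1 W).
    by rewrite lee_fin mul1r -natrM ler_nat; lia.
  split; first by exists 1 => // l _ W; exact: lower.
  move=> _; exists 1, (2 * (k%:R / (k%:R - mu)) * (mu + 4)); split => //.
    by rewrite !mulr_gt0 ?invr_gt0 ?subr_gt0 ?ltr0n ?addr_gt0.
  move=> l l_ge1 W; split; first exact: lower.
  exact: (star_exit_le xi_iid k_ge1 W mean_mu (ltW mu_gt0) mu_k l_ge1).
Qed.
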